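(* Let $n>4$ be an integer. The universal enveloping algebra $U(\mathfrak{sl}(2n)[u]^{\widetilde{\tau}})$ is isomorphic to the associative algebra generated by $$\{H_{i,0},H_{j,1},X^\pm_{i,r}\mid 1\le i\le n,\ 1\le j\le n-1,\ r=0,1\}$$ with the relations (imposed for all indices for which the generators occurring exist; where $\pm$ occurs, all upper or all lower signs are taken) $$[H_{i,r},H_{j,s}]=0\quad(0\le r,s\le1),$$ $$[H_{i,r},X^\pm_{j,0}]=\pm a^{r}_{i,j}X^\pm_{j,r}\quad(r=0,1),$$ $$[X^+_{i,0},X^-_{j,0}]=\delta_{i,j}H_{i,0},$$ $$[X^+_{i,1},X^-_{i,0}]=H_{i,1}\quad(i\ne n),$$ $$[[X^+_{n-1,2},X^-_{n-1,0}],X^\pm_{n,0}]=0,\quad\text{where } X^+_{n-1,2}:=\tfrac12[H_{n-1,1},X^+_{n-1,1}],$$ $$[X^+_{n,1},X^-_{n,0}]=H_{n-1,1},$$ $$[X^\pm_{i,1},X^\pm_{i,0}]=[X^\pm_{i,0},X^\pm_{i,1}],$$ $$[X^\pm_{i,0},X^\pm_{j,0}]=0\quad(a_{i,j}=0),$$ $$[X^\pm_{i,0},[X^\pm_{i,0},X^\pm_{j,0}]]=0\quad(a_{i,j}=-1),$$ $$[X^\pm_{n,1},[X^\pm_{n-2,0},X^\pm_{n-1,0}]]=-[X^\pm_{n-1,0},[X^\pm_{n-2,0},X^\pm_{n,1}]],$$ $$[[X^\pm_{n,0},X^\pm_{n-2,0}],[X^\pm_{n,0},X^\pm_{n-1,1}]]=0,$$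 $$[[X^\pm_{n-1,0},X^\pm_{n-2,0}],[X^\pm_{n-1,0},X^\pm_{n,1}]]=0.$$
   Context: The ground field is $\mathbb{C}$, and $[x,y]=xy-yx$ in associative algebras. Let $I_n=\{\pm1,\dots,\pm n\}$ and let $\mathfrak{gl}(2n)=\bigoplus_{i,j\in I_n}\mathbb{C}E_{i,j}$, where $E_{i,j}$ are the matrix units. Let $\tau$ be the involution $\tau(E_{i,j})=-E_{-j,-i}$, which restricts to $\mathfrak{sl}(2n)$. On $\mathfrak{sl}(2n)[u]=\mathfrak{sl}(2n)\otimes\mathbb{C}[u]$ (with bracket $[x\otimes u^r,y\otimes u^s]=[x,y]\otimes u^{r+s}$) let $\widetilde{\tau}(x\otimes u^r)=(-1)^r\tau(x)\otimes u^r$, and put $\mathfrak{sl}(2n)[u]^{\widetilde{\tau}}=\{x\in\mathfrak{sl}(2n)[u]\mid\widetilde{\tau}(x)=x\}$. For $1\le i,j\le n$ let $a_{i,j}=2\delta_{i,j}-\delta_{i,j+1}-\delta_{i+1,j}$ if $i,j\le n-1$, and $a_{i,j}=2\delta_{i,j}-\delta_{i,n-2}-\delta_{j,n-2}$ if $i=n$ or $j=n$. For an integer $r\ge0$ let $a^r_{i,j}=a_{i,j}$ ($1\le i,j\le n$) if $r$ is even, and $a^r_{i,j}=a_{i,j}+2\delta_{i,n-1}\delta_{j,n}$ ($1\le i\le n-1$, $1\le j\le n$) if $r$ is odd. There is no generator $H_{n,1}$. *)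

(* Defs.v *)
From HB Require Import structures.
From mathcomp Require Import all_boot all_order all_algebra.
From mathcomp Require Import boolp reals complex ring.

Set Implicit Arguments.
Unset Strict Implicit.
Unset Printing Implicit Defensive.

Import GRing.Theory.
Local Open Scope ring_scope.
Local Open Scope quotient_scope.

(* Noncommutative polynomial expressions over [K] in letters from [X]. *)
Inductive expr (K X : Type) : Type :=
| Gen of X
| EZero
| EOne
| EOpp of expr K X
| EAdd of expr K X & expr K X
| EMul of expr K X & expr K X
| EScale of K & expr K X.

Arguments Gen {K X}.
Arguments EZero {K X}.
Arguments EOne {K X}.

Declare Scope expr_scope.
Delimit Scope expr_scope with E.
Bind Scope expr_scope with expr.

Notation "0" := EZero : expr_scope.
Notation "1" := EOne : expr_scope.
Notation "- a" := (EOpp a) : expr_scope.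
Notation "a + b" := (EAdd a b) : expr_scope.
Notation "a - b" := (EAdd a (EOpp b)) : expr_scope.
Notation "a * b" := (EMul a b) : expr_scope.
Notation "c *: a" := (EScale c%R a) : expr_scope.
Notation "[~ a , b ]" := (EAdd (EMul a b) (EOpp (EMul b a))) : expr_scope.

HB.instance Definition _ (K X : Type) := gen_eqMixin (expr K X).
HB.instance Definition _ (K X : Type) := gen_choiceMixin (expr K X).

Fixpoint expr_map (K X Y : Type) (f : X -> Y) (e : expr K X) : expr K Y :=
  (match e with
  | Gen x => Gen (f x)
  | EZero => 0
  | EOne => 1
  | EOpp a => - expr_map f a
  | EAdd a b => expr_map f a + expr_map f b
  | EMul a b => expr_map f a * expr_map f b
  | EScale c a => c *: expr_map f a
  end)%E.

Section Presentation.
Variables (K : fieldType) (X : Type) (rel : expr K X -> expr K X -> Prop).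

(* The smallest congruence containing [rel] and the axioms of unital
   associative [K]-algebras: quotienting the expressions by it amounts to
   quotienting the free algebra on [X] by the two-sided ideal generated by the
   differences [a - b] with [rel a b]. *)
Inductive cong : expr K X -> expr K X -> Prop :=
| cong_rel a b : rel a b -> cong a b
| cong_refl a : cong a a
| cong_sym a b : cong a b -> cong b a
| cong_trans a b c : cong a b -> cong b c -> cong a c
| cong_opp a a' : cong a a' -> cong (- a) (- a')
| cong_add a a' b b' : cong a a' -> cong b b' -> cong (a + b) (a' + b')
| cong_mul a a' b b' : cong a a' -> cong b b' -> cong (a * b) (a' * b')
| cong_scale c a a' : cong a a' -> cong (c *: a) (c *: a')
| cong_addA a b c : cong (a + (b + c)) (a + b + c)
| cong_addC a b : cong (a + b) (b + a)
| cong_add0 a : cong (0 + a) a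
| cong_addN a : cong (- a + a) 0
| cong_mulA a b c : cong (a * (b * c)) (a * b * c)
| cong_mul1l a : cong (1 * a) a
| cong_mul1r a : cong (a * 1) a
| cong_mulDl a b c : cong ((a + b) * c) (a * c + b * c)
| cong_mulDr a b c : cong (a * (b + c)) (a * b + a * c)
| cong_scaleA k l a : cong (k *: (l *: a)) ((k * l) *: a)
| cong_scale1 a : cong (1 *: a) a
| cong_scaleDr k a b : cong (k *: (a + b)) (k *: a + k *: b)
| cong_scaleDl k l a : cong ((k + l) *: a) (k *: a + l *: a)
| cong_scaleAl k a b : cong (k *: (a * b)) ((k *: a) * b)
| cong_scaleAr k a b : cong (k *: (a * b)) (a * (k *: b)).

Definition congb (a b : expr K X) : bool := `[< cong a b >].

Fact congb_refl : reflexive congb.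
Proof. by move=> a; apply/asboolP; exact: cong_refl. Qed.

Fact congb_sym : symmetric congb.
Proof. by move=> a b; apply/asboolP/asboolP; exact: cong_sym. Qed.

Fact congb_trans : transitive congb.
Proof.
by move=> b a c /asboolP ab /asboolP bc; apply/asboolP; exact: cong_trans bc.
Qed.

Canonical cong_equiv := EquivRel congb congb_refl congb_sym congb_trans.

Definition presented : Type := {eq_quot cong_equiv}.

HB.instance Definition _ := Choice.on presented.
HB.instance Definition _ := Quotient.on presented.

Definition cls (a : expr K X) : presented := \pi_presented a.

Lemma clsP a b : cls a = cls b <-> cong a b.
Proof.
split=> [/eqP|ab]; first by rewrite /cls eqmodE => /asboolP.
by apply/eqP; rewrite /cls eqmodE; apply/asboolP.
Qed.

Lemma cls_repr x : cls (repr x) = x.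
Proof. exact: reprK. Qed.

Lemma cls_ind (P : presented -> Prop) : (forall a, P (cls a)) -> forall x, P x.
Proof. by move=> Pcls x; rewrite -[x]cls_repr; exact: Pcls. Qed.

Lemma cong_repr a : cong (repr (cls a)) a.
Proof. by apply/clsP; exact: cls_repr. Qed.

Definition pr_opp (x : presented) := cls (- repr x)%E.
Definition pr_add (x y : presented) := cls (repr x + repr y)%E.
Definition pr_mul (x y : presented) := cls (repr x * repr y)%E.
Definition pr_scale (k : K) (x : presented) := cls (k *: repr x)%E.

Fact pr_oppE a : pr_opp (cls a) = cls (- a)%E.
Proof. by apply/clsP/cong_opp/cong_repr. Qed.
Fact pr_addE a b : pr_add (cls a) (cls b) = cls (a + b)%E.
Proof. by apply/clsP/cong_add; exact: cong_repr. Qed.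
Fact pr_mulE a b : pr_mul (cls a) (cls b) = cls (a * b)%E.
Proof. by apply/clsP/cong_mul; exact: cong_repr. Qed.
Fact pr_scaleE k a : pr_scale k (cls a) = cls (k *: a)%E.
Proof. by apply/clsP/cong_scale/cong_repr. Qed.

Fact pr_addA : associative pr_add.
Proof.
elim/cls_ind=> a; elim/cls_ind=> b; elim/cls_ind=> c.
by rewrite !pr_addE; apply/clsP/cong_addA.
Qed.
Fact pr_addC : commutative pr_add.
Proof.
by elim/cls_ind=> a; elim/cls_ind=> b; rewrite !pr_addE; apply/clsP/cong_addC.
Qed.
Fact pr_add0 : left_id (cls 0%E) pr_add.
Proof. by elim/cls_ind=> a; rewrite pr_addE; apply/clsP/cong_add0. Qed.
Fact pr_addN : left_inverse (cls 0%E) pr_opp pr_add.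
Proof. by elim/cls_ind=> a; rewrite pr_oppE pr_addE; apply/clsP/cong_addN. Qed.

HB.instance Definition _ :=
  GRing.isZmodule.Build presented pr_addA pr_addC pr_add0 pr_addN.

Fact pr_mulA : associative pr_mul.
Proof.
elim/cls_ind=> a; elim/cls_ind=> b; elim/cls_ind=> c.
by rewrite !pr_mulE; apply/clsP/cong_mulA.
Qed.
Fact pr_mul1l : left_id (cls 1%E) pr_mul.
Proof. by elim/cls_ind=> a; rewrite pr_mulE; apply/clsP/cong_mul1l. Qed.
Fact pr_mul1r : right_id (cls 1%E) pr_mul.
Proof. by elim/cls_ind=> a; rewrite pr_mulE; apply/clsP/cong_mul1r. Qed.
Fact pr_mulDl : left_distributive pr_mul pr_add.
Proof.
elim/cls_ind=> a; elim/cls_ind=> b; elim/cls_ind=> c.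
by rewrite !(pr_mulE, pr_addE); apply/clsP/cong_mulDl.
Qed.
Fact pr_mulDr : right_distributive pr_mul pr_add.
Proof.
elim/cls_ind=> a; elim/cls_ind=> b; elim/cls_ind=> c.
by rewrite !(pr_mulE, pr_addE); apply/clsP/cong_mulDr.
Qed.

(* A presented algebra may be zero, so it is a [pzRingType] with a [K]-module
   structure rather than an [algType], whose instances are nonzero rings. *)
HB.instance Definition _ := GRing.Zmodule_isPzRing.Build presented
  pr_mulA pr_mul1l pr_mul1r pr_mulDl pr_mulDr.

Fact pr_scaleA k l x : pr_scale k (pr_scale l x) = pr_scale (k * l) x.
Proof. by elim/cls_ind: x => a; rewrite !pr_scaleE; apply/clsP/cong_scaleA. Qed.
Fact pr_scale1 : left_id 1 pr_scale.
Proof. by elim/cls_ind=> a; rewrite pr_scaleE; apply/clsP/cong_scale1. Qed.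
Fact pr_scaleDr : right_distributive pr_scale +%R.
Proof.
move=> k; elim/cls_ind=> a; elim/cls_ind=> b; rewrite /GRing.add /=.
by rewrite !(pr_addE, pr_scaleE); apply/clsP/cong_scaleDr.
Qed.
Fact pr_scaleDl x : {morph pr_scale^~ x : k l / k + l}.
Proof.
elim/cls_ind: x => a k l; rewrite [RHS]/GRing.add /=.
by rewrite !(pr_addE, pr_scaleE); apply/clsP/cong_scaleDl.
Qed.

HB.instance Definition _ := GRing.Zmodule_isLmodule.Build K presented
  pr_scaleA pr_scale1 pr_scaleDr pr_scaleDl.

Lemma pr_scaleAl (k : K) (x y : presented) : k *: (x * y) = (k *: x) * y.
Proof.
elim/cls_ind: x => a; elim/cls_ind: y => b.
rewrite /GRing.scale /GRing.mul /= !(pr_mulE, pr_scaleE).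
by apply/clsP/cong_scaleAl.
Qed.

Lemma pr_scaleAr (k : K) (x y : presented) : k *: (x * y) = x * (k *: y).
Proof.
elim/cls_ind: x => a; elim/cls_ind: y => b.
rewrite /GRing.scale /GRing.mul /= !(pr_mulE, pr_scaleE).
by apply/clsP/cong_scaleAr.
Qed.

Lemma clsN a : cls (- a)%E = - cls a. Proof. by rewrite -pr_oppE. Qed.
Lemma clsD a b : cls (a + b)%E = cls a + cls b. Proof. by rewrite -pr_addE. Qed.
Lemma clsM a b : cls (a * b)%E = cls a * cls b. Proof. by rewrite -pr_mulE. Qed.
Lemma clsZ k a : cls (k *: a)%E = k *: cls a. Proof. by rewrite -pr_scaleE. Qed.
Lemma cls0 : cls 0%E = 0. Proof. by []. Qed.
Lemma cls1 : cls 1%E = 1. Proof. by []. Qed.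

Section UniversalProperty.
Variables (A : algType K) (phi : X -> A).

Fixpoint eval (e : expr K X) : A :=
  match e with
  | Gen x => phi x
  | EZero => 0
  | EOne => 1
  | EOpp a => - eval a
  | EAdd a b => eval a + eval b
  | EMul a b => eval a * eval b
  | EScale c a => c *: eval a
  end.

Hypothesis phi_rel : forall a b, rel a b -> eval a = eval b.

Lemma eval_cong a b : cong a b -> eval a = eval b.
Proof.
elim=> {a b} //=; first by move=> a b c _ -> _ ->.
- by move=> a a' _ ->.
- by move=> a a' b b' _ -> _ ->.
- by move=> a a' b b' _ -> _ ->.
- by move=> c a a' _ ->.
- by move=> a b c; rewrite addrA.
- by move=> a b; rewrite addrC.
- by move=> a; rewrite add0r.
- by move=> a; rewrite addNr.
- by move=> a b c; rewrite mulrA.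
- by move=> a; rewrite mul1r.
- by move=> a; rewrite mulr1.
- by move=> a b c; rewrite mulrDl.
- by move=> a b c; rewrite mulrDr.
- by move=> k l a; rewrite scalerA.
- by move=> a; rewrite scale1r.
- by move=> k a b; rewrite scalerDr.
- by move=> k l a; rewrite scalerDl.
- by move=> k a b; rewrite scalerAl.
- by move=> k a b; rewrite scalerAr.
Qed.

Definition lift (x : presented) : A := eval (repr x).

Lemma lift_cls a : lift (cls a) = eval a.
Proof. exact/eval_cong/cong_repr. Qed.

Lemma lift_linear : linear lift.
Proof.
move=> k; elim/cls_ind=> a; elim/cls_ind=> b.
by rewrite -clsZ -clsD !lift_cls.
Qed.

HB.instance Definition _ :=
  GRing.isLinear.Build K presented A _ lift lift_linear.

Lemma lift_monoid_morphism : monoid_morphism lift.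
Proof.
split; first by rewrite -cls1 lift_cls.
by elim/cls_ind=> a; elim/cls_ind=> b; rewrite -clsM !lift_cls.
Qed.

Theorem presented_universal :
  exists2 f : {linear presented -> A},
    monoid_morphism f /\ (forall x, f (cls (Gen x)) = phi x) &
    forall g : {linear presented -> A},
      monoid_morphism g -> (forall x, g (cls (Gen x)) = phi x) -> g =1 f.
Proof.
exists lift.
  by split=> [|x]; [exact: lift_monoid_morphism | exact: lift_cls].
move=> g [g1 gM] gx; elim/cls_ind=> a; rewrite [RHS]lift_cls.
elim: a => [x|||a IHa|a IHa b IHb|a IHa b IHb|c a IHa] /=.
- exact: gx.
- exact: raddf0.
- exact: g1.
- by rewrite clsN -IHa; exact: raddfN.
- by rewrite clsD -IHa -IHb; exact: raddfD.
- by rewrite clsM gM IHa IHb.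
- by rewrite clsZ -IHa; exact: linearZ.
Qed.

End UniversalProperty.
End Presentation.

HB.mixin Record Lmodule_isLieAlgebra (K : fieldType) L of GRing.Lmodule K L := {
  lie : L -> L -> L;
  lie_linearl : forall (c : K) x y z, lie (c *: x + y) z = c *: lie x z + lie y z;
  lie_linearr : forall (c : K) x y z, lie z (c *: x + y) = c *: lie z x + lie z y;
  liexx : forall x, lie x x = 0;
  lie_jacobi : forall x y z,
    lie x (lie y z) + lie y (lie z x) + lie z (lie x y) = 0
}.

#[short(type="lieAlgType")]
HB.structure Definition LieAlgebra (K : fieldType) :=
  {L of GRing.Lmodule K L & Lmodule_isLieAlgebra K L}.

(* The first two families make [Gen] linear, which turns the free algebra on
   the set [L] into the tensor algebra of the vector space [L]. *)
Inductive uea_rel (K : fieldType) (L : lieAlgType K) :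
  expr K L -> expr K L -> Prop :=
| uea_add (x y : L) : uea_rel (Gen (x + y)) (Gen x + Gen y)
| uea_scale (c : K) (x : L) : uea_rel (Gen (c *: x)) (c *: Gen x)
| uea_lie (x y : L) : uea_rel (Gen (lie x y)) [~ Gen x, Gen y].

Definition uea (K : fieldType) (L : lieAlgType K) : Type :=
  presented (@uea_rel K L).

HB.instance Definition _ (K : fieldType) (L : lieAlgType K) :=
  GRing.PzRing.on (uea L).
HB.instance Definition _ (K : fieldType) (L : lieAlgType K) :=
  GRing.Lmodule.on (uea L).

Section TwistedCurrent.
Variables (K : fieldType) (n : nat).

(* ['I_(2 * n)] stands for [I_n] listed in increasing order
   -n < ... < -1 < 1 < ... < n, so that [i |-> -i] is [rev_ord].  The matrix
   unit [E_{i,j}] is [delta_mx i j]. *)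
Definition tau (R : pzRingType) (A : 'M[R]_(2 * n)) : 'M[R]_(2 * n) :=
  \matrix_(i, j) - A (rev_ord j) (rev_ord i).

Lemma tau_delta (R : pzRingType) (i j : 'I_(2 * n)) :
  tau (delta_mx i j : 'M[R]_(2 * n)) = - delta_mx (rev_ord j) (rev_ord i).
Proof.
apply/matrixP=> k l; rewrite !mxE andbC.
by rewrite !(can2_eq (@rev_ordK _) (@rev_ordK _)).
Qed.

(* [gl(2n)[u]] is the Lie algebra of [2n x 2n] matrices over [C[u]]. *)
Definition comm_br (R : pzRingType) m (A B : 'M[R]_m) : 'M[R]_m :=
  A *m B - B *m A.

Definition tens (x : 'M[K]_(2 * n)) (r : nat) : 'M[{poly K}]_(2 * n) :=
  map_mx (fun c => c *: 'X^r) x.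

Definition coefmx (r : nat) (A : 'M[{poly K}]_(2 * n)) : 'M[K]_(2 * n) :=
  map_mx (fun p : {poly K} => p`_r) A.

(* [tau] on the matrices, combined with the substitution [u |-> - u]. *)
Definition ttau (A : 'M[{poly K}]_(2 * n)) : 'M[{poly K}]_(2 * n) :=
  map_mx (fun p : {poly K} => p \Po (- 'X)) (tau A).

Fact comp_polyN (p q : {poly K}) : (- p) \Po q = - (p \Po q).
Proof. exact: raddfN. Qed.

Lemma ttau_tens x r : ttau (tens x r) = tens ((-1) ^+ r *: tau x) r.
Proof.
apply/matrixP=> i j; rewrite !mxE mulrN scaleNr comp_polyN comp_polyZ.
congr (- _); rewrite [_ * x _ _]mulrC -scalerA; congr (_ *: _).
by rewrite comp_Xn_poly [LHS]exprNn -mul_polyC polyC_exp polyCN.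
Qed.

Lemma comm_br_tens x y r s :
  comm_br (tens x r) (tens y s) = tens (comm_br x y) (r + s).
Proof.
apply/matrixP=> i j; rewrite !mxE scalerBl !scaler_suml.
by congr (_ - _); apply: eq_bigr => k _;
  rewrite !mxE -scalerAl -scalerAr scalerA -exprD 1?(addnC s).
Qed.

Lemma tens_sum (A : 'M[{poly K}]_(2 * n)) N :
  (forall i j, size (A i j) <= N)%N ->
  A = \sum_(r < N) tens (coefmx r A) r.
Proof.
move=> szA; apply/matrixP=> i j; rewrite summxE.
rewrite {1}(_ : A i j = \poly_(r < N) (A i j)`_r); last first.
  apply/polyP=> r; rewrite coef_poly; case: ltnP => // Nr.
  by rewrite nth_default // (leq_trans (szA i j)).
by rewrite poly_def; apply: eq_bigr => r _; rewrite !mxE.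
Qed.

Lemma trace_coefmx (A : 'M[{poly K}]_(2 * n)) :
  \tr A = 0 <-> forall r, \tr (coefmx r A) = 0.
Proof.
have trE r : \tr (coefmx r A) = (\tr A)`_r.
  by rewrite /mxtrace coef_sum; apply: eq_bigr => i _; rewrite mxE.
split=> [trA r|trA]; first by rewrite trE trA coef0.
by apply/polyP=> r; rewrite -trE trA coef0.
Qed.

Definition in_twisted : pred 'M[{poly K}]_(2 * n) :=
  [pred A | (\tr A == 0) && (ttau A == A)].

(* [sl(2n)[u]^ttau] *)
Record twisted : Type := Twisted {
  twisted_val : 'M[{poly K}]_(2 * n);
  _ : twisted_val \in in_twisted }.

HB.instance Definition _ := [isSub for twisted_val].
HB.instance Definition _ := [Choice of twisted by <:].

Lemma ttau_linear c A B : ttau (c%:P *: A + B) = c%:P *: ttau A + ttau B.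
Proof.
apply/matrixP=> i j.
by rewrite !mxE opprD comp_polyD !comp_polyN comp_polyM comp_polyC mulrN.
Qed.

Lemma ttauB A B : ttau (A - B) = ttau A - ttau B.
Proof.
have := ttau_linear (-1) B A.
by rewrite rmorphN1 !scaleN1r addrC (addrC (- _)).
Qed.

Lemma ttauM A B : ttau (A *m B) = - (ttau B *m ttau A).
Proof.
apply/matrixP=> i j; rewrite !mxE comp_polyN rmorph_sum; congr (- _).
rewrite (reindex_inj rev_ord_inj); apply: eq_bigr => k _ /=.
by rewrite !mxE rmorphM !comp_polyN mulrNN mulrC.
Qed.

Lemma ttau_comm_br A B : ttau (comm_br A B) = comm_br (ttau A) (ttau B).
Proof. by rewrite ttauB !ttauM opprK addrC. Qed.

Fact in_twistedP c A B : A \in in_twisted -> B \in in_twisted ->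
  c%:P *: A + B \in in_twisted.
Proof.
rewrite !inE => /andP[/eqP trA /eqP tA] /andP[/eqP trB /eqP tB].
by rewrite ttau_linear tA tB mxtraceD mxtraceZ trA trB mulr0 addr0 !eqxx.
Qed.

Fact in_twisted0 : 0 \in in_twisted.
Proof.
rewrite inE mxtrace0 eqxx /=; apply/eqP/matrixP=> i j.
by rewrite !mxE oppr0 comp_poly0.
Qed.

Fact in_twisted_zmod : zmod_closed in_twisted.
Proof.
split=> [|A B Atw Btw]; first exact: in_twisted0.
by rewrite addrC -scaleN1r -(rmorphN1 (@polyC K)) in_twistedP.
Qed.

HB.instance Definition _ := GRing.isZmodClosed.Build _ in_twisted in_twisted_zmod.
HB.instance Definition _ := [SubChoice_isSubZmodule of twisted by <:].

Fact twisted_scale_proof (c : K) (x : twisted) :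
  c%:P *: val x \in in_twisted.
Proof. by rewrite -[_ *: _]addr0 in_twistedP ?in_twisted0 ?(valP x). Qed.

Definition twisted_scale c x := Twisted (twisted_scale_proof c x).

Fact twisted_scaleA c d x :
  twisted_scale c (twisted_scale d x) = twisted_scale (c * d) x.
Proof. by apply: val_inj; rewrite /= scalerA polyCM. Qed.
Fact twisted_scale1 : left_id 1 twisted_scale.
Proof. by move=> x; apply: val_inj; rewrite /= scale1r. Qed.
Fact twisted_scaleDr : right_distributive twisted_scale +%R.
Proof. by move=> c x y; apply: val_inj; rewrite /= scalerDr. Qed.
Fact twisted_scaleDl x : {morph twisted_scale^~ x : c d / c + d}.
Proof. by move=> c d; apply: val_inj; rewrite /= polyCD scalerDl. Qed.

HB.instance Definition _ := GRing.Zmodule_isLmodule.Build K twisted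
  twisted_scaleA twisted_scale1 twisted_scaleDr twisted_scaleDl.

Fact twisted_lie_proof (x y : twisted) :
  comm_br (val x) (val y) \in in_twisted.
Proof.
have /andP[_ /eqP tx] := valP x; have /andP[_ /eqP ty] := valP y.
by rewrite inE ttau_comm_br tx ty eqxx andbT raddfB /= mxtrace_mulC subrr.
Qed.

Definition twisted_lie x y := Twisted (twisted_lie_proof x y).

Fact twisted_lie_linearl (c : K) x y z :
  twisted_lie (c *: x + y) z = c *: twisted_lie x z + twisted_lie y z.
Proof.
apply: val_inj; rewrite /= /comm_br mulmxDl mulmxDr -scalemxAl -scalemxAr.
by rewrite scalerBr opprD addrACA.
Qed.
Fact twisted_liexx x : twisted_lie x x = 0.
Proof. by apply: val_inj; rewrite /= /comm_br subrr. Qed.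
Fact twisted_lie_linearr (c : K) x y z :
  twisted_lie z (c *: x + y) = c *: twisted_lie z x + twisted_lie z y.
Proof.
apply: val_inj; rewrite /= /comm_br mulmxDl mulmxDr -scalemxAl -scalemxAr.
by rewrite scalerBr opprD addrACA.
Qed.
Fact twisted_jacobi x y z :
  twisted_lie x (twisted_lie y z) + twisted_lie y (twisted_lie z x)
    + twisted_lie z (twisted_lie x y) = 0.
Proof.
apply: val_inj; rewrite /= /comm_br !(mulmxBl, mulmxBr, mulmxA).
move: (val x) (val y) (val z) => A B C; rewrite !opprB.
set abc := A *m B *m C; set acb := A *m C *m B; set bac := B *m A *m C.
set bca := B *m C *m A; set cab := C *m A *m B; set cba := C *m B *m A.
by apply/matrixP=> i j; rewrite !mxE; ring.
Qed.

HB.instance Definition _ := Lmodule_isLieAlgebra.Build K twisted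
  twisted_lie_linearl twisted_lie_linearr twisted_liexx twisted_jacobi.

End TwistedCurrent.

Section DrinfeldPresentation.
Variables (K : fieldType) (n : nat).

Definition cartan (i j : nat) : int :=
  if (i <= n - 1)%N && (j <= n - 1)%N then
    2 * (i == j)%:Z - (i == j + 1)%N%:Z - (i + 1 == j)%N%:Z
  else 2 * (i == j)%:Z - (i == n - 2)%N%:Z - (j == n - 2)%N%:Z.

Definition cartanr (r i j : nat) : int :=
  if odd r then cartan i j + 2 * (i == n - 1)%N%:Z * (j == n)%:Z
  else cartan i j.

(* Symbols with unrestricted indices; in [GX s i r] the sign is [+] when [s] is
   [true] and [-] when [s] is [false]. *)
Inductive symbol : Type :=
| GH of nat & nat
| GX of bool & nat & nat.

Definition is_gen (g : symbol) : bool :=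
  match g with
  | GH i 0 => (1 <= i <= n)%N
  | GH i 1 => (1 <= i <= n - 1)%N
  | GX _ i r => (1 <= i <= n)%N && (r <= 1)%N
  | _ => false
  end.

Definition gen : Type := {g : symbol | is_gen g}.

Definition EH (i r : nat) : expr K symbol := Gen (GH i r).
Definition EX (s : bool) (i r : nat) : expr K symbol := Gen (GX s i r).
Definition with_sign (s : bool) (z : int) : K := (if s then z else - z)%:~R.

Inductive sym_rel : expr K symbol -> expr K symbol -> Prop :=
| rel_HH i j r s :
    sym_rel [~ EH i r, EH j s] 0
| rel_HX p i j r :
    sym_rel [~ EH i r, EX p j 0] (with_sign p (cartanr r i j) *: EX p j r)
| rel_XX i j :
    sym_rel [~ EX true i 0, EX false j 0] ((i == j)%:R *: EH i 0)
| rel_X1X i : i != n ->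
    sym_rel [~ EX true i 1, EX false i 0] (EH i 1)
| rel_X2 p :
    let X2 := (2^-1 *: [~ EH (n - 1) 1, EX true (n - 1) 1])%E in
    sym_rel [~ [~ X2, EX false (n - 1) 0], EX p n 0] 0
| rel_XnXn :
    sym_rel [~ EX true n 1, EX false n 0] (EH (n - 1) 1)
| rel_X1X0 p i :
    sym_rel [~ EX p i 1, EX p i 0] [~ EX p i 0, EX p i 1]
| rel_serre0 p i j : cartan i j = 0 ->
    sym_rel [~ EX p i 0, EX p j 0] 0
| rel_serre1 p i j : cartan i j = -1 ->
    sym_rel [~ EX p i 0, [~ EX p i 0, EX p j 0]] 0
| rel_end1 p :
    sym_rel [~ EX p n 1, [~ EX p (n - 2) 0, EX p (n - 1) 0]]
            (- [~ EX p (n - 1) 0, [~ EX p (n - 2) 0, EX p n 1]])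
| rel_end2 p :
    sym_rel [~ [~ EX p n 0, EX p (n - 2) 0], [~ EX p n 0, EX p (n - 1) 1]] 0
| rel_end3 p :
    sym_rel [~ [~ EX p (n - 1) 0, EX p (n - 2) 0], [~ EX p (n - 1) 0, EX p n 1]] 0.

(* A relation is imposed exactly when every symbol it involves is a generator:
   only then are both its sides in the image of [expr_map val]. *)
Definition gen_rel (a b : expr K gen) : Prop :=
  sym_rel (expr_map val a) (expr_map val b).

Definition drinfeld_alg : Type := presented gen_rel.

HB.instance Definition _ := GRing.PzRing.on drinfeld_alg.
HB.instance Definition _ := GRing.Lmodule.on drinfeld_alg.

End DrinfeldPresentation.

(* Main.v *)
(* Write [F_{i,j}(c) = E_{i,j} c(u) - E_{-j,-i} c(-u)].  Sending the generators
   to [F]'s at the simple root positions gives a morphism from the presented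
   algebra D to the enveloping algebra, by matrix computations.

   Conversely, view D as a Lie algebra under the commutator.  Its generators of
   level 0 satisfy the Serre relations of [so(2n)]; a copy [G] of [so(2n)] is
   built in D by adjoining the indices +-m for decreasing m, each step adding
   the vector representations generated by the two new simple root vectors.
   The [H_{a,1}] are the differences [t_a - t_{a+1}] of elements [t_a] of sum 0.
   The relations force [t_a] to commute with [G_{i,j}] when [a] is neither
   [|i|] nor [|j|], hence [ad t_i] and [- ad t_j] agree on [F_{i,j}], and their
   iterates define the elements of all levels.  The resulting linear map rho from
   matrices over K[u] to D satisfies [rho [Z, W] = [rho Z, rho W]] when [Z] has
   level 0 or is an odd diagonal matrix.  The matrices [Z] with this property for
   all [W] form a Lie algebra, and the former ones generate sl(2n)[u]^ttau.
   The two morphisms are inverse to each other because they are on generators. *)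

From HB Require Import structures.
Require Import Defs.
From mathcomp Require Import all_boot all_order all_algebra reals complex.
From mathcomp Require Import zify ring.

Set Implicit Arguments.
Unset Strict Implicit.
Unset Printing Implicit Defensive.

Import GRing.Theory.
Local Open Scope ring_scope.

(** The relations give no direct access to the bracket of two elements of positive level, and no
    full table of such brackets is computed in D. Brackets with level 0 elements and with [t a] are
    enough, and most of them come from level 0 identities by applying some [t a] that commutes with
    one factor. Where no [t a] separates the factors, a root vector is split through a further
    index; [4 < n] guarantees one outside any four absolute values. Two kinds of elements are not
    iterates of [ad t]: the diagonal ones, and those at [(i, - i)], where the contributions of the
    two ends cancel. They are defined by brackets. That the diagonal ones commute with the [t a]
    takes an argument in characteristic 0 on all splittings of a level at once. Only differences of
    diagonal matrix units are traceless. The diagonal is therefore normalised to vanish at index 1,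
    and the resulting error terms cancel on traceless matrices. Likewise the [H_{a,1}] determine the
    [t_a] only up to a common summand, which is why their sum is prescribed. *)

(* A reflexive decision procedure for equalities in abelian groups. *)
Inductive zterm := ZVar of nat | ZZero | ZOpp of zterm | ZAdd of zterm & zterm.

Section ZmoduleReflection.
Variable V : zmodType.

Fixpoint zeval (env : seq V) (t : zterm) : V :=
  match t with
  | ZVar i => env`_i
  | ZZero => 0
  | ZOpp a => - zeval env a
  | ZAdd a b => zeval env a + zeval env b
  end.

Fixpoint zcoef (t : zterm) (i : nat) : int :=
  match t with
  | ZVar j => if i == j then 1 else 0
  | ZZero => 0
  | ZOpp a => - zcoef a i
  | ZAdd a b => zcoef a i + zcoef b i
  end.

Lemma zevalE env t : zeval env t = \sum_(i < size env) env`_i *~ zcoef t i.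
Proof.
elim: t => [j||a IHa|a IHa b IHb] /=.
- case: (ltnP j (size env)) => [lt_j|le_j].
    rewrite (bigD1 (Ordinal lt_j)) //= eqxx mulr1z big1 ?addr0 // => i.
    by rewrite -val_eqE /= => /negbTE ->; rewrite mulr0z.
  rewrite nth_default // big1 // => i _.
  by rewrite ltn_eqF ?mulr0z // (leq_trans (ltn_ord i)).
- by rewrite big1 // => i _; rewrite mulr0z.
- by rewrite IHa -sumrN; apply: eq_bigr => i _; rewrite mulrNz.
- by rewrite IHa IHb -big_split; apply: eq_bigr => i _; rewrite mulrzDr.
Qed.

Lemma zeval_eq env a b :
  all (fun i => zcoef a i == zcoef b i) (iota 0 (size env)) ->
  zeval env a = zeval env b.
Proof.
move=> /allP eq_ab; rewrite !zevalE; apply: eq_bigr => i _.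
by rewrite (eqP (eq_ab (val i) _)) // mem_iota ltn_ord.
Qed.

End ZmoduleReflection.

Ltac zmember x l :=
  lazymatch l with
  | nil => constr:(false)
  | cons ?y ?l' =>
    match constr:(tt) with
    | _ => let _ := match constr:(tt) with _ => unify x y end in constr:(true)
    | _ => zmember x l'
    end
  end.
Ltac zcollect t l :=
  lazymatch t with
  | 0 => l
  | - ?a => zcollect a l
  | ?a + ?b => let l' := zcollect a l in zcollect b l'
  | ?a *+ 2 => zcollect a l
  | _ => let m := zmember t l in
         lazymatch m with true => l | false => constr:(cons t l) end
  end.
Ltac zindex x l :=
  lazymatch l with
  | cons ?y ?l' =>
    match constr:(tt) with
    | _ => let _ := match constr:(tt) with _ => unify x y end in constr:(0%N)
    | _ => let k := zindex x l' in constr:(S k)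
    end
  end.
Ltac zreify t l :=
  lazymatch t with
  | 0 => constr:(ZZero)
  | - ?a => let a' := zreify a l in constr:(ZOpp a')
  | ?a + ?b => let a' := zreify a l in let b' := zreify b l in
               constr:(ZAdd a' b')
  | ?a *+ 2 => let a' := zreify a l in constr:(ZAdd a' a')
  | _ => let k := zindex t l in constr:(ZVar k)
  end.
Ltac zmodule :=
  lazymatch goal with
  | |- @eq ?V ?a ?b =>
    let l0 := zcollect a (@nil V) in
    let l := zcollect b l0 in
    let a' := zreify a l in
    let b' := zreify b l in
    exact: (@zeval_eq _ l a' b' isT)
  end.


Local Notation "[~ x , y ]" := (lie x y) : ring_scope.

(** * Calculus of brackets in a Lie algebra *)

Section LieAlgebra.
Variables (K : fieldType) (L : lieAlgType K).
Implicit Types x y z : L.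

Lemma lieDl x y z : [~ x + y, z] = [~ x, z] + [~ y, z].
Proof. by have := lie_linearl 1 x y z; rewrite !scale1r. Qed.

Lemma lieDr x y z : [~ z, x + y] = [~ z, x] + [~ z, y].
Proof. by have := lie_linearr 1 x y z; rewrite !scale1r. Qed.

Lemma lie0l x : [~ 0, x] = 0.
Proof. by apply: (addrI [~ 0, x]); rewrite -lieDl !addr0. Qed.

Lemma lie0r x : [~ x, 0] = 0.
Proof. by apply: (addrI [~ x, 0]); rewrite -lieDr !addr0. Qed.

Lemma lieZl c x y : [~ c *: x, y] = c *: [~ x, y].
Proof. by have := lie_linearl c x 0 y; rewrite lie0l !addr0. Qed.

Lemma lieZr c x y : [~ x, c *: y] = c *: [~ x, y].
Proof. by have := lie_linearr c y 0 x; rewrite lie0r !addr0. Qed.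

Lemma lieNl x y : [~ - x, y] = - [~ x, y].
Proof. by rewrite -scaleN1r lieZl scaleN1r. Qed.

Lemma lieNr x y : [~ x, - y] = - [~ x, y].
Proof. by rewrite -scaleN1r lieZr scaleN1r. Qed.

Lemma lieBl x y z : [~ x - y, z] = [~ x, z] - [~ y, z].
Proof. by rewrite lieDl lieNl. Qed.

Lemma lieBr x y z : [~ z, x - y] = [~ z, x] - [~ z, y].
Proof. by rewrite lieDr lieNr. Qed.

Lemma lieMnl x y k : [~ x *+ k, y] = [~ x, y] *+ k.
Proof. by rewrite -!scaler_nat lieZl. Qed.

Lemma lieMnr x y k : [~ x, y *+ k] = [~ x, y] *+ k.
Proof. by rewrite -!scaler_nat lieZr. Qed.

Lemma lie_suml I (r : seq I) (P : pred I) (F : I -> L) x :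
  [~ \sum_(i <- r | P i) F i, x] = \sum_(i <- r | P i) [~ F i, x].
Proof. exact: (big_morph (fun y => [~ y, x]) (fun y z => lieDl y z x) (lie0l x)). Qed.

Lemma lie_sumr I (r : seq I) (P : pred I) (F : I -> L) x :
  [~ x, \sum_(i <- r | P i) F i] = \sum_(i <- r | P i) [~ x, F i].
Proof. exact: (big_morph _ (fun y z => lieDr y z x) (lie0r x)). Qed.

Lemma lieC x y : [~ x, y] = - [~ y, x].
Proof.
apply/eqP; rewrite -addr_eq0; apply/eqP.
by have := liexx (x + y); rewrite lieDl !lieDr !liexx add0r addr0.
Qed.

Lemma lie_eq0C x y : [~ x, y] = 0 -> [~ y, x] = 0.
Proof. by move=> xy; rewrite lieC xy oppr0. Qed.

Lemma lie_lier x y z : [~ x, [~ y, z]] = [~ [~ x, y], z] + [~ y, [~ x, z]].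
Proof.
have := lie_jacobi x y z; rewrite (lieC z [~ x, y]) (lieC z x) lieNr => /eqP.
by rewrite subr_eq0 => /eqP <-; zmodule.
Qed.

Lemma lie_liel x y z : [~ [~ x, y], z] = [~ [~ x, z], y] + [~ x, [~ y, z]].
Proof. by rewrite (lie_lier x y z) (lieC y [~ x, z]); zmodule. Qed.

Lemma commute_lie t x y : [~ t, x] = 0 -> [~ t, y] = 0 -> [~ t, [~ x, y]] = 0.
Proof. by move=> tx ty; rewrite lie_lier tx ty lie0l lie0r addr0. Qed.

Hypothesis charK : [pchar K] =i pred0.

Lemma mulrn_eq0_lie x k : (0 < k)%N -> x *+ k = 0 -> x = 0.
Proof.
move=> k_gt0 /eqP; rewrite -scaler_nat scaler_eq0 => /orP[|/eqP//].
by rewrite (iffLR (pcharf0P K) charK) eqn0Ngt k_gt0.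
Qed.

Lemma double_eq0 x : x + x = 0 -> x = 0.
Proof. by rewrite -mulr2n; exact: mulrn_eq0_lie. Qed.

Lemma eq_opp_eq0 x : x = - x -> x = 0.
Proof. by move=> xN; apply: double_eq0; rewrite {2}xN subrr. Qed.

End LieAlgebra.

(** Evaluates the Kronecker symbols that [lia] can decide from the inequalities between indices in
    the context. *)
Ltac deltas :=
  repeat match goal with
  | |- context [@eq_op ?T ?a ?b] =>
    first [ rewrite (_ : @eq_op T a b = false); [|lia]
          | rewrite (_ : @eq_op T a b = true); [|lia] ]
  end;
  rewrite /= ?(mul0rn, mulr0n, mulr1n, subr0, addr0, add0r, sub0r, oppr0).

(** * Families of matrix units of so(2n) and their extension by a pair of indices *)

Section Orthogonal.
Variables (K : fieldType) (L : lieAlgType K).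
Hypothesis charK : [pchar K] =i pred0.
Variable n : nat.

Local Notation idx k i := (k <= `|i| <= n)%N.

(* [G i j] stands for [E_{i,-j} - E_{j,-i}]: this labelling of [so(2n)] is
   antisymmetric, so that the bracket has all the symmetries of a pair of
   2-forms. *)
Definition so_bracket (G : int -> int -> L) (i j k l : int) : Prop :=
  [~ G i j, G k l] = G i l *+ (j == - k) - G i k *+ (j == - l)
                     - G j l *+ (i == - k) + G j k *+ (i == - l).

Definition so_family (m : nat) (G : int -> int -> L) : Prop :=
  (forall i j, idx m i -> idx m j -> G j i = - G i j) /\
  (forall i j k l, idx m i -> idx m j -> idx m k -> idx m l ->
     so_bracket G i j k l).

Lemma so_family_diag m G i : so_family m G -> idx m i -> G i i = 0.
Proof. by move=> [GN _] Ji; apply: eq_opp_eq0 => //; exact: GN. Qed.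

(* The indices [m] and [- m] are adjoined to [G], with rows [v] and [v'] and with
   [d] as new Cartan element. *)
Section Glue.
Variables (m : nat) (G : int -> int -> L) (v v' : int -> L) (d : L).
Hypothesis m_bounds : (0 < m < n)%N.
Hypothesis soG : so_family m.+1 G.
Hypothesis vG : forall j k l, idx m.+1 j -> idx m.+1 k -> idx m.+1 l ->
  [~ v j, G k l] = v l *+ (j == - k) - v k *+ (j == - l).
Hypothesis v'G : forall j k l, idx m.+1 j -> idx m.+1 k -> idx m.+1 l ->
  [~ v' j, G k l] = v' l *+ (j == - k) - v' k *+ (j == - l).
Hypothesis vv : forall i j, idx m.+1 i -> idx m.+1 j -> [~ v i, v j] = 0.
Hypothesis v'v' : forall i j, idx m.+1 i -> idx m.+1 j -> [~ v' i, v' j] = 0.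
Hypothesis vv' : forall i j, idx m.+1 i -> idx m.+1 j ->
  [~ v i, v' j] = - G i j - d *+ (i == - j).
Hypothesis dG : forall i j, idx m.+1 i -> idx m.+1 j -> [~ d, G i j] = 0.
Hypothesis dv : forall i, idx m.+1 i -> [~ d, v i] = v i.
Hypothesis dv' : forall i, idx m.+1 i -> [~ d, v' i] = - v' i.

Definition glue (i j : int) : L :=
  if i == m%:Z then
    (if j == m%:Z then 0 else if j == - m%:Z then d else v j)
  else if i == - m%:Z then
    (if j == m%:Z then - d else if j == - m%:Z then 0 else v' j)
  else if j == m%:Z then - v i else if j == - m%:Z then - v' i else G i j.

Lemma glue_old i j : idx m.+1 i -> idx m.+1 j -> glue i j = G i j.
Proof. by move=> Ji Jj; rewrite /glue; deltas. Qed.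

Lemma glue_pos j : idx m.+1 j -> glue m%:Z j = v j.
Proof. by move=> Jj; rewrite /glue; deltas. Qed.

Lemma glue_neg j : idx m.+1 j -> glue (- m%:Z) j = v' j.
Proof. by move=> Jj; rewrite /glue; deltas. Qed.

Lemma glue_diag : glue m%:Z (- m%:Z) = d.
Proof. by rewrite /glue; deltas. Qed.

Lemma idx_split i : idx m i -> [\/ i = m%:Z, i = - m%:Z | idx m.+1 i].
Proof.
move=> Ji; have [->|] := eqVneq i m%:Z; first by constructor 1.
have [->|] := eqVneq i (- m%:Z); first by constructor 2.
by constructor 3; lia.
Qed.

Lemma glueN i j : idx m i -> idx m j -> glue j i = - glue i j.
Proof.
have [GN _] := soG.
move=> /idx_split[->|->|Ji] /idx_split[->|->|Jj]; rewrite /glue; deltas => //;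
  by rewrite ?opprK //; exact: GN.
Qed.

Lemma glue_pair_ind (P : int -> int -> Prop) :
  (forall i j, P j i -> P i j) -> (forall i, P i i) ->
  (forall i j, idx m.+1 i -> idx m.+1 j -> P i j) ->
  (forall j, idx m.+1 j -> P m%:Z j) ->
  (forall j, idx m.+1 j -> P (- m%:Z) j) ->
  P m%:Z (- m%:Z) ->
  forall i j, idx m i -> idx m j -> P i j.
Proof.
move=> Psym Pdiag Pold Ppos Pneg Pmm i j.
by move=> /idx_split[->|->|Ji] /idx_split[->|->|Jj]; auto.
Qed.

(** The identity is preserved by exchanging the indices inside a pair and by exchanging the two
    pairs. So each pair is of one of the four types of [glue_pair_ind], and ten brackets remain:
    each is a hypothesis on [v], [v'] or [d], a bracket of the old family, or trivial. *)
Lemma glue_so_family : so_family m glue.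
Proof.
have [GN GG] := soG.
split=> [|i j k l Ji Jj Jk Jl]; first exact: glueN.
have neg_sym (a b : int) : (a == - b) = (b == - a) by lia.
have swap i' j' k' l' : idx m i' -> idx m j' -> idx m k' -> idx m l' ->
    so_bracket glue k' l' i' j' -> so_bracket glue i' j' k' l'.
  move=> Ji' Jj' Jk' Jl' H; rewrite /so_bracket lieC H.
  rewrite (glueN Jj' Jk') (glueN Jj' Jl') (glueN Ji' Jk') (glueN Ji' Jl').
  by rewrite !(neg_sym k') !(neg_sym l') !mulNrn; zmodule.
pose P4 i' j' k' l' := idx m i' -> idx m j' -> idx m k' -> idx m l' ->
  so_bracket glue i' j' k' l'.
suff /(_ i j Ji Jj k l Jk Jl): forall i' j', idx m i' -> idx m j' ->
    forall k' l', idx m k' -> idx m l' -> P4 i' j' k' l' by apply.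
have sym12 i' j' k' l' : P4 j' i' k' l' -> P4 i' j' k' l'.
  move=> H Ji' Jj' Jk' Jl'; rewrite /so_bracket (glueN Jj' Ji') lieNl.
  by rewrite (H Jj' Ji' Jk' Jl'); zmodule.
have sym34 i' j' k' l' : P4 i' j' l' k' -> P4 i' j' k' l'.
  move=> H Ji' Jj' Jk' Jl'; rewrite /so_bracket (glueN Jl' Jk') lieNr.
  by rewrite (H Ji' Jj' Jl' Jk'); zmodule.
have diag12 i' k' l' : P4 i' i' k' l'.
  move=> Ji' _ Jk' Jl'; rewrite /so_bracket (eq_opp_eq0 charK (glueN Ji' Ji')).
  by rewrite lie0l; zmodule.
have diag34 i' j' k' : P4 i' j' k' k'.
  move=> Ji' Jj' Jk' _; rewrite /so_bracket (eq_opp_eq0 charK (glueN Jk' Jk')).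
  by rewrite lie0r; zmodule.
have swapP i' j' k' l' : P4 k' l' i' j' -> P4 i' j' k' l'.
  by move=> H Ji' Jj' Jk' Jl'; apply: swap => //; exact: H.
have Jm : idx m m by lia.
have Jm' : idx m (- m%:Z) by lia.
have bracket_old i' j' k' l' : idx m.+1 i' -> idx m.+1 j' -> idx m.+1 k' ->
    idx m.+1 l' -> P4 i' j' k' l'.
  move=> Ji' Jj' Jk' Jl' _ _ _ _; rewrite /so_bracket !glue_old //; exact: GG.
have bracket_pos_old j' k' l' : idx m.+1 j' -> idx m.+1 k' -> idx m.+1 l' ->
    P4 m%:Z j' k' l'.
  move=> Jj' Jk' Jl' _ _ _ _; rewrite /so_bracket (glue_old Jk' Jl') !glue_pos // vG //.
  by deltas.
have bracket_neg_old j' k' l' : idx m.+1 j' -> idx m.+1 k' -> idx m.+1 l' ->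
    P4 (- m%:Z) j' k' l'.
  move=> Jj' Jk' Jl' _ _ _ _; rewrite /so_bracket (glue_old Jk' Jl') !glue_neg // v'G //.
  by deltas.
have bracket_diag_old k' l' : idx m.+1 k' -> idx m.+1 l' ->
    P4 m%:Z (- m%:Z) k' l'.
  move=> Jk' Jl' _ _ _ _; rewrite /so_bracket glue_diag (glue_old Jk' Jl') dG //.
  by deltas.
have bracket_pos_pos j' l' : idx m.+1 j' -> idx m.+1 l' -> P4 m%:Z j' m%:Z l'.
  move=> Jj' Jl' _ _ _ _; rewrite /so_bracket (glue_pos Jj') (glue_pos Jl') vv //.
  by rewrite (eq_opp_eq0 charK (glueN Jm Jm)); deltas.
have bracket_neg_neg j' l' : idx m.+1 j' -> idx m.+1 l' ->
    P4 (- m%:Z) j' (- m%:Z) l'.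
  move=> Jj' Jl' _ _ _ _; rewrite /so_bracket (glue_neg Jj') (glue_neg Jl') v'v' //.
  by rewrite (eq_opp_eq0 charK (glueN Jm' Jm')); deltas.
have bracket_pos_neg j' l' : idx m.+1 j' -> idx m.+1 l' ->
    P4 m%:Z j' (- m%:Z) l'.
  move=> Jj' Jl' _ _ _ _; rewrite /so_bracket (glue_pos Jj') (glue_neg Jl') vv' //.
  rewrite glue_diag (glue_old Jj' Jl') (_ : (m%:Z == - - m%:Z) = true); last by lia.
  rewrite (_ : (j' == - - m%:Z) = false); last by lia.
  rewrite (_ : (m%:Z == - l') = false); last by lia.
  by rewrite !mulr0n mulr1n; zmodule.
have bracket_diag_pos l' : idx m.+1 l' -> P4 m%:Z (- m%:Z) m%:Z l'.
  move=> Jl' _ _ _ _; rewrite /so_bracket (glue_pos Jl') glue_diag dv //.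
  by deltas.
have bracket_diag_neg l' : idx m.+1 l' -> P4 m%:Z (- m%:Z) (- m%:Z) l'.
  move=> Jl' _ _ _ _; rewrite /so_bracket (glue_neg Jl') glue_diag dv' //.
  by deltas.
have bracket_diag_diag : P4 m%:Z (- m%:Z) m%:Z (- m%:Z).
  by move=> _ _ _ _; rewrite /so_bracket (glueN Jm Jm') glue_diag liexx; deltas; rewrite addrN.
apply: glue_pair_ind => [i' j' H k' l' Jk' Jl'|i' k' l' _ _|i' j' Ji' Jj'
    |j' Jj'|j' Jj'|]; first by apply: sym12; exact: H.
- exact: diag12.
- by apply: glue_pair_ind => *; auto.
- by apply: glue_pair_ind => *; auto.
- by apply: glue_pair_ind => *; auto.
- by apply: glue_pair_ind => *; auto.
Qed.

End Glue.

(* The vector representation generated by a lowest weight vector [e], of weight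
   [c]. *)
Section VectorModule.
Variables (m : nat) (G : int -> int -> L) (c : int) (e : L).
Hypothesis m_bound : (m.+1 < n)%N.
Hypothesis c_abs : `|c|%N = m.+1.
Hypothesis soG : so_family m.+1 G.
Hypothesis eG : forall k l, idx m.+1 k -> idx m.+1 l -> k != - c -> l != - c ->
  [~ e, G k l] = 0.
Hypothesis eGcc : [~ e, G (- c) c] = e.

(** In the vector representation with [e = v c], the inner bracket is [v i], and [b i j] is
    [- v (- c)] when [i = - j] and 0 otherwise. *)
Let b i j := [~ [~ e, G (- c) i], G (- c) j].

Let Jc : idx m.+1 c. Proof. by lia. Qed.
Let JNc : idx m.+1 (- c). Proof. by lia. Qed.
Let widen i : idx m.+2 i -> idx m.+1 i. Proof. by lia. Qed.
Let GN i j : idx m.+1 i -> idx m.+1 j -> G j i = - G i j.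
Proof. by case: soG => + _; apply. Qed.
Let Gii i : idx m.+1 i -> G i i = 0. Proof. exact: so_family_diag. Qed.
Let GG i j k l : idx m.+1 i -> idx m.+1 j -> idx m.+1 k -> idx m.+1 l ->
  [~ G i j, G k l] = G i l *+ (j == - k) - G i k *+ (j == - l)
                     - G j l *+ (i == - k) + G j k *+ (i == - l).
Proof. by case: soG => _; apply. Qed.

Lemma lowest_commute k l : idx m.+2 k -> idx m.+2 l -> [~ e, G k l] = 0.
Proof. by move=> Jk Jl; apply: eG; lia. Qed.

Lemma lowest_GG j k l : idx m.+2 j -> idx m.+2 k -> idx m.+2 l ->
  [~ G (- c) j, G k l] = G (- c) l *+ (j == - k) - G (- c) k *+ (j == - l).
Proof. by move=> Jj Jk Jl; rewrite GG; [|lia..]; deltas. Qed.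

Lemma lowest_vec_GG j k l : idx m.+2 j -> idx m.+2 k -> idx m.+2 l ->
  [~ [~ e, G (- c) j], G k l] =
  [~ e, G (- c) l] *+ (j == - k) - [~ e, G (- c) k] *+ (j == - l).
Proof.
move=> Jj Jk Jl; rewrite lie_liel lowest_commute // lie0l add0r lowest_GG //.
by rewrite lieBr !lieMnr.
Qed.

Lemma lowest_bG i j k l : idx m.+2 i -> idx m.+2 j -> idx m.+2 k -> idx m.+2 l ->
  [~ b i j, G k l] = (b l j *+ (i == - k) - b k j *+ (i == - l))
                     + (b i l *+ (j == - k) - b i k *+ (j == - l)).
Proof.
move=> Ji Jj Jk Jl; rewrite [LHS]lie_liel lowest_vec_GG // lowest_GG //.
by rewrite lieBl !lieMnl lieBr !lieMnr.
Qed.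

Lemma lowest_b_sym i j : idx m.+2 i -> idx m.+2 j -> b i j = b j i.
Proof.
move=> Ji Jj; rewrite /b lie_liel GG; [|lia..]; rewrite Gii //; deltas.
by rewrite lie0r addr0.
Qed.

(** Bracketing [b i i = 0] with [G (- i) j] gives [b j i + b i j = 0], hence [b j i = 0] by
    symmetry; a second bracket with the same element gives [b j j]. One Serre relation thus yields
    the others. *)
Lemma lowest_b_diag i j : idx m.+2 i -> idx m.+2 j -> `|i|%N <> `|j|%N ->
  b i i = 0 -> b j j = 0.
Proof.
move=> Ji Jj neq_ij bii.
have bij : b j i = 0.
  apply: (double_eq0 charK).
  have := lowest_bG Ji Ji (_ : idx m.+2 (- i)) Jj; rewrite bii lie0l; deltas.
  by rewrite -(lowest_b_sym Jj Ji) => <- //; lia.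
have := lowest_bG Jj Ji (_ : idx m.+2 (- i)) Jj; rewrite bij lie0l; deltas.
by move=> <- //; lia.
Qed.

(** [G (- i) j] commutes with [e] and carries [[~ e, G (- c) i]] to [[~ e, G (- c) j]]. *)
Lemma lowest_b_opp i j : idx m.+2 i -> idx m.+2 j -> `|i|%N <> `|j|%N ->
  [~ e, [~ e, G (- c) i]] = 0 -> [~ e, [~ e, G (- c) j]] = 0.
Proof.
move=> Ji Jj neq_ij ei.
have JNi : idx m.+2 (- i) by lia.
have := lowest_vec_GG Ji JNi Jj; deltas => <-.
by rewrite lie_lier ei lie0l (lowest_commute JNi Jj) lie0r addr0.
Qed.

Hypothesis bii : forall i, idx m.+2 i -> b i i = 0.

(** Brackets with [G] spread the vanishing of [b i i] to every [b i j] with [i != - j]. Bracketing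
    [b k l = 0] with [G (- k) (- l)] then identifies the remaining values with each other. *)
Lemma lowest_bE : exists q, forall i j, idx m.+2 i -> idx m.+2 j ->
  b i j = q *+ (i == - j).
Proof.
have Jn : idx m.+2 n by lia.
have b0 i j : idx m.+2 i -> idx m.+2 j -> i != - j -> b i j = 0.
  move=> Ji Jj neq; have [->|neq'] := eqVneq i j; first exact: bii.
  apply: (double_eq0 charK).
  have := lowest_bG Ji Ji (_ : idx m.+2 (- i)) Jj; rewrite bii // lie0l; deltas.
  by rewrite -(lowest_b_sym Ji Jj) => <- //; lia.
exists (b n (- n%:Z)) => i j Ji Jj; have [eq_ij|] := eqVneq i (- j); last exact: b0.
have {eq_ij}-> : j = - i by lia.
have bN k l : idx m.+2 k -> idx m.+2 l -> `|k|%N <> `|l|%N ->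
    b (- l) l = b k (- k).
  move=> Jk Jl neq.
  have JNk : idx m.+2 (- k) by lia.
  have JNl : idx m.+2 (- l) by lia.
  have := lowest_bG Jk Jl JNk JNl; rewrite b0 ?lie0l //; last by lia.
  by deltas => /esym/eqP; rewrite subr_eq0 => /eqP.
have [->|ni] := eqVneq i n; first by [].
have [->|ni'] := eqVneq i (- n%:Z); first by rewrite lowest_b_sym ?opprK //; lia.
rewrite mulr1n lowest_b_sym; [|lia..]; apply: bN; lia.
Qed.

Lemma vector_module : exists v : int -> L,
  [/\ v c = e,
      forall j, idx m.+2 j -> v j = [~ e, G (- c) j] &
      forall j k l, idx m.+1 j -> idx m.+1 k -> idx m.+1 l ->
        [~ v j, G k l] = v l *+ (j == - k) - v k *+ (j == - l)].
Proof.
have [q bq] := lowest_bE.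
(* The value at [- c] is forced: [b i (- i)] has to be [- v (- c)]. *)
pose v j := if j == c then e else if j == - c then - q else [~ e, G (- c) j].
have vc : v c = e by rewrite /v eqxx.
have vNc : v (- c) = - q by rewrite /v; deltas.
have vE j : idx m.+2 j -> v j = [~ e, G (- c) j] by move=> Jj; rewrite /v; deltas.
exists v; split=> // j k l Jj Jk Jl.
have idx_splitc i : idx m.+1 i -> [\/ i = c, i = - c | idx m.+2 i].
  move=> Ji; have [->|] := eqVneq i c; first by constructor 1.
  have [->|] := eqVneq i (- c); first by constructor 2.
  by constructor 3; lia.
pose P k' l' := idx m.+1 k' -> idx m.+1 l' ->
  [~ v j, G k' l'] = v l' *+ (j == - k') - v k' *+ (j == - l').
have symP k' l' : P l' k' -> P k' l'.
  by move=> H Jk' Jl'; rewrite (GN Jl' Jk') lieNr H // opprB.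
have diagP k' : P k' k' by move=> Jk' _; rewrite Gii // lie0r subrr.
suff: P k l by apply.
have JN i : idx m.+2 i -> idx m.+2 (- i) by lia.
have vD i : idx m.+2 i -> [~ v i, G (- c) c] = 0.
  move=> Ji; rewrite vE // lie_liel eGcc GG; [|lia..]; deltas.
  by rewrite (GN JNc (widen Ji)) lieNr addrN.
have gD i : idx m.+2 i -> [~ G (- c) i, G (- c) c] = - G (- c) i.
  by move=> Ji; rewrite GG; [|lia..]; deltas; rewrite (GN JNc (widen Ji)).
have vGc i l' : idx m.+2 i -> idx m.+2 l' -> [~ v i, G c l'] = - e *+ (i == - l').
  move=> Ji Jl'; rewrite vE // lie_liel [X in [~ X, _] + _]eG; [|lia..].
  rewrite lie0l add0r GG; [|lia..]; deltas.
  rewrite lieBr lieNr lieMnr eGcc eG; [|lia..].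
  by rewrite subr0 mulNrn.
(* Brackets with [q] become computable because [i] is free here: each case below picks the [i]
   adapted to the other factor. *)
have qE i : idx m.+2 i -> q = [~ v i, G (- c) (- i)].
  by move=> Ji; rewrite vE // [RHS](bq i (- i) Ji (JN i Ji)) opprK eqxx.
have vg i l' : idx m.+2 i -> idx m.+2 l' ->
    [~ v i, G (- c) l'] = q *+ (i == - l').
  by move=> Ji Jl'; rewrite vE //; exact: bq.
have Pold k' l' : idx m.+2 k' -> idx m.+2 l' -> P k' l'.
  move=> Jk' Jl' _ _; have [->|->|Jj'] := idx_splitc j Jj.
  - by rewrite vc lowest_commute //; deltas.
  - rewrite vNc (qE l') // lieNl lie_liel.
    rewrite -lie_liel vE // lowest_bG ?JN // (bii Jl') !bq ?JN // opprK eqxx.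
    by deltas; rewrite addrN oppr0.
  - by rewrite !vE // lowest_vec_GG.
have Pc l' : idx m.+2 l' -> P c l'.
  move=> Jl' _ _; have [->|->|Jj'] := idx_splitc j Jj.
  - by rewrite vc eG; [|lia..]; deltas.
  - rewrite vNc (qE (- l')) ?JN // opprK lieNl lie_liel vGc ?JN //.
    rewrite GG; [|lia..]; rewrite Gii; [|lia]; deltas.
    by rewrite lie0r addr0 lieNl opprK vE.
  - by rewrite vGc // vc; deltas; rewrite mulNrn.
have PNc l' : idx m.+2 l' -> P (- c) l'.
  move=> Jl' _ _; have [->|->|Jj'] := idx_splitc j Jj.
  - by rewrite vc vE //; deltas.
  - rewrite vNc (qE l') // lieNl lie_liel vg // GG; [|lia..].
    by rewrite Gii; [|lia]; deltas; rewrite lie0l lie0r addr0 oppr0.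
  - by rewrite vg // vNc mulNrn; deltas; rewrite opprK.
have PNcc : P (- c) c.
  move=> _ _; have [->|->|Jj'] := idx_splitc j Jj.
  - by rewrite vc eGcc; deltas.
  - have Jn : idx m.+2 n by lia.
    rewrite vNc vc {1}(qE n) // lieNl lie_liel vD // gD ?JN //.
    by rewrite lie0l lieNr -qE //; deltas.
  - by rewrite vD //; deltas.
have [Jk'|Jk'|Jk'] := idx_splitc k Jk; have [Jl'|Jl'|Jl'] := idx_splitc l Jl;
  rewrite ?Jk' ?Jl'; auto.
Qed.

End VectorModule.

(** * Brackets between copies of the vector representation *)

Section VectorBrackets.
Variables (m : nat) (G : int -> int -> L) (c : int).
Hypothesis m_bound : (m.+1 < n)%N.
Hypothesis c_abs : `|c|%N = m.+1.
Hypothesis soG : so_family m.+1 G.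

Let Jc : idx m.+1 c. Proof. by lia. Qed.
Let JNc : idx m.+1 (- c). Proof. by lia. Qed.
Let JN i : idx m.+1 i -> idx m.+1 (- i). Proof. by lia. Qed.
Let widen i : idx m.+2 i -> idx m.+1 i. Proof. by lia. Qed.

Lemma idx_splitc i : idx m.+1 i -> [\/ i = c, i = - c | idx m.+2 i].
Proof.
move=> Ji; have [->|] := eqVneq i c; first by constructor 1.
have [->|] := eqVneq i (- c); first by constructor 2.
by constructor 3; lia.
Qed.

Definition equivariant (v : int -> L) :=
  forall j k l, idx m.+1 j -> idx m.+1 k -> idx m.+1 l ->
    [~ v j, G k l] = v l *+ (j == - k) - v k *+ (j == - l).

Lemma equivariant_lie v v' i j k l : equivariant v -> equivariant v' ->
  idx m.+1 i -> idx m.+1 j -> idx m.+1 k -> idx m.+1 l ->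
  [~ [~ v i, v' j], G k l] =
    ([~ v l, v' j] *+ (i == - k) - [~ v k, v' j] *+ (i == - l))
    + ([~ v i, v' l] *+ (j == - k) - [~ v i, v' k] *+ (j == - l)).
Proof.
move=> vG v'G Ji Jj Jk Jl; rewrite lie_liel vG // v'G //.
by rewrite lieBl !lieMnl lieBr !lieMnr.
Qed.

(** Brackets with [G] move the known zeros to all pairs except the opposite ones, whose values all
    equal [[~ v c, v (- c)]]. Exchanging [n] and [- n] shows that this value is its own opposite,
    hence 0. *)
Lemma equivariant_commute v : equivariant v ->
  (forall j, idx m.+2 j -> [~ v c, v j] = 0) ->
  forall i j, idx m.+1 i -> idx m.+1 j -> [~ v i, v j] = 0.
Proof.
move=> vG vc0.
have vij i j : idx m.+2 i -> idx m.+2 j -> i != - j -> [~ v i, v j] = 0.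
  move=> Ji Jj neq.
  have := equivariant_lie vG vG Jc (widen Jj) JNc (widen Ji).
  by rewrite vc0 // lie0l; deltas => <-.
have vNj j : idx m.+2 j -> [~ v (- j), v j] = [~ v c, v (- c)].
  move=> Jj; have JNj : idx m.+1 (- j) by lia.
  have := equivariant_lie vG vG Jc (widen Jj) JNc JNj.
  rewrite vc0 // lie0l; deltas => /esym/eqP.
  by rewrite subr_eq0 => /eqP.
have Jn : idx m.+2 n by lia.
have vcN : [~ v c, v (- c)] = 0.
  apply: (eq_opp_eq0 charK); rewrite -{1}(vNj n) // lieC -(vNj (- n%:Z)) ?opprK //.
  by lia.
have vjN j : idx m.+2 j -> [~ v (- j), v j] = 0 by move=> Jj; rewrite vNj.
have vNc j : idx m.+2 j -> [~ v (- c), v j] = 0.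
  move=> Jj; have JNj : idx m.+1 (- j) by lia.
  have := equivariant_lie vG vG JNj (widen Jj) (widen Jj) JNc.
  by rewrite vjN // lie0l; deltas => <-.
move=> i j /idx_splitc[->|->|Ji] /idx_splitc[->|->|Jj] //; rewrite ?liexx //;
  try by [apply: vc0 | apply: vNc | apply: lie_eq0C; auto].
have [->|neq] := eqVneq i (- j); first exact: vjN.
exact: vij.
Qed.

(** The difference [D] of the two sides transforms under [G] like a tensor product of two vectors,
    as do [G i j] and the invariant [d] times the pairing. Its vanishing at [(c, - c)] therefore
    spreads to all pairs. *)
Lemma equivariant_pairing v v' d : equivariant v -> equivariant v' ->
  (forall k l, idx m.+1 k -> idx m.+1 l -> [~ d, G k l] = 0) ->
  [~ v c, v' (- c)] = - G c (- c) - d ->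
  forall i j, idx m.+1 i -> idx m.+1 j ->
    [~ v i, v' j] = - G i j - d *+ (i == - j).
Proof.
move=> vG v'G dG vcNc; have [GN GG] := soG.
pose D i j := [~ v i, v' j] + G i j + d *+ (i == - j).
suff D0 i j : idx m.+1 i -> idx m.+1 j -> D i j = 0.
  move=> i j Ji Jj; apply/eqP; rewrite -subr_eq0 -(D0 i j Ji Jj); apply/eqP.
  by rewrite /D; zmodule.
have DG i' j' k l : idx m.+1 i' -> idx m.+1 j' -> idx m.+1 k -> idx m.+1 l ->
    [~ D i' j', G k l] = (D l j' *+ (i' == - k) - D k j' *+ (i' == - l))
                         + (D i' l *+ (j' == - k) - D i' k *+ (j' == - l)).
  move=> Ji Jj Jk Jl; rewrite !lieDl lieMnl dG // mul0rn addr0.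
  rewrite equivariant_lie // GG // (GN k j') // (GN l j') //.
  rewrite /D !mulrnDl -!mulrnA !mulNrn !mulnb.
  rewrite (_ : (l == - j') && (i' == - k) = (i' == - k) && (j' == - l)); last by lia.
  rewrite (_ : (k == - j') && (i' == - l) = (i' == - l) && (j' == - k)); last by lia.
  rewrite (_ : (i' == - l) && (j' == - k) = (j' == - k) && (i' == - l)); last by lia.
  rewrite (_ : (i' == - k) && (j' == - l) = (j' == - l) && (i' == - k)); last by lia.
  by zmodule.
have Dc : D c (- c) = 0.
  by rewrite /D vcNc opprK eqxx; zmodule.
have Di i' : idx m.+2 i' -> D i' (- c) = 0.
  move=> Ji; have := DG c (- c) (- c) i' Jc JNc JNc (widen Ji).
  by rewrite Dc lie0l; deltas => /esym.
have DiN i' : idx m.+1 i' -> D i' (- c) = 0.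
  move=> /idx_splitc[->|->|//]; last by move=> ?; apply: Di.
    exact: Dc.
  have Jn : idx m.+2 n by lia.
  have JNn : idx m.+1 (- n%:Z) by lia.
  have := DG n (- c) (- n%:Z) (- c) (widen Jn) JNc JNn JNc.
  by rewrite Di // lie0l; deltas => /esym.
have Dj i' j' : idx m.+1 i' -> idx m.+2 j' -> D i' j' = 0.
  move=> Ji Jj; have := DG i' (- c) c j' Ji JNc Jc (widen Jj).
  rewrite !DiN ?lie0l; [|lia..]; by deltas => /esym.
move=> Ji /idx_splitc[->|->|?]; [|exact: DiN|exact: Dj].
have Jn : idx m.+2 n by lia.
have JNn : idx m.+1 (- n%:Z) by lia.
have := DG i n (- n%:Z) c Ji (widen Jn) JNn Jc.
by rewrite (Dj i n) // (Dj c n) // (Dj (- n%:Z) n) // lie0l; deltas => /esym.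
Qed.

(** Since [d] commutes with [G], the eigenvalue at [v c] is carried along by [G]. A step needs
    distinct absolute values, so [- c] is reached through [n]. *)
Lemma equivariant_eigen v d z : equivariant v ->
  (forall k l, idx m.+1 k -> idx m.+1 l -> [~ d, G k l] = 0) ->
  [~ d, v c] = v c *~ z -> forall i, idx m.+1 i -> [~ d, v i] = v i *~ z.
Proof.
move=> vG dG dvc.
have step k l : idx m.+1 k -> idx m.+1 l -> `|k|%N <> `|l|%N ->
    [~ d, v k] = v k *~ z -> [~ d, v l] = v l *~ z.
  move=> Jk Jl neq dvk.
  have -> : v l = [~ v k, G (- k) l].
    by rewrite vG ?JN //; deltas.
  rewrite lie_lier dvk (dG (- k) l) ?JN // lie0r addr0.
  by rewrite -!scaler_int lieZl.
have Jn : idx m.+2 n by lia.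
move=> i /idx_splitc[->//|->|Ji].
  by apply: (step n); [lia..|]; apply: (step c) => //; lia.
by apply: (step c) => //; lia.
Qed.

End VectorBrackets.
End Orthogonal.

Definition sg (s : bool) : int := if s then 1 else -1.

Lemma sg_absP (i : int) : exists s, i = sg s * `|i|%N%:Z.
Proof. by case: i => k; [exists true|exists false]; rewrite /sg; lia. Qed.

Lemma mulrsgT (V : zmodType) (v : V) : v *~ sg true = v.
Proof. exact: mulr1z. Qed.

Lemma mulrsgF (V : zmodType) (v : V) : v *~ sg false = - v.
Proof. exact: mulrN1z. Qed.

(** * Paths between signed indices *)

Section Connectivity.
Variables (n : nat) (S : pred nat) (R : int -> int -> Prop).
Hypothesis R_opp : forall i j, S `|i|%N -> S `|j|%N -> R i j -> R (- j) (- i).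
Hypothesis R_trans : forall i j k, S `|i|%N -> S `|j|%N -> S `|k|%N ->
  `|i|%N <> `|j|%N -> `|i|%N <> `|k|%N -> `|j|%N <> `|k|%N ->
  R i j -> R j k -> R i k.

(** [R_trans] composes only steps among three distinct absolute values, hence the detours. Downward
    steps are opposites of upward ones by [R_opp], and every change of sign is routed through the
    edge from [p] to [- q]. *)
Lemma connect_all :
  (forall s (i j : nat), S i -> S j -> (i < j)%N ->
     R (sg s * i%:Z) (sg s * j%:Z)) ->
  (forall i j, S i -> S j -> i <> j -> exists p q, [/\ S p, S q, p <> q &
     forall s, R (sg s * p%:Z) (- (sg s * q%:Z))]) ->
  forall i j, S `|i|%N -> S `|j|%N -> `|i|%N <> `|j|%N -> R i j.
Proof.
move=> Rup Rbase.
have absS t (k : nat) : absz (sg t * k%:Z) = k by case: t; rewrite /sg; lia.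
have same s (i j : nat) : S i -> S j -> i <> j -> R (sg s * i%:Z) (sg s * j%:Z).
  move=> Si Sj neq; have [|le_ji] := ltnP i j; first exact: Rup.
  have := Rup (~~ s) j i Sj Si; rewrite ltn_neqAle le_ji andbT => /(_ _).
  have -> : j != i by apply/eqP; auto.
  move=> /(_ isT) /R_opp.
  have -> : - (sg (~~ s) * i%:Z) = sg s * i%:Z by case: s; rewrite /sg /=; lia.
  have -> : - (sg (~~ s) * j%:Z) = sg s * j%:Z by case: s; rewrite /sg /=; lia.
  by apply; rewrite absS.
have opposite s (i j : nat) : S i -> S j -> i <> j ->
    R (sg s * i%:Z) (- (sg s * j%:Z)).
  move=> Si Sj neq; have [p [q [Sp Sq neq_pq Rpq]]] := Rbase i j Si Sj neq.
  have absN t (k : nat) : absz (- (sg t * k%:Z)) = k by rewrite abszN absS.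
  have to_q k : S k -> k <> q -> R (sg s * k%:Z) (- (sg s * q%:Z)).
    move=> Sk kq; have [->//|/eqP kp] := eqVneq k p.
    apply: (R_trans (j := sg s * p%:Z)); rewrite ?absS ?absN //; exact: same.
  have [iq|/eqP iq] := eqVneq i q.
    have jq : j <> q by rewrite -iq; auto.
    have := R_opp _ _ (to_q j Sj jq); rewrite opprK iq ?absS ?absN; exact.
  have [->|/eqP jq] := eqVneq j q; first exact: to_q.
  apply: (R_trans (j := - (sg s * q%:Z))); rewrite ?absS ?absN //; auto.
  have sgN k : - (sg s * k%:Z) = sg (~~ s) * k%:Z.
    by clear; case: s; rewrite /sg /=; lia.
  by rewrite !sgN; apply: same; auto.
move=> i j; have [s {3}->] := sg_absP i; have [t {3}->] := sg_absP j.
move=> Si Sj neq; have [->|st] := eqVneq t s; first exact: same.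
have -> : sg t * `|j|%N%:Z = - (sg s * `|j|%N%:Z).
  by clear -st; case: s t st => [] [] //= _; rewrite /sg; lia.
exact: opposite.
Qed.

End Connectivity.

(* The index [a] is skipped; [a = 0] skips nothing. *)
Lemma chain_up (n m a : nat) (R : nat -> nat -> Prop) :
  let S i := (m <= i <= n)%N && (i != a) in
  (forall i j k, S i -> S j -> S k -> (i < j < k)%N -> R i j -> R j k -> R i k) ->
  (forall i, S i -> S i.+1 -> R i i.+1) ->
  (S a.-1 -> S a.+1 -> (0 < a)%N -> R a.-1 a.+1) ->
  forall i j, S i -> S j -> (i < j)%N -> R i j.
Proof.
move=> S Rtr Rsucc Rskip i j.
have [k] := ubnP j; elim: k i j => // k IH i j lt_jk Si Sj lt_ij.
have [/eqP a_j|neq_a] := boolP (j.-1 == a).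
  have [i_a|i_a] := eqVneq i a.-1.
    have ja : j = a.+1 by lia.
    rewrite i_a ja; apply: Rskip; [by rewrite -i_a|by rewrite -ja|].
    by move: Si; rewrite /S; lia.
  have Sa : S a.-1 by move: Si Sj; rewrite /S; lia.
  apply: (Rtr i a.-1 j) => //; first by move: Si Sj; rewrite /S; lia.
    by apply: IH => //; move: Si Sj; rewrite /S; lia.
  have ja : j = a.+1 by lia.
  by rewrite ja; apply: Rskip; rewrite -?ja //; move: Si; rewrite /S; lia.
have Sj' : S j.-1 by move: Si Sj; rewrite /S; lia.
have ej : j = j.-1.+1 by lia.
have [->|neq] := eqVneq i j.-1.
  by rewrite ej; apply: Rsucc; rewrite -?ej.
apply: (Rtr i j.-1 j) => //; first lia.
  by apply: IH => //; lia.
by rewrite {2}ej; apply: Rsucc; rewrite -?ej.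
Qed.

(** * Level 0 of the presentation: the copy of so(2n) *)

Section DrinfeldRelations.
Variables (K : fieldType) (L : lieAlgType K).
Hypothesis charK : [pchar K] =i pred0.
Variable n : nat.
Hypothesis n_gt4 : (4 < n)%N.
Variables (h0 h1 : nat -> L) (x : bool -> nat -> nat -> L).

Record drinfeld_relations : Prop := DrinfeldRelations {
  dr_h0h0 : forall i j, (0 < i <= n)%N -> (0 < j <= n)%N -> [~ h0 i, h0 j] = 0;
  dr_h0h1 : forall i j, (0 < i <= n)%N -> (0 < j < n)%N -> [~ h0 i, h1 j] = 0;
  dr_h1h1 : forall i j, (0 < i < n)%N -> (0 < j < n)%N -> [~ h1 i, h1 j] = 0;
  dr_h0x : forall s i j, (0 < i <= n)%N -> (0 < j <= n)%N ->
    [~ h0 i, x s j 0] = with_sign K s (cartanr n 0 i j) *: x s j 0;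
  dr_h1x : forall s i j, (0 < i < n)%N -> (0 < j <= n)%N ->
    [~ h1 i, x s j 0] = with_sign K s (cartanr n 1 i j) *: x s j 1;
  dr_xx : forall i j, (0 < i <= n)%N -> (0 < j <= n)%N ->
    [~ x true i 0, x false j 0] = h0 i *+ (i == j);
  dr_x1x : forall i, (0 < i < n)%N -> [~ x true i 1, x false i 0] = h1 i;
  dr_x1x0 : forall s i, (0 < i <= n)%N ->
    [~ x s i 1, x s i 0] = [~ x s i 0, x s i 1];
  dr_serre0 : forall s i j, (0 < i <= n)%N -> (0 < j <= n)%N ->
    cartan n i j = 0 -> [~ x s i 0, x s j 0] = 0;
  dr_serre1 : forall s i j, (0 < i <= n)%N -> (0 < j <= n)%N ->
    cartan n i j = -1 -> [~ x s i 0, [~ x s i 0, x s j 0]] = 0;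
  dr_end1 : forall s,
    [~ x s n 1, [~ x s (n - 2) 0, x s (n - 1) 0]] =
    - [~ x s (n - 1) 0, [~ x s (n - 2) 0, x s n 1]]
}.

Hypothesis rels : drinfeld_relations.

(* With these signs, [y s i = G (s i) (- s (i + 1))] and
   [y s n = G (s (n - 1)) (s n)] for both values of [s]. *)
Definition y0 (s : bool) (i : nat) : L := if s then x true i 0 else - x false i 0.
Definition y1 (s : bool) (i : nat) : L := x s i 1.

Arguments y0 : simpl never.
Arguments y1 : simpl never.

(* [even_diag i] acts on [y0 s j] with eigenvalue [+- wt0 j i], and [odd_diag i]
   maps it to [wt1 j i] times [y1 s j]. *)
Definition wt0 (j i : nat) : int :=
  if j == n then (i == n - 1)%N%:Z + (i == n)%:Z
  else (i == j)%:Z - (i == j.+1)%:Z.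
Definition wt1 (j i : nat) : int :=
  if j == n then (i == n - 1)%N%:Z - (i == n)%:Z
  else (i == j)%:Z - (i == j.+1)%:Z.

Lemma h0y s i j : (0 < i <= n)%N -> (0 < j <= n)%N ->
  [~ h0 i, y0 s j] = y0 s j *~ (sg s * cartan n i j).
Proof.
move=> Ji Jj; have := dr_h0x rels s Ji Jj; rewrite /with_sign /cartanr /= scaler_int.
by case: s; rewrite /y0 /sg ?lieNr => ->; rewrite ?mul1r // mulN1r mulNrz !mulrNz.
Qed.

Lemma h1y s i j : (0 < i < n)%N -> (0 < j <= n)%N ->
  [~ h1 i, y0 s j] = y1 s j *~ cartanr n 1 i j.
Proof.
move=> Ji Jj; have := dr_h1x rels s Ji Jj; rewrite /with_sign scaler_int.
by case: s; rewrite /y0 /y1 ?lieNr => ->; rewrite ?mulrNz ?opprK.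
Qed.

Lemma yy s i j : (0 < i <= n)%N -> (0 < j <= n)%N ->
  [~ y0 s i, y0 (~~ s) j] = - (h0 i *~ sg s) *+ (i == j).
Proof.
move=> Ji Jj; case: s; rewrite /y0 /= ?lieNr ?lieNl.
  by rewrite dr_xx // mulr1z mulNrn.
by rewrite lieC opprK dr_xx // eq_sym mulrNz opprK mulr1z; case: eqP => // ->.
Qed.

Lemma yyT i j : (0 < i <= n)%N -> (0 < j <= n)%N ->
  [~ y0 true i, y0 false j] = - h0 i *+ (i == j).
Proof. by move=> Ji Jj; rewrite (yy true) // mulrsgT. Qed.

Lemma y_serre0 s i j : (0 < i <= n)%N -> (0 < j <= n)%N -> cartan n i j = 0 ->
  [~ y0 s i, y0 s j] = 0.
Proof.
move=> Ji Jj cij; have := dr_serre0 rels s Ji Jj cij.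
by case: s => xx0; rewrite /y0 ?lieNl ?lieNr ?opprK.
Qed.

Lemma y_serre1 s i j : (0 < i <= n)%N -> (0 < j <= n)%N -> cartan n i j = -1 ->
  [~ y0 s i, [~ y0 s i, y0 s j]] = 0.
Proof.
move=> Ji Jj cij; have := dr_serre1 rels s Ji Jj cij.
by case: s => xx0; rewrite /y0 ?lieNl ?lieNr ?opprK ?xx0 ?oppr0.
Qed.

(** The element with [d i - d i.+1 = h0 i] for [i < n] and [d (n - 1) + d n = h0 n]. Solving the
    last two equations for [d n] produces the coefficient 1/2. *)
Definition even_diag (i : nat) : L :=
  (2%:R^-1 *: (h0 n - h0 (n - 1)%N)) + \sum_(i <= k < n) h0 k.

Local Notation d := even_diag.

Lemma dS i : (i < n)%N -> d i = d i.+1 + h0 i.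
Proof. by move=> lt_in; rewrite /even_diag big_ltn // addrCA addrC. Qed.

Lemma two_neq0 : 2%:R != 0 :> K.
Proof. by rewrite (iffLR (pcharf0P K) charK). Qed.

Lemma d_n2 : d n *+ 2 = h0 n - h0 (n - 1)%N.
Proof.
by rewrite /even_diag big_geq // addr0 -scaler_nat scalerA mulfV ?scale1r // two_neq0.
Qed.

Lemma d_last : d (n - 1) + d n = h0 n.
Proof.
have e : (n - 1).+1 = n by lia.
by rewrite (dS (i := (n - 1)%N)) ?e; [|lia]; rewrite addrAC -mulr2n d_n2 subrK.
Qed.

Lemma diff_dS i : (i < n)%N -> d i - d i.+1 = h0 i.
Proof. by move=> lt_in; rewrite dS // addrC addKr. Qed.

Lemma dy s i j : (0 < i <= n)%N -> (0 < j <= n)%N ->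
  [~ d i, y0 s j] = y0 s j *~ (sg s * wt0 j i).
Proof.
move=> + Jj; have [k] := ubnP (n - i); elim: k i => // k IH i lt_ik Ji.
have [lt_in|le_ni] := ltnP i n.
  rewrite dS // lieDl h0y // IH; [|lia..]; rewrite -mulrzDr -mulrDr.
  congr (_ *~ (_ * _)); rewrite /wt0 /cartan; case: ifP; case: ifP; lia.
have {le_ni Ji lt_ik IH}-> : i = n by lia.
apply/eqP; rewrite -subr_eq0; apply/eqP/(mulrn_eq0_lie charK (isT : 0 < 2)%N).
rewrite mulrnBl -lieMnl d_n2 lieBl !h0y; [|lia..].
rewrite pmulrn -mulrzA -!mulrzBr (_ : _ - _ = 0) ?mulr0z // /wt0 /cartan.
case: s; rewrite /sg; case: ifP; case: ifP; case: ifP; lia.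
Qed.

Lemma dd i j : (0 < i)%N -> (0 < j)%N -> [~ d i, d j] = 0.
Proof.
have hd k l : (0 < k <= n)%N -> (0 < l)%N -> [~ h0 k, d l] = 0.
  move=> Jk Jl; rewrite lieDr lieZr lieBr !(dr_h0h0 rels); [|lia..].
  rewrite subrr scaler0 add0r lie_sumr big_nat big1 // => p Jp.
  by apply: (dr_h0h0 rels); lia.
move=> Ji Jj; rewrite {1}/even_diag lieDl lieZl lieBl !hd; [|lia..].
rewrite subrr scaler0 add0r lie_suml big_nat big1 // => p Jp.
by rewrite hd //; lia.
Qed.

Local Notation idx k i := (k <= `|i| <= n)%N.

Definition simple_labels (m : nat) (G : int -> int -> L) : Prop :=
  [/\ forall i : nat, (m <= i <= n)%N -> G i%:Z (- i%:Z) = d i,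
      forall s (i : nat), (m <= i < n)%N ->
        G (sg s * i%:Z) (- (sg s * i.+1%:Z)) = y0 s i &
      (m < n)%N -> forall s, G (sg s * (n - 1)%N%:Z) (sg s * n%:Z) = y0 s n].

Lemma so_widen m m' (G : int -> int -> L) : (m <= m')%N -> so_family n m G ->
  so_family n m' G.
Proof.
by move=> le_mm' [GN GG]; split=> [i j Ji Jj|i j k l Ji Jj Jk Jl];
  [apply: GN | apply: GG]; lia.
Qed.

Lemma simple_widen m m' (G : int -> int -> L) : (m <= m')%N ->
  simple_labels m G -> simple_labels m' G.
Proof.
move=> le_mm' [Gd Gy Gn]; split=> [i Ji|s i Ji|lt s]; first by apply: Gd; lia.
  by apply: Gy; lia.
by apply: Gn; lia.
Qed.

(** Brackets of [G] at matching indices provide the transitivity asked by [connect_all], so a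
    property stable under opposites and brackets is checked on edges only. Skipping the index [a]
    costs the extra edge from [a.-1] to [a.+1]. *)
Lemma so_connect m (P : L -> Prop) G (a : nat) : (0 < m)%N ->
  so_family n m G ->
  (forall u, P u -> P (- u)) -> (forall u v, P u -> P v -> P [~ u, v]) ->
  let S i := (m <= i <= n)%N && (i != a) in
  (forall s (i : nat), S i -> S i.+1 -> P (G (sg s * i%:Z) (- (sg s * i.+1%:Z)))) ->
  (forall s, S a.-1 -> S a.+1 -> P (G (sg s * a.-1%:Z) (- (sg s * a.+1%:Z)))) ->
  (forall i j, S i -> S j -> i <> j -> exists p q, [/\ S p, S q, p <> q &
     forall s, P (G (sg s * p%:Z) (sg s * q%:Z))]) ->
  forall i j, S `|i|%N -> S `|j|%N -> `|i|%N <> `|j|%N -> P (G i j).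
Proof.
move=> m_gt0 soG PN PL S Psucc Pskip Pbase; have [GN GG] := soG.
have SJ i : S i -> (m <= i <= n)%N by case/andP.
pose R i j := P (G i (- j)).
suff RP i j : S `|i|%N -> S `|j|%N -> `|i|%N <> `|j|%N -> R i j.
  move=> i j Si Sj neq; have := RP i (- j); rewrite /R abszN opprK.
  exact.
have Rtr i' j' k' : S `|i'|%N -> S `|j'|%N -> S `|k'|%N ->
    `|i'|%N <> `|j'|%N -> `|i'|%N <> `|k'|%N -> `|j'|%N <> `|k'|%N ->
    R i' j' -> R j' k' -> R i' k'.
  move=> /SJ Ji /SJ Jj /SJ Jk ij ik jk Rij Rjk; rewrite /R.
  have -> : G i' (- k') = [~ G i' (- j'), G j' (- k')].
    by rewrite GG ?abszN //; deltas.
  exact: PL.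
apply: connect_all => [{}i {}j /SJ Ji /SJ Jj Rij|//|s {}i {}j Si Sj|{}i {}j Si Sj neq].
- rewrite /R opprK GN ?abszN //; exact: PN.
- move=> lt_ij; have absS (k : nat) : absz (sg s * k%:Z) = k.
    by case: s; rewrite /sg; lia.
  have sS (k : nat) : S k -> S (absz (sg s * k%:Z)) by rewrite absS.
  apply: (@chain_up n m a (fun i j => R (sg s * i%:Z) (sg s * j%:Z))) => //.
  + move=> i' j' k' Si' Sj' Sk' lt; apply: Rtr; rewrite ?absS //; lia.
  + by move=> i' Si' Si''; exact: Psucc.
  + by move=> *; exact: Pskip.
- have [p [q [Sp Sq pq Ppq]]] := Pbase i j Si Sj neq; exists p, q; split=> // s.
  by rewrite /R opprK.
Qed.

Lemma so_centralizer m G u : (0 < m <= n)%N -> so_family n m G ->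
  simple_labels m G ->
  (forall s i, (m <= i < n)%N -> [~ u, y0 s i] = 0) ->
  ((m < n)%N -> forall s, [~ u, y0 s n] = 0) ->
  (forall i, (m <= i <= n)%N -> [~ u, d i] = 0) ->
  forall i j, idx m i -> idx m j -> [~ u, G i j] = 0.
Proof.
move=> Jm soG [Gd Gy Gn] uy un ud i j Ji Jj; have [GN GG] := soG.
have [eq_ij|neq] := eqVneq `|i|%N `|j|%N.
  have [->|ij] := eqVneq i j.
    by rewrite (so_family_diag charK soG) ?lie0r.
  have ->: j = - i by lia.
  have := ud `|i|%N; have := Gd `|i|%N; case: i {eq_ij ij} Ji => k Ji /=.
    by move=> /(_ Ji) -> /(_ Ji).
  rewrite NegzE opprK (GN k.+1 (- k.+1%:Z)) //.
  by move=> /(_ Ji) -> /(_ Ji); rewrite lieNr => ->; rewrite oppr0.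
have lt_mn : (m < n)%N by lia.
apply: (@so_connect m (fun w => [~ u, w] = 0) G 0) => //; try lia.
- by move=> w uw; rewrite lieNr uw oppr0.
- by move=> w w'; exact: commute_lie.
- by move=> s k Sk Sk'; rewrite Gy ?uy //; lia.
- by move=> *; exists (n - 1)%N, n; split=> [||| s]; rewrite ?Gn ?un //; lia.
Qed.

Lemma so_base : exists G, so_family n n G /\ simple_labels n G.
Proof.
pose G (i j : int) : L :=
  if (i == n%:Z) && (j == - n%:Z) then d n
  else if (i == - n%:Z) && (j == n%:Z) then - d n else 0.
have idxn i : idx n i -> i = n%:Z \/ i = - n%:Z by lia.
exists G; split; last first.
  split=> [i Ji|s i Ji|lt_nn]; [|lia..].
  have -> : i = n by lia.
  by rewrite /G; deltas.
split=> [i j /idxn[]-> /idxn[]->|i j k l].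
- by rewrite /G; deltas.
- by rewrite /G; deltas.
- by rewrite /G; deltas; rewrite opprK.
- by rewrite /G; deltas.
by move=> /idxn[]-> /idxn[]-> /idxn[]-> /idxn[]->; rewrite /so_bracket /G; deltas;
   rewrite ?lie0l ?lie0r ?lieNl ?lieNr ?liexx; zmodule.
Qed.

(** The first gluing is done by hand. The vector representation of so(2) is not generated by one
    weight vector: its two weight vectors are the root vectors of the nodes [n - 1] and [n], which
    commute. *)
Lemma so_fork : exists G, so_family n (n - 1) G /\ simple_labels (n - 1) G.
Proof.
have [G [soG [Gd _ _]]] := so_base; have [GN GG] := soG.
have idxn i : idx n i -> i = n%:Z \/ i = - n%:Z by lia.
have GnN : G n%:Z (- n%:Z) = d n by apply: Gd; lia.
have GNn : G (- n%:Z) n%:Z = - d n by rewrite GN ?GnN //; lia.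
have soN i : idx n i -> G i i = 0 by exact: so_family_diag.
have Gnn : G n%:Z n%:Z = 0 by apply: soN; lia.
have GNnn : G (- n%:Z) (- n%:Z) = 0 by apply: soN; lia.
pose v (s : bool) (j : int) := y0 s (if (j == n%:Z) == s then n else (n - 1)%N).
have vn s : v s (sg s * n%:Z) = y0 s n.
  by rewrite /v; case: s; rewrite /sg; deltas.
have vNn s : v s (- (sg s * n%:Z)) = y0 s (n - 1).
  by rewrite /v; case: s; rewrite /sg; deltas.
have yn s : [~ y0 s n, d n] = - (y0 s n *~ sg s).
  by rewrite lieC dy; [|lia..]; congr (- (_ *~ _)); rewrite /wt0 eqxx; lia.
have yn1 s : [~ y0 s (n - 1), d n] = y0 s (n - 1) *~ sg s.
  rewrite lieC dy; [|lia..]; rewrite -mulrNz; congr (_ *~ _).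
  by rewrite /wt0; case: ifP; lia.
have vG s j k l : idx n j -> idx n k -> idx n l ->
    [~ v s j, G k l] = v s l *+ (j == - k) - v s k *+ (j == - l).
  move=> Jj Jk Jl; have [kl|] := eqVneq k l.
    by rewrite kl soN // lie0r subrr.
  move: Jj Jk Jl => /idxn[]-> /idxn[]-> /idxn[]-> //; rewrite ?eqxx // => _;
    rewrite ?GnN ?GNn ?lieNr /v; case: s; rewrite /=; deltas.
  all: rewrite ?yn ?yn1 ?mulrsgT ?mulrsgF ?opprK //.
have vv s i j : idx n i -> idx n j -> [~ v s i, v s j] = 0.
  have c0 : [~ y0 s n, y0 s (n - 1)] = 0.
    by apply: y_serre0; try lia; rewrite /cartan; case: ifP; lia.
  by move=> /idxn[]-> /idxn[]->; rewrite ?liexx // /v; deltas; case: s c0 => c0;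
    rewrite /= ?c0 ?(lie_eq0C c0).
have n1S : (n - 1).+1 = n by lia.
have vv' i j : idx n i -> idx n j ->
    [~ v true i, v false j] = - G i j - d (n - 1) *+ (i == - j).
  have hn : h0 n = d (n - 1) + d n by rewrite d_last.
  have hn1 : h0 (n - 1)%N = d (n - 1) - d n.
    by have := @diff_dS (n - 1); rewrite n1S => -> //; lia.
  move=> /idxn[]-> /idxn[]->; rewrite ?Gnn ?GNnn ?GnN ?GNn /v /=; deltas;
    by rewrite yyT; [deltas; rewrite ?hn ?hn1; zmodule|lia..].
have dG k l : idx n k -> idx n l -> [~ d (n - 1), G k l] = 0.
  have dd0 : [~ d (n - 1), d n] = 0 by apply: dd; lia.
  by move=> /idxn[]-> /idxn[]->;
    rewrite ?Gnn ?GNnn ?GnN ?GNn ?lieNr ?lie0r ?dd0 ?oppr0.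
have dv s i : idx n i -> [~ d (n - 1), v s i] = v s i *~ sg s.
  move=> /idxn[]->; rewrite /v; case: s; deltas;
    (rewrite dy; [|lia..]); congr (_ *~ _); rewrite /sg /wt0; case: ifP; lia.
pose F := glue (n - 1) G (v true) (v false) (d (n - 1)).
exists F; split.
  apply: glue_so_family; rewrite ?n1S //; try lia.
  - exact: vG.
  - exact: vG.
  - exact: vv.
  - exact: vv.
  - by move=> i Ji; rewrite dv ?mulrsgT.
  - by move=> i Ji; rewrite dv ?mulrsgF.
have Jn : idx (n - 1).+1 n by lia.
have JNn : idx (n - 1).+1 (- n%:Z) by lia.
split=> [i Ji|s i Ji|_ [|]].
- have [in1|in1] := eqVneq i (n - 1)%N; first by rewrite in1 /F (glue_diag (n := n)) //; lia.
  by rewrite /F (glue_old (n := n)) ?Gd //; lia.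
- have -> : i = (n - 1)%N by lia.
  rewrite n1S; case: s; rewrite /F /sg ?mul1r ?mulN1r ?opprK.
    by rewrite (glue_pos (n := n)) // /v; [deltas|lia].
  by rewrite (glue_neg (n := n)) // /v ?eqxx //; lia.
- by rewrite /F /sg !mul1r (glue_pos (n := n)) // /v ?eqxx //; lia.
- by rewrite /F /sg !mulN1r (glue_neg (n := n)) // /v; [deltas|lia].
Qed.


Section Step.
Variables (m : nat) (G : int -> int -> L).
Hypothesis m_bounds : (0 < m)%N && (m.+1 < n)%N.
Hypothesis soG : so_family n m.+1 G.
Hypothesis labG : simple_labels m.+1 G.

(** The column in which [y0 s m] will sit, in row [sg s * m], once [m] and [- m] are adjoined. *)
Let c (s : bool) : int := - (sg s * m.+1%:Z).

Let sgK s k : absz (sg s * k%:Z) = k. Proof. by case: s; rewrite /sg; lia. Qed.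
Let c_abs s : absz (c s) = m.+1. Proof. by rewrite abszN sgK. Qed.
Let sgN s : sg (~~ s) = - sg s. Proof. by case: s. Qed.
Let cN s : - c s = c (~~ s). Proof. by rewrite /c sgN mulNr. Qed.

(** Away from [m.+1] the node [m] is adjacent to no node, so [so_centralizer] applies. In row [c s]
    a first entry is a root vector of the opposite sign, which commutes with [y0 s m], and the older
    family moves it to the other columns. *)
Lemma step_lowest s k l : idx m.+1 k -> idx m.+1 l -> k != - c s -> l != - c s ->
  [~ y0 s m, G k l] = 0.
Proof.
move=> Jk Jl kc lc; have [GN GG] := soG.
have le12 : (m.+1 <= m.+2)%N by [].
have Jm : (0 < m <= n)%N by lia.
have old i j : idx m.+2 i -> idx m.+2 j -> [~ y0 s m, G i j] = 0.
  apply: (so_centralizer _ (so_widen le12 soG) (simple_widen le12 labG)).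
  - by lia.
  - move=> t p Jp; have [->|st] := eqVneq t s.
      by apply: y_serre0; try lia; rewrite /cartan; case: ifP; lia.
    have -> : t = ~~ s by clear -st; case: t s st => [] [].
    by rewrite yy; [|lia..]; deltas.
  - move=> lt t; have [->|st] := eqVneq t s.
      by apply: y_serre0; try lia; rewrite /cartan; case: ifP; lia.
    have -> : t = ~~ s by clear -st; case: t s st => [] [].
    by rewrite yy; [|lia..]; deltas.
  - move=> p Jp; rewrite lieC dy; [|lia..].
    rewrite (_ : wt0 m p = 0) ?mulr0 ?mulr0z ?oppr0 // /wt0; case: ifP; lia.
have [_ Gy Gn] := labG.
have csplit j : idx m.+2 j -> [~ y0 s m, G (c s) j] = 0.
  have other t p : t = ~~ s -> (m < p <= n)%N -> [~ y0 s m, y0 t p] = 0.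
    by move=> -> Jp; rewrite yy; [|lia..]; deltas.
  have first_j : [~ y0 s m, G (c s) (sg s * m.+2%:Z)] = 0.
    have := Gy (~~ s) m.+1; rewrite sgN !mulNr opprK => -> //; last by lia.
    by apply: other; lia.
  have step i i' : idx m.+2 i -> idx m.+2 i' -> `|i|%N <> `|i'|%N ->
      [~ y0 s m, G (c s) i] = 0 -> [~ y0 s m, G (c s) i'] = 0.
    move=> Ji Ji' neq ci.
    have -> : G (c s) i' = [~ G (c s) i, G (- i) i'].
      by have ca := c_abs s; rewrite GG; [deltas|lia..].
    by apply: commute_lie => //; apply: old; lia.
  have JJ : (m.+2 <= absz (sg s * m.+2%:Z)%R <= n)%N by rewrite sgK; lia.
  move=> Jj; have [jm|jm] := eqVneq `|j|%N m.+2; last first.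
    by apply: (step (sg s * m.+2%:Z)) => //; rewrite sgK; apply/eqP; rewrite eq_sym.
  have [->//|jN] := eqVneq j (sg s * m.+2%:Z).
  have {}jN : j = - (sg s * m.+2%:Z) by move: (sgK s m.+2); lia.
  (* Passing from an index to its opposite needs a third absolute value. None is left when
     [m.+2 = n], but then the entry is a root vector of node [n]. *)
  have [mn|mn] := eqVneq m.+2 n.
    have := Gn _ (~~ s); rewrite sgN !mulNr (_ : (n - 1)%N = m.+1); last by lia.
    by rewrite -mn jN => -> //; apply: other; lia.
  apply: (step n%:Z); try lia.
  apply: (step (sg s * m.+2%:Z)) => //; first lia.
  by rewrite sgK; move/eqP: mn; lia.
have splitc i : idx m.+1 i -> i != - c s -> i = c s \/ idx m.+2 i.
  by move: (c s) (c_abs s) => cs; lia.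
have [->|Jk'] := splitc k Jk kc; have [->|Jl'] := splitc l Jl lc.
- by rewrite (so_family_diag charK soG) ?lie0r // c_abs; lia.
- exact: csplit.
- by rewrite GN ?lieNr ?csplit ?oppr0 ?c_abs //; lia.
- exact: old.
Qed.

Lemma step_diag s : G (- c s) (c s) = d m.+1 *~ sg s.
Proof.
have [GN _] := soG; have [Gd _ _] := labG.
case: s; rewrite ?mulrsgT ?mulrsgF /c /sg ?mulN1r ?mul1r ?opprK.
  by rewrite Gd //; lia.
by rewrite GN ?Gd //; lia.
Qed.

(** For a neighbour [k] of [m], the Serre relations of [(m, k)] and [(k, m)] give both identities at
    the index labelled by [k]; [lowest_b_diag] and [lowest_b_opp] transfer them to the others. *)
Lemma step_good s i : idx m.+2 i ->
  [~ [~ y0 s m, G (- c s) i], G (- c s) i] = 0 /\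
  [~ y0 s m, [~ y0 s m, G (- c s) i]] = 0.
Proof.
have [_ Gy Gn] := labG.
have good_label k j : (0 < k <= n)%N -> cartan n m k = -1 -> cartan n k m = -1 ->
    G (- c s) j = y0 s k ->
    [~ [~ y0 s m, G (- c s) j], G (- c s) j] = 0 /\
    [~ y0 s m, [~ y0 s m, G (- c s) j]] = 0.
  move=> Jk cmk ckm ->; split; last by apply: y_serre1 => //; lia.
  by rewrite lieC (lieC (y0 s m)) lieNr opprK y_serre1 //; lia.
have good_step j k : idx m.+2 j -> idx m.+2 k -> `|j|%N <> `|k|%N ->
    [~ [~ y0 s m, G (- c s) j], G (- c s) j] = 0 /\
    [~ y0 s m, [~ y0 s m, G (- c s) j]] = 0 ->
    [~ [~ y0 s m, G (- c s) k], G (- c s) k] = 0 /\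
    [~ y0 s m, [~ y0 s m, G (- c s) k]] = 0.
  have eG := @step_lowest s; have mn : (m.+1 < n)%N by lia.
  move=> Jj Jk neq [bj ej]; split.
    exact: (lowest_b_diag charK mn (c_abs s) soG eG Jj Jk neq bj).
  exact: (lowest_b_opp mn (c_abs s) soG eG Jj Jk neq ej).
have Ji0 : (m.+2 <= absz (- (sg s * m.+2%:Z))%R <= n)%N by rewrite abszN sgK; lia.
have good0 := good_label m.+1 (- (sg s * m.+2%:Z)).
have {}good0 := good0 _ _ _ _.
move=> Ji; have {}good0 : [~ [~ y0 s m, G (- c s) (- (sg s * m.+2%:Z))],
      G (- c s) (- (sg s * m.+2%:Z))] = 0 /\
    [~ y0 s m, [~ y0 s m, G (- c s) (- (sg s * m.+2%:Z))]] = 0.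
  apply: good0; try lia; try by rewrite /cartan; case: ifP; lia.
  by rewrite opprK Gy //; lia.
have [im|im] := eqVneq `|i|%N m.+2; last first.
  by apply: (good_step (- (sg s * m.+2%:Z))) => //; rewrite abszN sgK; lia.
have [->//|iN] := eqVneq i (- (sg s * m.+2%:Z)).
have {}iN : i = sg s * m.+2%:Z by move: (sgK s m.+2); lia.
(* When [m.+2 = n], node [n] is a second neighbour of [m] and settles the opposite index, for which
   no third absolute value is left. *)
have [mn|mn] := eqVneq m.+2 n.
  apply: (good_label n); try lia; try by rewrite /cartan; case: ifP; lia.
  by rewrite opprK iN mn -Gn; [congr (G (_ * _) _)|]; lia.
apply: (good_step n%:Z); try lia.
by apply: (good_step (- (sg s * m.+2%:Z))) => //; rewrite ?abszN ?sgK; lia.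
Qed.

Lemma step_vector s : exists v, [/\ v (c s) = y0 s m, equivariant n m G v &
  forall i j, idx m.+1 i -> idx m.+1 j -> [~ v i, v j] = 0].
Proof.
have mn : (m.+1 < n)%N by lia.
have ydiag : [~ y0 s m, G (- c s) (c s)] = y0 s m.
  rewrite step_diag lieC -scaler_int lieZl scaler_int dy; [|lia..].
  rewrite -mulrzA -mulrNz (_ : - _ = 1) ?mulr1z // /wt0.
  by case: (s); rewrite /sg; case: ifP; lia.
have [v [vc vE vG]] := vector_module charK mn (c_abs s) soG (@step_lowest s) ydiag
  (fun i Ji => (step_good s Ji).1).
exists v; split=> //.
apply: (equivariant_commute charK mn (c_abs s) vG) => j Jj.
by rewrite vc vE //; case: (step_good s Jj).
Qed.

Lemma so_step : exists F, so_family n m F /\ simple_labels m F.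
Proof.
have mn : (m.+1 < n)%N by lia.
have m_lt : (0 < m < n)%N by lia.
have [GN GG] := soG; have [Gd Gy Gn] := labG.
have [v [vc vG vv]] := step_vector true.
have [v' [v'c v'G v'v']] := step_vector false.
have cF : c false = - c true by rewrite cN.
have dG k l : idx m.+1 k -> idx m.+1 l -> [~ d m, G k l] = 0.
  apply: so_centralizer => //; first lia.
  - move=> s p Jp; rewrite dy; [|lia..].
    by rewrite (_ : wt0 p m = 0) ?mulr0 ?mulr0z // /wt0; case: ifP; lia.
  - move=> _ s; rewrite dy; [|lia..].
    by rewrite (_ : wt0 n m = 0) ?mulr0 ?mulr0z // /wt0; case: ifP; lia.
  - by move=> p Jp; apply: dd; lia.
have dy_sg s : [~ d m, y0 s m] = y0 s m *~ sg s.
  rewrite dy; [|lia..]; congr (_ *~ _); rewrite (_ : wt0 m m = 1) ?mulr1 //.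
  by rewrite /wt0; case: ifP; lia.
have vd := equivariant_eigen mn (c_abs true) vG dG.
have {}vd i : idx m.+1 i -> [~ d m, v i] = v i.
  by move=> Ji; rewrite (vd (sg true)) ?mulrsgT // vc dy_sg.
have v'd := equivariant_eigen mn (c_abs false) v'G dG.
have {}v'd i : idx m.+1 i -> [~ d m, v' i] = - v' i.
  by move=> Ji; rewrite (v'd (sg false)) ?mulrsgF // v'c dy_sg.
have vv' : forall i j, idx m.+1 i -> idx m.+1 j ->
    [~ v i, v' j] = - G i j - d m *+ (i == - j).
  (* Only the pair [(c, - c)] is to be checked, where both sides are [- h0 m = d m.+1 - d m]. *)
  apply: (equivariant_pairing mn (c_abs true) soG vG v'G dG).
  rewrite -cF v'c vc yyT; [|lia..]; rewrite eqxx mulr1n -diff_dS; last by lia.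
  have Jc : idx m.+1 (c true) by rewrite c_abs; lia.
  rewrite cF (GN (- c true)) ?abszN // step_diag mulrsgT opprK.
  by zmodule.
exists (glue m G v v' (d m)); split; first exact: glue_so_family.
have idx_next s k : (m.+1 <= k <= n)%N -> (m.+1 <= absz (sg s * k%:Z)%R <= n)%N.
  by rewrite sgK.
split=> [i Ji|s i Ji|_ s].
- have [->|im] := eqVneq i m; first by rewrite (glue_diag (n := n)).
  by rewrite (glue_old (n := n)) ?Gd //; lia.
- have [->|im] := eqVneq i m.
    have Jc t : idx m.+1 (c t) by rewrite c_abs; lia.
    case: s; rewrite -/(c _) ?[sg _ * m%:Z]mul1r ?[sg _ * m%:Z]mulN1r.
      by rewrite (glue_pos (n := n)).
    by rewrite (glue_neg (n := n)).
  have Ji0 := idx_next s i; have Ji1 := idx_next s i.+1.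
  by rewrite (glue_old (n := n)); [apply: Gy| |clear Ji1|clear Ji0]; lia.
- have Jn0 := idx_next s (n - 1)%N; have Jn1 := idx_next s n.
  by rewrite (glue_old (n := n)); [apply: Gn| | |]; lia.
Qed.

End Step.

Lemma so_exists : exists G, so_family n 1 G /\ simple_labels 1 G.
Proof.
suff H k : (k < n - 1)%N -> exists G, so_family n (n - 1 - k) G /\
    simple_labels (n - 1 - k) G.
  by have := H (n - 2)%N; rewrite (_ : (n - 1 - (n - 2) = 1)%N); [apply|]; lia.
elim: k => [|k IH] lt_k; first by rewrite subn0; exact: so_fork.
have [|G [soG labG]] := IH; first by lia.
have e : (n - 1 - k = (n - 1 - k.+1).+1)%N by lia.
by rewrite e in soG labG; apply: (so_step _ soG labG); lia.
Qed.

End DrinfeldRelations.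

(** * Level 1: commutation of the diagonal elements [t a] with so(2n) *)

Section OddLevels.
Variables (K : fieldType) (L : lieAlgType K).
Hypothesis charK : [pchar K] =i pred0.
Variable n : nat.
Hypothesis n_gt4 : (4 < n)%N.
Variables (h0 h1 : nat -> L) (x : bool -> nat -> nat -> L).
Hypothesis rels : drinfeld_relations n h0 h1 x.
Variable G : int -> int -> L.
Hypothesis soG : so_family n 1 G.
Hypothesis labG : simple_labels n h0 x 1 G.

Local Notation y0 := (y0 x).
Local Notation y1 := (y1 x).
Local Notation wt0 := (wt0 n).
Local Notation wt1 := (wt1 n).
Local Notation idx k i := (k <= `|i| <= n)%N.

(** The subtracted term is the mean of the first one over all indices. *)
Definition odd_diag (a : nat) : L :=
  \sum_(a <= k < n) h1 k
  - n%:R^-1 *: \sum_(1 <= b < n.+1) \sum_(b <= k < n) h1 k.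

Local Notation t := odd_diag.

Lemma t_sum : \sum_(1 <= b < n.+1) t b = 0.
Proof.
rewrite sumrB sumr_const_nat subn1 /= -scaler_nat scalerA mulfV ?scale1r ?subrr //.
by rewrite (iffLR (pcharf0P K) charK); lia.
Qed.

Lemma t_diff a : (a < n)%N -> t a - t a.+1 = h1 a.
Proof. by move=> lt_an; rewrite /odd_diag big_ltn //; zmodule. Qed.

Lemma commute_t u a : (0 < a)%N ->
  (forall k, (0 < k < n)%N -> [~ u, h1 k] = 0) -> [~ u, t a] = 0.
Proof.
move=> a_gt0 uh.
have us b : (0 < b)%N -> [~ u, \sum_(b <= k < n) h1 k] = 0.
  by move=> b_gt0; rewrite lie_sumr big_nat big1 // => k Jk; apply: uh; lia.
rewrite lieBr lieZr us // sub0r lie_sumr big_nat big1 ?scaler0 ?oppr0 // => b Jb.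
by apply: us; lia.
Qed.

Lemma t_comm a b : (0 < a)%N -> (0 < b)%N -> [~ t a, t b] = 0.
Proof.
move=> a_gt0 b_gt0; apply: commute_t => // k Jk; apply: lie_eq0C.
by apply: commute_t => // l Jl; apply: (dr_h1h1 rels).
Qed.

Lemma h0t i a : (0 < i <= n)%N -> (0 < a)%N -> [~ h0 i, t a] = 0.
Proof. by move=> Ji a_gt0; apply: commute_t => // k Jk; apply: (dr_h0h1 rels). Qed.

Lemma sum_delta j : (0 < j <= n)%N -> \sum_(1 <= a < n.+1) (a == j)%:Z = 1.
Proof.
move=> Jj; rewrite (bigD1_seq j) ?iota_uniq ?mem_index_iota //= eqxx big1 //.
by move=> i /negbTE ->.
Qed.

Lemma sum_wt1 j : (0 < j <= n)%N -> \sum_(1 <= a < n.+1) wt1 j a = 0.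
Proof.
move=> Jj; rewrite /wt1; have [_|jn] := eqVneq j n.
  by rewrite sumrB !sum_delta ?subrr //; lia.
by rewrite sumrB !sum_delta ?subrr //; lia.
Qed.

(** The defect [u b] does not depend on [b], because the differences [h1 b] of the [t b] act as
    prescribed. Both the [t b] and the weights [wt1 j b] have sum 0, so [n] times the defect is
    0. *)
Lemma ty s a j : (0 < a <= n)%N -> (0 < j <= n)%N ->
  [~ t a, y0 s j] = y1 s j *~ wt1 j a.
Proof.
move=> Ja Jj; pose u b := [~ t b, y0 s j] - y1 s j *~ wt1 j b.
have uS b : (0 < b < n)%N -> u b.+1 = u b.
  move=> Jb; apply/eqP; rewrite eq_sym -subr_eq0; apply/eqP.
  transitivity ([~ t b - t b.+1, y0 s j] - (y1 s j *~ wt1 j b - y1 s j *~ wt1 j b.+1)).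
    by rewrite /u lieBl; zmodule.
  rewrite t_diff; last by lia.
  rewrite (h1y rels) // -!mulrzBr (_ : _ - _ = 0) ?mulr0z // /wt1 /cartanr /cartan /=.
  by case: ifP; case: ifP; lia.
have u1 b : (0 < b <= n)%N -> u b = u 1%N.
  elim: b => // b IH Jb; case: b IH Jb => // b IH Jb.
  by rewrite uS ?IH //; lia.
have : u a *+ n = 0.
  transitivity (\sum_(1 <= b < n.+1) u b).
    rewrite big_nat (eq_bigr (fun=> u a)) => [|b Jb]; last by rewrite !u1 //; lia.
    by rewrite -big_nat sumr_const_nat subn1.
  rewrite sumrB -lie_suml t_sum lie0l sub0r.
  by rewrite -mulrz_sumr sum_wt1 // mulr0z oppr0.
move/(mulrn_eq0_lie charK (ltn_trans _ n_gt4)) => /(_ isT)/eqP.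
by rewrite subr_eq0 => /eqP.
Qed.

Lemma y1y0 s i : (0 < i <= n)%N -> [~ y1 s i, y0 s i] = 0.
Proof.
move=> Ji; have : [~ x s i 1, x s i 0] = 0.
  by apply: (eq_opp_eq0 charK); rewrite {1}(dr_x1x0 rels) // lieC.
by rewrite /y1 /y0; case: s => xx; rewrite ?lieNr ?xx ?oppr0.
Qed.

(** For the lower sign, [t i] is applied to [[~ y0 true i, y0 false i] = - h0 i]. It kills the
    right-hand side, so the level can be moved from one factor to the other at the cost of a
    sign. *)
Lemma y1y s i : (0 < i < n)%N -> [~ y1 s i, y0 (~~ s) i] = - h1 i.
Proof.
have y1yT j : (0 < j < n)%N -> [~ y1 true j, y0 false j] = - h1 j.
  by move=> Jj; rewrite /y1 /y0 lieNr (dr_x1x rels).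
move=> Ji; case: s; first exact: y1yT.
have Ji' : (0 < i <= n)%N by lia.
have wii : wt1 i i = 1 by rewrite /wt1; case: ifP; lia.
have tyi s : [~ t i, y0 s i] = y1 s i by rewrite ty // wii mulr1z.
have : [~ t i, [~ y0 true i, y0 false i]] = 0.
  have ht : [~ t i, h0 i] = 0 by apply: lie_eq0C; apply: h0t; lia.
  by rewrite (yyT rels) // eqxx mulr1n lieNr ht oppr0.
rewrite lie_lier !tyi y1yT // (lieC (y0 true i)) => /eqP.
by rewrite subr_eq0 => /eqP <-.
Qed.

(* The relations between two adjacent nodes make the difference
   [[X, Y1] - [X1, Y]] a null vector for [X], [Xm] of nonzero weight for
   [[X, Xm]], hence zero. *)
Lemma adjacent_commute (X Y X1 Y1 Xm T U : L) :
  [~ T, X] = - X1 -> [~ T, Y] = Y1 -> [~ U, X] = 0 -> [~ U, Y] = - Y1 ->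
  [~ U, Xm] = 0 -> [~ X, [~ X, Y]] = 0 -> [~ X1, X] = 0 -> [~ Xm, Y] = 0 ->
  [~ [~ X, Xm], T] = 0 -> [~ [~ X, Xm], X] = X *~ (-2) ->
  [~ [~ X, Xm], Y] = Y -> [~ [~ X1, Xm], Y] = Y1 ->
  [~ X, Y1] = [~ X1, Y].
Proof.
move=> TX TY UX UY UXm XXY X1X XmY kT kX kY X1XmY.
have kY1 : [~ [~ X, Xm], Y1] = Y1 by rewrite -TY lie_lier kT kY lie0l add0r.
have XXY1 : [~ X, [~ X, Y1]] = 0.
  have : [~ U, [~ X, [~ X, Y]]] = 0 by rewrite XXY lie0r.
  by rewrite !(lie_lier U) UX UY !lie0l !add0r !lieNr => /eqP; rewrite oppr_eq0 => /eqP.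
have X1XY : [~ X1, [~ X, Y]] = 0.
  have : [~ T, [~ X, [~ X, Y]]] = 0 by rewrite XXY lie0r.
  rewrite !(lie_lier T) TX TY !lieDr XXY1 addr0 !lieNl !lieNr.
  rewrite (lie_lier X X1) (lieC X X1) X1X oppr0 lie0l add0r -opprD => /eqP.
  by rewrite oppr_eq0 => /eqP/(double_eq0 charK).
have XmY1 : [~ Xm, Y1] = 0.
  have : [~ U, [~ Xm, Y]] = 0 by rewrite XmY lie0r.
  by rewrite lie_lier UXm UY lie0l add0r lieNr => /eqP; rewrite oppr_eq0 => /eqP.
pose w := [~ X, Y1] - [~ X1, Y].
have Xw : [~ X, w] = 0.
  rewrite lieBr XXY1 (lie_lier X X1) (lieC X X1) X1X oppr0 lie0l X1XY.
  by zmodule.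
have Xmw : [~ Xm, w] = 0.
  rewrite lieBr !(lie_lier Xm) XmY XmY1 !lie0r !addr0 (lieC Xm X) (lieC Xm X1).
  by rewrite !lieNl kY1 X1XmY; zmodule.
have kw : [~ [~ X, Xm], w] = 0.
  by rewrite lie_liel Xw lie0l add0r Xmw lie0r.
have kX1 : [~ [~ X, Xm], X1] = X1 *~ (-2).
  have -> : X1 = - [~ T, X] by rewrite TX opprK.
  by rewrite lieNr lie_lier kT lie0l add0r kX -scaler_int lieZr scaler_int mulNrz.
have : [~ [~ X, Xm], w] = - w.
  rewrite lieBr !(lie_lier [~ X, Xm]) kX kX1 kY kY1 -!scaler_int !lieZl !scaler_int.
  by rewrite /w (_ : -2 = - (2%N%:Z)) // !mulrNz -!pmulrn; zmodule.
rewrite kw => /eqP; rewrite eq_sym oppr_eq0 /w subr_eq0 => /eqP; exact.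
Qed.

(** [adjacent_commute] with [T = t a] and [U = t a.+1]: the roots of [p] and [q] meet at the index
    [a], while [a.+1] occurs in the root of [q] only. *)
Lemma y_adjacent s p q a : (0 < p < n - 1)%N -> (0 < q <= n)%N -> (0 < a < n)%N ->
  cartan n p q = -1 -> cartanr n 1 p q = -1 ->
  wt1 p a = -1 -> wt1 q a = 1 -> wt1 p a.+1 = 0 -> wt1 q a.+1 = -1 ->
  [~ y0 s p, y1 s q] = [~ y1 s p, y0 s q].
Proof.
move=> Jp Jq Ja cpq c1pq wpa wqa wpa1 wqa1.
have pq : p != q by apply/eqP=> epq; move: cpq; rewrite /cartan epq; case: ifP; lia.
have kE u z : [~ h0 p, u] = u *~ (sg s * z) ->
    [~ [~ y0 s p, y0 (~~ s) p], u] = u *~ (- z).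
  move=> hu; rewrite (yy rels) ?eqxx ?mulr1n; [|lia..].
  rewrite lieNl -scaler_int lieZl hu scaler_int -mulrzA -mulrNz.
  by congr (_ *~ _); case: (s); rewrite /sg /=; lia.
apply: (@adjacent_commute _ _ _ _ (y0 (~~ s) p) (t a) (t a.+1)).
- by rewrite ty ?wpa ?mulrN1z //; lia.
- by rewrite ty ?wqa ?mulr1z //; lia.
- by rewrite ty ?wpa1 ?mulr0z //; lia.
- by rewrite ty ?wqa1 ?mulrN1z //; lia.
- by rewrite ty ?wpa1 ?mulr0z //; lia.
- by apply: (y_serre1 rels) => //; lia.
- by apply: y1y0; lia.
- by have := yy rels (~~ s) (i := p) (j := q); rewrite negbK (negbTE pq) mulr0n;
    apply; lia.
- rewrite (yy rels) ?eqxx ?mulr1n; [|lia..].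
  by rewrite lieNl -scaler_int lieZl h0t ?scaler0 ?oppr0 //; lia.
- apply: (kE _ 2); rewrite (h0y rels); [|lia..]; congr (_ *~ (_ * _)).
  by rewrite /cartan; case: ifP; lia.
- rewrite (kE _ (-1)) ?opprK ?mulr1z // (h0y rels) ?cpq //; lia.
- rewrite y1y; last by lia.
  by rewrite lieNl (h1y rels) ?c1pq ?mulrN1z ?opprK //; lia.
Qed.

Lemma y_adjacentS s p : (0 < p < n - 1)%N ->
  [~ y0 s p, y1 s p.+1] = [~ y1 s p, y0 s p.+1].
Proof.
move=> Jp; apply: (@y_adjacent s p p.+1 p.+1); try lia;
  rewrite /wt1 /cartanr /cartan /=; repeat case: ifP; lia.
Qed.

Lemma y_adjacentn s : [~ y0 s (n - 2), y1 s n] = [~ y1 s (n - 2), y0 s n].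
Proof.
apply: (@y_adjacent s (n - 2) n (n - 1)); try lia;
  rewrite /wt1 /cartanr /cartan /=; repeat case: ifP; lia.
Qed.

Lemma t_wt0 s a j : (0 < a <= n)%N -> (0 < j <= n)%N -> wt1 j a = 0 ->
  [~ t a, y0 s j] = 0.
Proof. by move=> Ja Jj wt; rewrite ty // wt mulr0z. Qed.

Lemma t_wt1 s a j : (0 < a <= n)%N -> (0 < j <= n)%N -> wt1 j a = 1 ->
  [~ t a, y0 s j] = y1 s j.
Proof. by move=> Ja Jj wt; rewrite ty // wt mulr1z. Qed.

Lemma t_wtN1 s a j : (0 < a <= n)%N -> (0 < j <= n)%N -> wt1 j a = -1 ->
  [~ t a, y0 s j] = - y1 s j.
Proof. by move=> Ja Jj wt; rewrite ty // wt mulrN1z. Qed.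

Lemma t_y_succ s a : (1 < a < n)%N -> [~ t a, [~ y0 s a.-1, y0 s a]] = 0.
Proof.
move=> Ja.
have ta1 : [~ t a, y0 s a.-1] = - y1 s a.-1.
  by apply: t_wtN1; try lia; rewrite /wt1; case: ifP; lia.
have ta : [~ t a, y0 s a] = y1 s a.
  by apply: t_wt1; try lia; rewrite /wt1; case: ifP; lia.
have := @y_adjacentS s a.-1; rewrite (_ : a.-1.+1 = a); last by lia.
by rewrite lie_lier ta1 ta lieNl => ->; [rewrite addNr|lia].
Qed.

Lemma t_y_fork s : [~ t (n - 1), [~ y0 s (n - 2), y0 s n]] = 0.
Proof.
have ta1 : [~ t (n - 1), y0 s (n - 2)] = - y1 s (n - 2).
  by apply: t_wtN1; try lia; rewrite /wt1; case: ifP; lia.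
have ta : [~ t (n - 1), y0 s n] = y1 s n.
  by apply: t_wt1; try lia; rewrite /wt1 eqxx; lia.
by rewrite lie_lier ta1 ta lieNl y_adjacentn addNr.
Qed.

(** The nested bracket joins the indices [n - 2] and [n - 1] with a change of sign, passing through
    [n]. Adjacency rewrites the two terms created by [t n] so that [dr_end1] cancels them. *)
Lemma t_y_end s : [~ t n, [~ [~ y0 s (n - 2), y0 s (n - 1)], y0 s n]] = 0.
Proof.
have ta2 : [~ t n, y0 s (n - 2)] = 0.
  by apply: t_wt0; try lia; rewrite /wt1; case: ifP; lia.
have ta1 : [~ t n, y0 s (n - 1)] = - y1 s (n - 1).
  by apply: t_wtN1; try lia; rewrite /wt1; case: ifP; lia.
have ta : [~ t n, y0 s n] = - y1 s n.
  by apply: t_wtN1; try lia; rewrite /wt1 eqxx; lia.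
rewrite !(lie_lier (t n)) ta2 ta1 ta lie0l add0r !(lieNl, lieNr).
have := @y_adjacentS s (n - 2); rewrite (_ : (n - 2).+1 = (n - 1)%N); last by lia.
move=> -> //; last by lia.
have yn0 : [~ y0 s (n - 1), y0 s n] = 0.
  by apply: (y_serre0 rels); try lia; rewrite /cartan; case: ifP; lia.
rewrite lie_liel yn0 lie0r addr0 -y_adjacentn (lieC _ (y0 s (n - 1))) opprK.
have := dr_end1 rels s; rewrite (lieC (x s n 1)).
rewrite /y0 /y1; case: (s); rewrite ?(lieNl, lieNr) ?opprK => /eqP.
  by rewrite eqr_opp => /eqP ->; rewrite addrN.
by rewrite eqr_opp => /eqP ->; rewrite addrN.
Qed.

(** [so_connect] is used with [a] skipped. The edge over [a] and, for [a >= n - 1], the edge that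
    changes the sign are composites passing through [a], in which the contributions of [t a]
    cancel. *)
Lemma t_commute a i j : (0 < a <= n)%N -> idx 1 i -> idx 1 j ->
  `|i|%N <> `|j|%N -> `|i|%N <> a -> `|j|%N <> a -> [~ t a, G i j] = 0.
Proof.
move=> Ja Ji Jj ij ia ja; have [GN GG] := soG; have [_ Gy Gn] := labG.
have sgK s k : absz (sg s * k%:Z) = k by case: s; rewrite /sg; lia.
have Gtr i' j' k' : idx 1 i' -> idx 1 j' -> idx 1 k' -> `|i'|%N <> `|j'|%N ->
    `|i'|%N <> `|k'|%N -> `|j'|%N <> `|k'|%N ->
    G i' k' = [~ G i' (- j'), G j' k'].
  by move=> *; rewrite GG; [deltas|lia..].
have Js s k : (0 < k <= n)%N -> (1 <= absz (sg s * k%:Z)%R <= n)%N by rewrite sgK.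
apply: (@so_connect _ _ _ n_gt4 1 (fun w => [~ t a, w] = 0) G a) => //; try lia.
- by move=> w tw; rewrite lieNr tw oppr0.
- by move=> w w'; exact: commute_lie.
- move=> s k Sk Sk'; rewrite Gy; last by lia.
  by apply: t_wt0; try lia; rewrite /wt1; case: ifP; lia.
- move=> s Sk Sk'.
  rewrite (Gtr _ (sg s * a%:Z)) ?abszN ?sgK; try (by apply: Js; lia); try lia.
  have := Gy s a.-1; rewrite (_ : a.-1.+1 = a) => [->|]; [|lia..].
  by rewrite Gy; [apply: t_y_succ|]; lia.
move=> k l Sk Sl kl.
have [a_n1|a_n1] := ltnP a (n - 1).
  exists (n - 1)%N, n; split=> [||| s]; rewrite ?Gn; try lia.
  by apply: t_wt0; try lia; rewrite /wt1 eqxx; lia.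
have [an|an] := eqVneq a n; last first.
  have {}an : a = (n - 1)%N by lia.
  exists (n - 2)%N, n; split=> [||| s]; try lia.
  rewrite an (Gtr _ (sg s * (n - 1)%N%:Z)) ?sgK; try (by apply: Js; lia); try lia.
  have := Gy s (n - 2)%N; rewrite (_ : (n - 2).+1 = (n - 1)%N) => [->|]; [|lia..].
  by rewrite Gn; [exact: t_y_fork|lia].
exists (n - 2)%N, (n - 1)%N; split=> [||| s]; try lia.
rewrite an (Gtr _ (sg s * n%:Z)) ?sgK; try (by apply: Js; lia); try lia.
rewrite (GN (sg s * (n - 1)%N%:Z) (sg s * n%:Z)); try (by apply: Js; lia).
rewrite Gn; last by lia.
rewrite lieNr (Gtr _ (sg s * (n - 1)%N%:Z)) ?abszN ?sgK; try (by apply: Js; lia); try lia.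
have := Gy s (n - 2)%N; rewrite (_ : (n - 2).+1 = (n - 1)%N) => [->|]; [|lia..].
have := Gy s (n - 1)%N; rewrite (_ : (n - 1).+1 = n) => [->|]; [|lia..].
by rewrite lieNr t_y_end oppr0.
Qed.

End OddLevels.

(** * Elements of all levels and their brackets with level 0 and with the [t a] *)

Lemma pair_cases (i j k l : int) : `|i|%N <> `|j|%N -> `|k|%N <> `|l|%N ->
  j <> k -> i <> l -> j <> - l -> i <> - k ->
  [\/ `|k|%N <> `|i|%N /\ `|k|%N <> `|j|%N,
      `|l|%N <> `|i|%N /\ `|l|%N <> `|j|%N,
      k = i /\ l = j | k = - j /\ l = - i].
Proof.
move=> ij kl jk il jl ik.
have [/eqP ki|/eqP ki] := boolP (`|k| == `|i|)%N.
  have [/eqP lj|/eqP lj] := boolP (`|l| == `|j|)%N.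
    by constructor 3; clear il jk kl ij; lia.
  by constructor 2; clear il jk jl ik; lia.
have [/eqP kj|/eqP kj] := boolP (`|k| == `|j|)%N; last by constructor 1.
have [/eqP li|/eqP li] := boolP (`|l| == `|i|)%N.
  by constructor 4; clear jl ik kl ij; lia.
by constructor 2; clear il jk jl ik; lia.
Qed.

Section Levels.
Variables (K : fieldType) (L : lieAlgType K).
Hypothesis charK : [pchar K] =i pred0.
Variable n : nat.
Hypothesis n_gt4 : (4 < n)%N.

Local Notation idx i := (1 <= `|i| <= n)%N.

Variables (G : int -> int -> L) (t : nat -> L).
Hypothesis soG : so_family n 1 G.
Hypothesis tt : forall a b, (0 < a)%N -> (0 < b)%N -> [~ t a, t b] = 0.
Hypothesis t_sum : \sum_(1 <= b < n.+1) t b = 0.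
Hypothesis tG : forall a i j, (0 < a <= n)%N -> idx i -> idx j ->
  `|i|%N <> `|j|%N -> `|i|%N <> a -> `|j|%N <> a -> [~ t a, G i j] = 0.

(** The bound [4 < n] leaves five absolute values to choose from. *)
Lemma avoid4 a b c d : exists p : nat,
  [/\ (1 <= p <= n)%N, p <> a, p <> b, p <> c & p <> d].
Proof.
have /allPn[p] : ~~ all (mem [:: a; b; c; d]) (iota 1 5).
  by apply/negP => /allP sub; have := uniq_leq_size (iota_uniq 1 5) sub.
rewrite mem_iota !inE !negb_or => Jp /and4P[/eqP pa /eqP pb /eqP pc /eqP pd].
by exists p; split=> //; lia.
Qed.

Lemma t_last u a : (0 < a <= n)%N ->
  (forall b, (0 < b <= n)%N -> b <> a -> [~ t b, u] = 0) -> [~ t a, u] = 0.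
Proof.
move=> Ja tu; have := lie0l u; rewrite -t_sum lie_suml.
rewrite (bigD1_seq a) ?iota_uniq ?mem_index_iota //= big_seq_cond big1 ?addr0 //.
by move=> b /andP[]; rewrite mem_index_iota => Jb /eqP; apply: tu.
Qed.

Definition unit_so (i j : int) : L := G i (- j).

Local Notation F := unit_so.

Lemma FN i j : idx i -> idx j -> F (- j) (- i) = - F i j.
Proof. by move=> Ji Jj; case: soG => GN _; rewrite /unit_so opprK GN ?abszN. Qed.

Lemma F_trans i j k : idx i -> idx j -> idx k -> `|i|%N <> `|j|%N ->
  `|i|%N <> `|k|%N -> `|j|%N <> `|k|%N -> [~ F i j, F j k] = F i k.
Proof. by move=> *; case: soG => _ GG; rewrite GG; [deltas|lia..]. Qed.

Lemma F_zero i j k l : idx i -> idx j -> idx k -> idx l -> j <> k -> i <> l ->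
  j <> - l -> i <> - k -> [~ F i j, F k l] = 0.
Proof. by move=> *; case: soG => _ GG; rewrite GG; [deltas|lia..]. Qed.

(** Plays the part of [F_{i,j}(u^r)] for [|i| <> |j|], on which the diagonal matrix with entries [u]
    at [i] and [- i] acts as multiplication by [u]. *)
Definition level (r : nat) (i j : int) : L := iter r (lie (t `|i|)) (F i j).

Local Notation E := level.

Lemma t_iter a b r u : (0 < a)%N -> (0 < b)%N ->
  [~ t a, iter r (lie (t b)) u] = iter r (lie (t b)) [~ t a, u].
Proof.
move=> a_gt0 b_gt0; elim: r => //= r IH.
by rewrite lie_lier tt // lie0l add0r IH.
Qed.

Lemma iter_lie0 r (v : L) : iter r (lie v) 0 = 0.
Proof. by elim: r => //= r ->; rewrite lie0r. Qed.

Lemma iter_lieN r (v u : L) : iter r (lie v) (- u) = - iter r (lie v) u.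
Proof. by elim: r => //= r ->; rewrite lieNr. Qed.

Lemma t_F_sum i j : idx i -> idx j -> `|i|%N <> `|j|%N ->
  [~ t `|j|, F i j] = - [~ t `|i|, F i j].
Proof.
move=> Ji Jj ij; have := lie0l (F i j); rewrite -t_sum lie_suml.
rewrite (bigD1_seq `|i|%N) ?iota_uniq ?mem_index_iota //=.
rewrite -big_filter (bigD1_seq `|j|%N) ?filter_uniq ?iota_uniq //=; last first.
  by rewrite mem_filter mem_index_iota; apply/andP; split; lia.
rewrite big_seq_cond big1 ?addr0.
  by rewrite t_sum => /eqP; rewrite addrC addr_eq0 => /eqP.
move=> b; rewrite mem_filter mem_index_iota => /andP[/andP[bi Jb] bj].
by apply: tG; rewrite ?abszN //; lia.
Qed.

Lemma t_E a r i j : (0 < a <= n)%N -> idx i -> idx j -> `|i|%N <> `|j|%N ->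
  [~ t a, E r i j] = E r.+1 i j *~ ((a == `|i|%N)%:Z - (a == `|j|%N)%:Z).
Proof.
move=> Ja Ji Jj ij; rewrite /level iterSr t_iter; [|lia..].
have [->|ai] := eqVneq a `|i|%N.
  by deltas; rewrite ?subr0 ?mulr1z.
have [->|aj] := eqVneq a `|j|%N.
  by rewrite t_F_sum // iter_lieN; deltas; rewrite ?sub0r mulrN1z.
by rewrite [X in iter r _ X]tG ?abszN ?iter_lie0 ?subrr ?mulr0z //; lia.
Qed.

Lemma t_E_left r i j : idx i -> idx j -> `|i|%N <> `|j|%N ->
  [~ t `|i|, E r i j] = E r.+1 i j.
Proof. by []. Qed.

Lemma t_E_right r i j : idx i -> idx j -> `|i|%N <> `|j|%N ->
  [~ t `|j|, E r i j] = - E r.+1 i j.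
Proof. by move=> Ji Jj ij; rewrite t_E //; deltas; rewrite mulrN1z. Qed.

Lemma t_E_other a r i j : (0 < a <= n)%N -> idx i -> idx j -> `|i|%N <> `|j|%N ->
  a <> `|i|%N -> a <> `|j|%N -> [~ t a, E r i j] = 0.
Proof. by move=> Ja Ji Jj ij ai aj; rewrite t_E //; deltas; rewrite mulr0z. Qed.

Lemma E_opp r i j : idx i -> idx j -> `|i|%N <> `|j|%N ->
  E r (- j) (- i) = - ((-1) ^+ r *: E r i j).
Proof.
move=> Ji Jj ij; elim: r => [|r IH]; first by rewrite expr0 scale1r /level /= FN.
rewrite -t_E_left ?abszN //; last by auto.
by rewrite IH lieNr lieZr t_E_right // scalerN opprK exprS mulN1r scaleNr opprK.
Qed.

(** The element [t] at [|k|] commutes with [F i j] and acts on both root vectors by the same signed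
    shift, so applying it to the identity at level [r] gives level [r.+1]. [EF_trans] and
    [FE_outside] use the same device. *)
Lemma FE_trans r i j k : idx i -> idx j -> idx k -> `|i|%N <> `|j|%N ->
  `|i|%N <> `|k|%N -> `|j|%N <> `|k|%N -> [~ F i j, E r j k] = E r i k.
Proof.
move=> Ji Jj Jk ij ik jk; elim: r => [|r IH]; first exact: F_trans.
have tF : [~ t `|k|, F i j] = 0 by apply: (t_E_other 0) => //; lia.
have := congr1 (lie (t `|k|)) IH; rewrite lie_lier tF lie0l add0r.
by rewrite !t_E_right // lieNr => /eqP; rewrite eqr_opp => /eqP.
Qed.

Lemma EF_trans r i j k : idx i -> idx j -> idx k -> `|i|%N <> `|j|%N ->
  `|i|%N <> `|k|%N -> `|j|%N <> `|k|%N -> [~ E r i j, F j k] = E r i k.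
Proof.
move=> Ji Jj Jk ij ik jk; elim: r => [|r IH]; first exact: F_trans.
have tF : [~ t `|i|, F j k] = 0 by apply: (t_E_other 0) => //; lia.
have := congr1 (lie (t `|i|)) IH; rewrite lie_lier tF lie0r addr0.
by rewrite !t_E_left.
Qed.

Lemma FE_outside r i j k l : idx i -> idx j -> idx k -> idx l ->
    `|i|%N <> `|j|%N -> `|k|%N <> `|l|%N ->
    j <> k -> i <> l -> j <> - l -> i <> - k ->
    (`|k|%N <> `|i|%N /\ `|k|%N <> `|j|%N) \/
    (`|l|%N <> `|i|%N /\ `|l|%N <> `|j|%N) -> [~ F i j, E r k l] = 0.
Proof.
move=> Ji Jj Jk Jl ij kl jk il jl ik out.
  elim: r => [|r IH]; first exact: F_zero.
  case: out => [[ki kj]|[li lj]].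
    have tF : [~ t `|k|, F i j] = 0 by apply: (t_E_other 0).
    have := congr1 (lie (t `|k|)) IH.
    by rewrite lie_lier tF lie0l add0r t_E_left // lie0r.
  have tF : [~ t `|l|, F i j] = 0 by apply: (t_E_other 0).
  have := congr1 (lie (t `|l|)) IH; rewrite lie_lier tF lie0l add0r t_E_right //.
  by rewrite lieNr lie0r => /eqP; rewrite oppr_eq0 => /eqP.
Qed.

Lemma FE_zero r i j k l : idx i -> idx j -> idx k -> idx l ->
  `|i|%N <> `|j|%N -> `|k|%N <> `|l|%N ->
  j <> k -> i <> l -> j <> - l -> i <> - k -> [~ F i j, E r k l] = 0.
Proof.
move=> Ji Jj Jk Jl ij kl jk il jl ik.
(* Here no [t] acts on one factor only, so [E r i j] is split through a fresh index [p]. *)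
have FE_diag : [~ F i j, E r i j] = 0.
  have [p [Jp pi pj _ _]] := avoid4 `|i|%N `|j|%N 0 0.
  rewrite -(@FE_trans r i p j) //; try lia; rewrite lie_lier.
  have [ip pj'] : `|i|%N <> p /\ p <> `|j|%N by split; auto.
  have Fip : [~ F i j, F i p] = 0 by apply: F_zero => //; clear -ij pi pj Ji; lia.
  have Fpj : [~ F i j, E r p j] = 0.
    by apply: FE_outside => //; clear -ij pi pj Ji Jj Jp; lia.
  by rewrite Fip lie0l add0r Fpj lie0r.
(* Either an end of the second root is foreign to the first one and [FE_outside] applies, or the two
   root vectors agree up to sign and level. *)
have [out|out|kl_ij|kl_ji] := pair_cases ij kl jk il jl ik.
- by apply: FE_outside => //; left.
- by apply: FE_outside => //; right.
- by case: kl_ij => -> ->.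
- by case: kl_ji => -> ->; rewrite E_opp // lieNr lieZr FE_diag scaler0 oppr0.
Qed.

(** Plays the part of [F_{i,i}(u^r) - F_{j,j}(u^r)]. *)
Definition level_coroot (r : nat) (i j : int) : L := [~ F i j, E r j i].

Local Notation H := level_coroot.

Lemma EF_rev r i j k : idx i -> idx j -> idx k -> `|i|%N <> `|j|%N ->
  `|i|%N <> `|k|%N -> `|j|%N <> `|k|%N -> [~ F i k, E r j i] = - E r j k.
Proof.
move=> Ji Jj Jk ij ik jk; rewrite lieC; congr (- _).
by apply: EF_trans => //; auto.
Qed.

Lemma H_add r i j k : idx i -> idx j -> idx k -> `|i|%N <> `|j|%N ->
  `|i|%N <> `|k|%N -> `|j|%N <> `|k|%N -> H r i j = H r i k + H r k j.
Proof.
move=> Ji Jj Jk ij ik jk; rewrite /level_coroot -(@F_trans i k j) //; try lia.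
rewrite lie_liel EF_rev // lieNl (lieC (E r j k)) opprK addrC; congr (_ + _).
by rewrite FE_trans //; auto.
Qed.

(** In effect [[~ E r i j, F j i] = [~ F i j, E r j i]]: the level can be moved between opposite
    root vectors. The comparison goes through a third index [p], by expanding [[~ E r p i, F i p]]
    with [E r p i = [~ E r p j, F j i]]. *)
Lemma H_opp r i j : idx i -> idx j -> `|i|%N <> `|j|%N -> H r j i = - H r i j.
Proof.
move=> Ji Jj ij; have [p [Jp pi pj _ _]] := avoid4 `|i|%N `|j|%N 0 0.
have Hip : [~ E r p i, F i p] = [~ E r p j, F j p] + H r j i.
  rewrite -(@EF_trans r p j i) //; try lia.
  rewrite lie_liel (@F_trans j i p) //; try lia.
  rewrite (lieC (E r p j)) FE_trans //; try lia.
  by rewrite lieNl -lieC addrC.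
have Hr k : [~ E r p k, F k p] = - H r k p by rewrite /level_coroot lieC.
move: Hip; rewrite !Hr (@H_add r i p j) //; try lia.
move=> eqH; apply: (addrI (- H r j p)); rewrite -eqH; zmodule.
Qed.

Lemma H_sym r i j : idx i -> idx j -> `|i|%N <> `|j|%N ->
  H r (- j) (- i) = (-1) ^+ r *: H r i j.
Proof.
move=> Ji Jj ij; rewrite /level_coroot FN // E_opp //; last by auto.
by rewrite lieNl lieNr opprK lieZr.
Qed.

Definition third (i : int) : int := if `|i|%N == 1%N then 2 else 1.

(** Plays the part of [F_{i,-i}(u^r)]. The elements [t a] kill this position, so its levels are not
    iterates but brackets through an auxiliary index, whose choice is immaterial by [long_FE]. *)
Definition long (r : nat) (i : int) : L := [~ F i (third i), E r (third i) (- i)].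

Lemma thirdP i : idx (third i) /\ `|i|%N <> `|third i|%N.
Proof. by rewrite /third; case: ifP; lia. Qed.

Lemma long_step r i k l : idx i -> idx k -> idx l -> `|i|%N <> `|k|%N ->
  `|i|%N <> `|l|%N -> `|k|%N <> `|l|%N ->
  [~ F i k, E r k (- i)] = [~ F i l, E r l (- i)].
Proof.
move=> Ji Jk Jl ik il kl; rewrite -(@F_trans i l k) //; last by auto.
rewrite lie_liel (@FE_zero r i l k (- i)) ?abszN //; try lia.
by rewrite lie0l add0r FE_trans ?abszN //; auto.
Qed.

Lemma long_FE r i k : idx i -> idx k -> `|i|%N <> `|k|%N ->
  [~ F i k, E r k (- i)] = long r i.
Proof.
move=> Ji Jk ik; have [Jt it] := thirdP i.
have [p [Jp pi pk pt _]] := avoid4 `|i|%N `|k|%N `|third i|%N 0.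
by rewrite (@long_step r i k p) // 1?(@long_step r i p (third i)) //; auto.
Qed.

Lemma long_EF r i k : idx i -> idx k -> `|i|%N <> `|k|%N ->
  [~ E r i k, F k (- i)] = long r i.
Proof.
move=> Ji Jk ik; have [p [Jp pi pk _ _]] := avoid4 `|i|%N `|k|%N 0 0.
rewrite -(@FE_trans r i p k) //; try (by auto).
rewrite lie_liel (@F_zero i p k (- i)) ?abszN //; try lia.
rewrite lie0l add0r EF_trans ?abszN //; try (by auto).
by apply: long_FE; auto.
Qed.

(** Diagonal units are taken relative to the one at index 1. A coroot needs distinct absolute
    values, so [- 1] is joined to 1 through 2. *)
Definition Mdiag (r : nat) (k : int) : L :=
  if k == 1 then 0 else if k == -1 then H r (-1) 2 + H r 2 1 else H r k 1.

(* The image of the matrix unit [(k, l)] times [u ^ r], up to an irrelevant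
   multiple of the trace on the diagonal. *)
Definition level_image (r : nat) (k l : int) : L :=
  if `|k|%N != `|l|%N then E r k l else if k == l then Mdiag r k else long r k.

Local Notation M := level_image.

Lemma M_off r k l : `|k|%N <> `|l|%N -> M r k l = E r k l.
Proof. by move=> /eqP kl; rewrite /level_image kl. Qed.

Lemma M_diag r k : M r k k = Mdiag r k.
Proof. by rewrite /level_image !eqxx. Qed.

Lemma M_long r k : idx k -> M r k (- k) = long r k.
Proof. by move=> Jk; rewrite /level_image abszN eqxx /=; deltas. Qed.

Lemma M_longN r k : idx k -> M r (- k) k = long r (- k).
Proof. by move=> Jk; rewrite -{2}[k]opprK M_long ?abszN. Qed.

Lemma Mdiag_sub r k l : idx k -> idx l -> `|k|%N <> `|l|%N ->
  Mdiag r k - Mdiag r l = H r k l.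
Proof.
move=> Jk Jl kl.
(* The detour through 2 built into [Mdiag r (-1)] collides with [|m| = 2]; the index 3 serves as
   common reference there. *)
have sub1 m : idx m -> `|m|%N <> 1%N -> H r m 1 - (H r (-1) 2 + H r 2 1) = H r m (-1).
  move=> Jm m1; have [m2|m2] := eqVneq `|m|%N 2%N.
    rewrite (@H_add r m 1 3) ?(@H_add r (-1) 2 3) ?(@H_add r 2 1 3); try lia.
    rewrite (@H_add r m (-1) 3); try lia.
    rewrite (@H_opp r 3 (-1)) ?(@H_opp r 3 2); try lia.
    by zmodule.
  rewrite (@H_add r m 1 2) ?(@H_add r m (-1) 2); try lia.
  by rewrite (@H_opp r 2 (-1)); try lia; zmodule.
rewrite /Mdiag; have [k1|k1] := eqVneq k 1; have [l1|l1] := eqVneq l 1.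
- by lia.
- have [l1'|l1'] := eqVneq l (-1); first by lia.
  by rewrite k1 sub0r -H_opp //; lia.
- have [k1'|k1'] := eqVneq k (-1); first by lia.
  by rewrite l1 subr0.
have [k1'|k1'] := eqVneq k (-1); have [l1'|l1'] := eqVneq l (-1); first by lia.
- rewrite (@H_opp r l k); try lia.
  by rewrite -opprB k1' sub1 //; lia.
- by rewrite l1' sub1 //; lia.
by rewrite (@H_add r k l 1) ?(@H_opp r l 1) //; lia.
Qed.

(** The four terms of the commutator of [E_{i,j} - E_{-j,-i}] with [E_{k,l} u^r]. *)
Definition level_act (r : nat) (i j k l : int) : L :=
  M r i l *+ (j == k) - M r k j *+ (i == l)
  + M r k (- i) *+ (j == - l) - M r (- j) l *+ (k == - i).

Local Notation act := level_act.

Lemma F_opp i j : idx i -> idx j -> F i j = - F (- j) (- i).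
Proof. by move=> Ji Jj; rewrite FN // opprK. Qed.

Lemma F_M_off r i j k l : idx i -> idx j -> idx k -> idx l ->
  `|i|%N <> `|j|%N -> `|k|%N <> `|l|%N -> [~ F i j, M r k l] = act r i j k l.
Proof.
move=> Ji Jj Jk Jl ij kl; rewrite M_off // /level_act.
have [jk|/eqP jk] := eqVneq j k.
  rewrite -{k}jk in Jk kl *; have [il|/eqP il] := eqVneq i l.
    rewrite -{l}il in Jl kl *; deltas; rewrite !M_diag.
    by rewrite Mdiag_sub.
  have [il'|/eqP il'] := eqVneq l (- i).
    by rewrite il'; deltas; rewrite M_long // long_FE.
  by deltas; rewrite M_off ?FE_trans //; lia.
have [il|/eqP il] := eqVneq i l.
  rewrite -{l}il in Jl kl *; have [jk'|/eqP jk'] := eqVneq k (- j).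
    rewrite jk'; deltas; rewrite M_longN //.
    by rewrite lieC -[in F i j](opprK j) long_EF ?abszN //; auto.
  by deltas; rewrite lieC M_off ?EF_trans //; lia.
have [jl|/eqP jl] := eqVneq j (- l).
  have {jl}jl : l = - j by lia.
  rewrite {}jl in Jl kl il *; have [ki|/eqP ki] := eqVneq k (- i).
    rewrite ki; deltas; rewrite !M_diag Mdiag_sub ?abszN // F_opp // lieNl.
    by rewrite -/(H r (- j) (- i)) -H_opp ?abszN //; auto.
  have [ki'|/eqP ki'] := eqVneq k i.
    rewrite ki'; deltas; rewrite M_long // F_opp // lieNl -lieC.
    by rewrite long_EF ?abszN.
  deltas; rewrite M_off ?abszN; last by lia.
  by rewrite F_opp // lieNl -lieC EF_trans ?abszN //; lia.
have [ki|/eqP ki] := eqVneq k (- i).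
  rewrite {k jk}ki in Jk kl *; deltas; rewrite F_opp // lieNl.
  have [lj|/eqP lj] := eqVneq l j.
    by rewrite lj M_longN // -[in E r _ j](opprK j) long_FE ?abszN //; auto.
  by rewrite FE_trans ?abszN // ?M_off ?abszN //; lia.
by deltas; apply: FE_zero => //; lia.
Qed.

Lemma F_long_same r i j : idx i -> idx j -> `|i|%N <> `|j|%N ->
  [~ F i j, long r j] = E r i (- j) + E r j (- i).
Proof.
move=> Ji Jj ij; have [p [Jp pi pj _ _]] := avoid4 `|i|%N `|j|%N 0 0.
rewrite -(@long_FE r j p) //; try (by auto).
rewrite lie_lier F_trans ?FE_trans ?abszN //; try (by auto).
have := @F_M_off r i j p (- j); rewrite M_off ?abszN // => -> //; try (by auto).
rewrite /level_act; deltas; rewrite M_off ?abszN //.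
by rewrite FE_trans ?abszN //; auto.
Qed.

Lemma F_long_zero r i j : idx i -> idx j -> `|i|%N <> `|j|%N ->
  [~ F i j, long r i] = 0.
Proof.
move=> Ji Jj ij; have [p [Jp pi pj _ _]] := avoid4 `|i|%N `|j|%N 0 0.
rewrite -(@long_FE r i p) //; try (by auto).
apply: commute_lie; first by apply: F_zero => //; lia.
by apply: FE_zero => //; lia.
Qed.

Lemma F_M_long r i j k : idx i -> idx j -> idx k -> `|i|%N <> `|j|%N ->
  [~ F i j, M r k (- k)] = act r i j k (- k).
Proof.
move=> Ji Jj Jk ij; rewrite M_long // /level_act.
have [kj|/eqP kj] := eqVneq k j.
  by rewrite kj; deltas; rewrite F_long_same // !M_off ?abszN //; auto.
have [ki|/eqP ki] := eqVneq k (- i).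
  rewrite ki; deltas; rewrite F_opp // lieNl F_long_same ?abszN //; last by auto.
  by rewrite opprK !M_off ?abszN //; [rewrite opprD opprK addrC|auto].
have [ki'|/eqP ki'] := eqVneq k i; first by rewrite ki'; deltas; rewrite F_long_zero.
have [kj'|/eqP kj'] := eqVneq k (- j).
  by rewrite kj'; deltas; rewrite F_opp // lieNl F_long_zero ?abszN ?oppr0 //; auto.
deltas; have [p [Jp pi pj pk _]] := avoid4 `|i|%N `|j|%N `|k|%N 0.
rewrite -(@long_FE r k p) //; try (by auto).
have [ip ip' jp jp'] : [/\ i <> p, i <> - p%:Z, j <> p & j <> - p%:Z] by split; lia.
have ik : i <> - k by move=> e; apply: ki; rewrite e opprK.
have pk' : `|p|%N <> `|- k|%N by rewrite abszN.
by apply: commute_lie; [apply: F_zero | apply: FE_zero]; rewrite ?opprK ?abszN; auto.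
Qed.

Lemma absz_neq (i j : int) : `|i|%N <> `|j|%N ->
  [/\ i <> j, i <> - j, j <> i & j <> - i].
Proof. by move=> ij; split; lia. Qed.

Lemma idx_neqN i : idx i -> i <> - i.
Proof. by lia. Qed.

Lemma F_H_outside r i j k l : idx i -> idx j -> idx k -> idx l ->
  `|i|%N <> `|j|%N -> `|k|%N <> `|l|%N -> `|l|%N <> `|i|%N -> `|l|%N <> `|j|%N ->
  [~ F i j, H r k l] = act r i j k k.
Proof.
move=> Ji Jj Jk Jl ij kl li lj; rewrite /level_act.
have pos a b : idx a -> idx b -> `|a|%N <> `|b|%N -> `|l|%N <> `|a|%N ->
    `|l|%N <> `|b|%N -> [~ F a b, H r b l] = E r a b.
  move=> Ja Jb ab la lb; rewrite lie_lier F_trans //; try (by auto).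
  rewrite FE_trans //; try (by auto).
  have [_ _ bl _] := absz_neq lb; have [_ _ _ al'] := absz_neq la.
  have [ab' _ _ _] := absz_neq ab; have bN := idx_neqN Jb.
  by rewrite (@FE_zero r a b l b) ?lie0r ?addr0.
have neg a b : idx a -> idx b -> `|a|%N <> `|b|%N -> `|l|%N <> `|a|%N ->
    `|l|%N <> `|b|%N -> [~ F a b, H r a l] = - E r a b.
  move=> Ja Jb ab la lb.
  have [_ _ _ bl] := absz_neq lb; have [_ _ al _] := absz_neq la.
  have [_ _ ba _] := absz_neq ab; have aN := idx_neqN Ja.
  rewrite lie_lier (@F_zero a b a l) //.
  rewrite lie0l add0r (lieC (F a b)) EF_trans //; try (by auto).
  by rewrite lieNr FE_trans //; auto.
have [kj|/eqP kj] := eqVneq k j.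
  by rewrite kj; deltas; rewrite pos // M_off.
have [ki|/eqP ki] := eqVneq k i.
  by rewrite ki; deltas; rewrite neg // M_off.
have [kj'|/eqP kj'] := eqVneq k (- j).
  rewrite kj'; deltas; rewrite F_opp // lieNl neg ?abszN //; try (by auto).
  by rewrite opprK M_off ?abszN //; auto.
have [ki'|/eqP ki'] := eqVneq k (- i).
  rewrite ki'; deltas; rewrite F_opp // lieNl pos ?abszN //; try (by auto).
  by rewrite M_off ?abszN //; auto.
have [_ _ il il'] := absz_neq li; have [_ _ jl' jl] := absz_neq lj.
have ik' : i <> - k by move=> e; apply: ki'; rewrite e opprK.
have jk' : j <> - k by move=> e; apply: kj'; rewrite e opprK.
by deltas; apply: commute_lie; [apply: F_zero | apply: FE_zero]; auto.
Qed.

Lemma F_H r i j k l : idx i -> idx j -> idx k -> idx l ->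
  `|i|%N <> `|j|%N -> `|k|%N <> `|l|%N ->
  [~ F i j, H r k l] = act r i j k k - act r i j l l.
Proof.
move=> Ji Jj Jk Jl ij kl.
have [p [Jp pi pj pk pl]] := avoid4 `|i|%N `|j|%N `|k|%N `|l|%N.
rewrite (@H_add r k l p) ?(@H_opp r l p) //; try (by auto).
by rewrite lieDr lieNr !F_H_outside //; auto.
Qed.

(** The correction comes from normalising the diagonal at index 1. It does not depend on [k], so
    that in a matrix it gets multiplied by the trace. *)
Lemma F_Mdiag r i j k : idx i -> idx j -> idx k -> `|i|%N <> `|j|%N ->
  [~ F i j, M r k k] = act r i j k k - act r i j 1 1.
Proof.
move=> Ji Jj Jk ij; rewrite M_diag /Mdiag.
have [->|/eqP k1] := eqVneq k 1; first by rewrite lie0r subrr.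
have [->|/eqP kN1] := eqVneq k (-1); last by rewrite F_H //; lia.
by rewrite lieDr !F_H //; try lia; zmodule.
Qed.

Lemma F_M r i j k l : idx i -> idx j -> idx k -> idx l -> `|i|%N <> `|j|%N ->
  [~ F i j, M r k l] = act r i j k l - act r i j 1 1 *+ (k == l).
Proof.
move=> Ji Jj Jk Jl ij; have [->|/eqP kl] := eqVneq k l; first exact: F_Mdiag.
have [kl'|/eqP kl'] := eqVneq l (- k); first by rewrite kl' subr0 F_M_long.
by rewrite subr0 F_M_off //; lia.
Qed.

(** For [a <> |k|] the auxiliary index can be chosen away from [a]; the remaining [t a] follows
    because the sum of all of them is 0. *)
Lemma t_long a r k : (0 < a <= n)%N -> idx k -> [~ t a, long r k] = 0.
Proof.
have other b : (0 < b <= n)%N -> idx k -> b <> `|k|%N -> [~ t b, long r k] = 0.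
  move=> Jb Jk bk; have [p [Jp pb pk _ _]] := avoid4 b `|k|%N 0 0.
  rewrite -(@long_FE r k p) //; try (by auto).
  apply: commute_lie; first by apply: (t_E_other 0) => //; auto.
  by apply: t_E_other => //; rewrite ?abszN //; auto.
move=> Ja Jk; have [ak|/eqP ak] := eqVneq a `|k|%N; last exact: other.
by apply: t_last => // b Jb ba; apply: other => //; rewrite -ak.
Qed.

(* Writing the bracket of levels [a] and [N - a] as [H N i j + a *: theta],
   the case [a = N] forces [theta = 0]. *)
Lemma t_H_left r i j : idx i -> idx j -> `|i|%N <> `|j|%N ->
  [~ t `|i|, H r i j] = 0.
Proof.
move=> Ji Jj ij; have ji : `|j|%N <> `|i|%N by auto.
have t_EE a b : [~ t `|i|, [~ E a i j, E b j i]] =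
    [~ E a.+1 i j, E b j i] - [~ E a i j, E b.+1 j i].
  by rewrite lie_lier t_E_left // t_E_right // lieNr.
suff /(_ r)[] : forall N, (forall a, (a <= N)%N ->
    [~ E a i j, E (N - a) j i] = H N i j) /\ [~ t `|i|, H N i j] = 0 by [].
elim=> [|N [IH tN]].
  suff base a : (a <= 0)%N -> [~ E a i j, E (0 - a) j i] = H 0 i j.
    split=> //; pose theta := [~ t `|i|, H 0 i j]; rewrite -/theta.
    have := t_EE 0 0; rewrite -[X in lie _ X]/(H 0 i j) -/theta => thetaE.
    have : [~ E 1 i j, F j i] = H 1 i j.
      by rewrite lieC -/(H 1 j i) H_opp // opprK.
    by move=> EF; rewrite thetaE [X in X - _]EF subrr.
  by rewrite leqn0 => /eqP ->.
have step a : (a <= N)%N ->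
    [~ E a.+1 i j, E (N - a) j i] = [~ E a i j, E (N - a).+1 j i].
  by move=> aN; apply/eqP; rewrite -subr_eq0 -t_EE IH // tN.
have all_eq a : (a <= N.+1)%N -> [~ E a i j, E (N.+1 - a) j i] = H N.+1 i j.
  elim: a => // a IHa aN; rewrite subSS step //.
  by rewrite -subSn // IHa //; lia.
split=> //; pose theta := [~ t `|i|, H N.+1 i j].
have shift a : (a <= N.+2)%N ->
    [~ E a i j, E (N.+2 - a) j i] = H N.+2 i j + theta *+ a.
  elim: a => [|a IHa] aN; first by rewrite mulr0n addr0.
  have := t_EE a (N.+1 - a)%N; rewrite all_eq; last by lia.
  rewrite -/theta -subSn // (IHa _); last by lia.
  rewrite subSS => /eqP; rewrite eq_sym subr_eq => /eqP ->.
  by rewrite mulrS; zmodule.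
have := shift N.+2 (leqnn _); rewrite subnn => eq_theta.
apply: (mulrn_eq0_lie charK (isT : (0 < N.+2)%N)); rewrite -/theta.
apply: (addrI (H N.+2 i j)); rewrite -eq_theta addr0.
by rewrite lieC -/(H N.+2 j i) H_opp // opprK.
Qed.

Lemma t_H a r i j : (0 < a <= n)%N -> idx i -> idx j -> `|i|%N <> `|j|%N ->
  [~ t a, H r i j] = 0.
Proof.
move=> Ja Ji Jj ij; have [->|/eqP ai] := eqVneq a `|i|%N; first exact: t_H_left.
have [->|/eqP aj] := eqVneq a `|j|%N.
  by rewrite -[H r i j]opprK -H_opp // lieNr t_H_left ?oppr0 //; auto.
by apply: commute_lie; [apply: (t_E_other 0)|apply: t_E_other]; auto.
Qed.

Lemma t_M a r k l : (0 < a <= n)%N -> idx k -> idx l ->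
  [~ t a, M r k l] = M r.+1 k l *~ ((a == `|k|%N)%:Z - (a == `|l|%N)%:Z).
Proof.
move=> Ja Jk Jl; have [kl|/eqP kl] := eqVneq `|k|%N `|l|%N; last first.
  by rewrite !M_off // t_E.
rewrite kl subrr mulr0z; have [->|/eqP kl'] := eqVneq k l.
  rewrite M_diag /Mdiag; have [_|/eqP l1] := eqVneq l 1; first by rewrite lie0r.
  have [_|/eqP l1'] := eqVneq l (-1); last by rewrite t_H //; lia.
  by rewrite lieDr !t_H ?addr0 //; lia.
have -> : l = - k by lia.
by rewrite M_long // t_long.
Qed.

End Levels.

Lemma rank_gt0 n : (4 < n)%N -> (0 < n)%N.
Proof. exact: ltn_trans. Qed.

(** * The elements [F_{i,j}(c)] of the twisted matrix algebra *)

Section MatrixUnits.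
Variables (K : fieldType) (n : nat).
Implicit Types (p q r s : 'I_(2 * n)) (c e : {poly K}).
Local Notation mx := 'M[{poly K}]_(2 * n).
Local Notation conj c := (c \Po (- 'X)).

Lemma comm_brDl (A B C : mx) : comm_br (A + B) C = comm_br A C + comm_br B C.
Proof. by rewrite /comm_br mulmxDl mulmxDr; zmodule. Qed.

Lemma comm_brDr (A B C : mx) : comm_br C (A + B) = comm_br C A + comm_br C B.
Proof. by rewrite /comm_br mulmxDl mulmxDr; zmodule. Qed.

Lemma comm_brNl (A B : mx) : comm_br (- A) B = - comm_br A B.
Proof. by rewrite /comm_br mulNmx mulmxN; zmodule. Qed.

Lemma comm_brNr (A B : mx) : comm_br A (- B) = - comm_br A B.
Proof. by rewrite /comm_br mulNmx mulmxN; zmodule. Qed.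

Lemma conjK c : conj (conj c) = c.
Proof.
rewrite -comp_polyA raddfN /= comp_polyX opprK.
exact: comp_polyXr.
Qed.

(* [E_{p,q} c(u) - E_{-q,-p} c(-u)] *)
Definition Fo p q c : mx :=
  c *: delta_mx p q - conj c *: delta_mx (rev_ord q) (rev_ord p).

Lemma Fo_linear p q (k : K) c e : Fo p q (k *: c + e) = k%:P *: Fo p q c + Fo p q e.
Proof.
rewrite /Fo comp_polyD comp_polyZ -!mul_polyC !scalerDl scalerBr !scalerA.
by zmodule.
Qed.

Lemma Fo_opp p q c : Fo (rev_ord q) (rev_ord p) c = - Fo p q (conj c).
Proof. by rewrite /Fo !rev_ordK conjK; zmodule. Qed.

Lemma Fo_bracket p q r s c e : comm_br (Fo p q c) (Fo r s e) =
  Fo p s (c * e) *+ (q == r) - Fo r q (c * e) *+ (s == p)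
  - Fo p (rev_ord r) (c * conj e) *+ (q == rev_ord s)
  + Fo (rev_ord s) q (c * conj e) *+ (rev_ord p == r).
Proof.
rewrite /comm_br /Fo !(mulmxBl, mulmxBr) -!scalemxAl -!scalemxAr !scalerA.
rewrite !mul_delta_mx_cond !rev_ordK !comp_polyM !conjK.
rewrite !(can2_eq (@rev_ordK _) (@rev_ordK _)) !rev_ordK.
rewrite !mulrnBl !scalerMnr.
rewrite (eq_sym p s) (eq_sym r q) (_ : (s == rev_ord q) = (q == rev_ord s)).
  rewrite (_ : (r == rev_ord p) = (p == rev_ord r)).
    by rewrite !(mulrC e) !(mulrC (conj e)); zmodule.
  by rewrite eq_sym (can2_eq (@rev_ordK _) (@rev_ordK _)).
by rewrite eq_sym (can2_eq (@rev_ordK _) (@rev_ordK _)).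
Qed.

Lemma ttau_delta c p q : ttau (c *: delta_mx p q : mx) =
  - (conj c *: delta_mx (rev_ord q) (rev_ord p)).
Proof.
apply/matrixP=> a b; rewrite !mxE !mulr_natr raddfN raddfMn /= andbC.
by rewrite !(can2_eq (@rev_ordK _) (@rev_ordK _)).
Qed.

Lemma ttau_Fo p q c : ttau (Fo p q c) = Fo p q c.
Proof.
by rewrite /Fo ttauB !ttau_delta !rev_ordK conjK opprK addrC.
Qed.

Lemma trace_delta p q : \tr (delta_mx p q : mx) = (p == q)%:R.
Proof.
rewrite /mxtrace (bigD1 p) //= mxE eqxx big1 ?addr0 // => a /negbTE ap.
by rewrite mxE ap.
Qed.

Lemma Fo_in_twisted p q c : p != q -> Fo p q c \in @in_twisted K n.
Proof.
move=> pq; rewrite inE ttau_Fo eqxx andbT raddfB /= !mxtraceZ !trace_delta.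
rewrite (inj_eq rev_ord_inj) (eq_sym q) (negbTE pq) !mulr0 subr0; exact: eqxx.
Qed.

Lemma Fo_diag_in_twisted p q c : Fo p p c - Fo q q c \in @in_twisted K n.
Proof.
rewrite inE ttauB !ttau_Fo eqxx andbT !raddfB /= !mxtraceZ !trace_delta !eqxx.
by apply/eqP; zmodule.
Qed.

Hypothesis n_gt0 : (0 < n)%N.
Local Notation idx i := (1 <= `|i| <= n)%N.

(** The upper half is shifted by one because the value 0 is skipped. *)
Definition zi p : int := if (p < n)%N then p%:Z - n%:Z else p%:Z - n%:Z + 1.

Fact ord_default : (0 < 2 * n)%N.
Proof. by lia. Qed.

Definition oi (i : int) : 'I_(2 * n) :=
  insubd (Ordinal ord_default)
    (absz (if i < 0 then i + n%:Z else i + n%:Z - 1)).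

Lemma zi_idx p : idx (zi p).
Proof. by have := ltn_ord p; rewrite /zi; case: ifP; lia. Qed.

Lemma val_oi i : idx i ->
  val (oi i) = absz (if i < 0 then i + n%:Z else i + n%:Z - 1).
Proof. by move=> Ji; rewrite /oi val_insubd; case: ifP => //; case: ifP; lia. Qed.

Lemma oiK i : idx i -> zi (oi i) = i.
Proof. by move=> Ji; rewrite /zi val_oi //; case: ifP; case: ifP; lia. Qed.

Lemma ziK p : oi (zi p) = p.
Proof.
apply: val_inj; rewrite val_oi ?zi_idx // /zi; have := ltn_ord p.
by case: (ltnP p n) => pn lt_p; case: ifP; rewrite /=; lia.
Qed.

Lemma zi_rev p : zi (rev_ord p) = - zi p.
Proof. by have := ltn_ord p; rewrite /zi /=; case: ifP; case: ifP; lia. Qed.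

Lemma rev_oi i : idx i -> rev_ord (oi i) = oi (- i).
Proof. by move=> Ji; rewrite -[LHS]ziK zi_rev oiK. Qed.

Lemma oi_eq i j : idx i -> idx j -> (oi i == oi j) = (i == j).
Proof. by move=> Ji Jj; apply/eqP/eqP=> [|->//]; rewrite -{2}(oiK Ji) => ->; rewrite oiK. Qed.

Lemma sum_zi (V : nmodType) (i : int) (f : 'I_(2 * n) -> V) : idx i ->
  \sum_p f p *+ (i == zi p) = f (oi i).
Proof.
move=> Ji; rewrite (bigD1 (oi i)) //= oiK // eqxx mulr1n big1 ?addr0 // => p pi.
by case: eqP => // ip; move: pi; rewrite ip ziK eqxx.
Qed.

Definition Fz (i j : int) (c : {poly K}) : mx := Fo (oi i) (oi j) c.

Lemma Fz_bracket i j k l c e : idx i -> idx j -> idx k -> idx l ->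
  comm_br (Fz i j c) (Fz k l e) =
  Fz i l (c * e) *+ (j == k) - Fz k j (c * e) *+ (l == i)
  - Fz i (- k) (c * conj e) *+ (j == - l)
  + Fz (- l) j (c * conj e) *+ (- i == k).
Proof.
move=> Ji Jj Jk Jl; by rewrite /Fz Fo_bracket !rev_oi // !oi_eq ?abszN.
Qed.

Lemma Fz_opp i j c : idx i -> idx j -> Fz (- j) (- i) c = - Fz i j (conj c).
Proof. by move=> Ji Jj; rewrite /Fz -!rev_oi // Fo_opp. Qed.

Lemma Fz_linear i j (k : K) c e : Fz i j (k *: c + e) = k%:P *: Fz i j c + Fz i j e.
Proof. exact: Fo_linear. Qed.

Lemma FzN i j c : Fz i j (- c) = - Fz i j c.
Proof. by rewrite /Fz /Fo raddfN /= !scaleNr; zmodule. Qed.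

Lemma Fz0 i j : Fz i j 0 = 0.
Proof. by rewrite /Fz /Fo comp_poly0 !scale0r subrr. Qed.

Lemma FzD i j c e : Fz i j (c + e) = Fz i j c + Fz i j e.
Proof. by have := Fz_linear i j 1 c e; rewrite polyC1 !scale1r. Qed.

Lemma Fz_in_twisted i j c : idx i -> idx j -> i != j -> Fz i j c \in @in_twisted K n.
Proof. by move=> Ji Jj ij; apply: Fo_in_twisted; rewrite oi_eq. Qed.

Lemma Fz_diag_in_twisted i j c : Fz i i c - Fz j j c \in @in_twisted K n.
Proof. exact: Fo_diag_in_twisted. Qed.

Definition tw (A : mx) : twisted K n := insubd 0 A.

Lemma val_tw A : A \in @in_twisted K n -> val (tw A) = A.
Proof. by move=> tA; rewrite /tw val_insubd tA. Qed.

(** [F_{p,q}(c)] is the sum of [c E_{p,q}] and its image under [ttau], and [A] is fixed by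
    [ttau]. *)
Lemma twisted_sum (A : mx) : A \in @in_twisted K n ->
  A *+ 2 = \sum_p \sum_q Fz (zi p) (zi q) (A p q).
Proof.
rewrite inE => /andP[_ /eqP tA].
under eq_bigr => p _ do (under eq_bigr => q _ do rewrite /Fz !ziK).
rewrite /Fo; under eq_bigr => p _ do rewrite sumrB.
rewrite sumrB mulr2n; congr (_ + _).
  rewrite {1}[A]matrix_sum_delta; exact: eq_bigr.
rewrite -{1}tA [ttau A]matrix_sum_delta exchange_big -sumrN.
rewrite (reindex_inj rev_ord_inj); apply: eq_bigr => p _ /=.
rewrite -sumrN (reindex_inj rev_ord_inj); apply: eq_bigr => q _ /=.
by rewrite !mxE !rev_ordK raddfN /= scaleNr.
Qed.

End MatrixUnits.

(** * Generation of the twisted algebra by simple root vectors and odd diagonal matrices *)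

Section Generation.
Variables (K : fieldType) (n : nat).
Hypothesis charK : [pchar K] =i pred0.
Hypothesis n_gt4 : (4 < n)%N.
Local Notation n_gt0 := (rank_gt0 n_gt4).
Local Notation mx := 'M[{poly K}]_(2 * n).
Local Notation idx i := (1 <= `|i| <= n)%N.
Local Notation Fz := (@Fz K n n_gt0).

Variable P : twisted K n -> Prop.
Hypothesis P_linear : forall (c : K) u v, P u -> P v -> P (c *: u + v).
Hypothesis P_lie : forall u v, P u -> P v -> P [~ u, v].
Hypothesis P_simple : forall s (i : nat), (0 < i < n)%N ->
  P (tw (Fz (sg s * i%:Z) (sg s * i.+1%:Z) 1)).
Hypothesis P_end : forall s,
  P (tw (Fz (sg s * (n - 1)%N%:Z) (- (sg s * n%:Z)) 1)).
Hypothesis P_odd : forall i : nat, (0 < i < n)%N ->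
  P (tw (Fz i i 'X - Fz i.+1 i.+1 'X)).

(** Transported to matrices, [P] can be followed through [Fz_bracket]; the witness keeps track of
    membership in the twisted algebra. *)
Let Q (A : mx) := exists2 w : twisted K n, val w = A & P w.

Let Q_tw (A : mx) : A \in @in_twisted K n -> P (tw A) -> Q A.
Proof. by move=> tA PA; exists (tw A); rewrite ?val_tw. Qed.

Let Q_linear (c : K) A B : Q A -> Q B -> Q (c%:P *: A + B).
Proof. by move=> [u <- Pu] [v <- Pv]; exists (c *: u + v) => //; exact: P_linear. Qed.

Let Q_lie A B : Q A -> Q B -> Q (comm_br A B).
Proof. by move=> [u <- Pu] [v <- Pv]; exists [~ u, v] => //; exact: P_lie. Qed.

Let Q0 : Q 0.
Proof.
have [w _ Pw] : Q (Fz (sg true * 1) (sg true * 2) 1).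
  apply: Q_tw; last by apply: (P_simple true (i := 1)); lia.
  by apply: Fz_in_twisted; rewrite /sg; lia.
by exists 0 => //; rewrite -(addNr w) -scaleN1r; exact: P_linear.
Qed.

Let QD A B : Q A -> Q B -> Q (A + B).
Proof. by move=> QA QB; rewrite -[A]scale1r -polyC1; exact: Q_linear. Qed.

Let QZ (c : K) A : Q A -> Q (c%:P *: A).
Proof. by move=> QA; rewrite -[_ *: _]addr0; exact: Q_linear. Qed.

Let QN A : Q A -> Q (- A).
Proof. by move=> QA; rewrite -scaleN1r -polyC1 -polyCN; exact: QZ. Qed.

Let Q_half A : Q (A *+ 2) -> Q A.
Proof.
move=> /(QZ 2^-1); rewrite -scaler_nat scalerA -polyC_natr -polyCM mulVf ?scale1r //.
exact: two_neq0.
Qed.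

Lemma gen_level0 i j : idx i -> idx j -> `|i|%N <> `|j|%N -> Q (Fz i j 1).
Proof.
move=> Ji Jj ij; pose S k := (1 <= k <= n)%N && (k != 0%N).
have SJ k : S k -> (1 <= k <= n)%N by case/andP.
have JS k : (1 <= k <= n)%N -> S k by rewrite /S; lia.
have absS s (k : nat) : absz (sg s * k%:Z) = k by case: s; rewrite /sg; lia.
have trans i' j' k' : idx i' -> idx j' -> idx k' -> `|i'|%N <> `|j'|%N ->
    `|i'|%N <> `|k'|%N -> `|j'|%N <> `|k'|%N -> Q (Fz i' j' 1) -> Q (Fz j' k' 1) ->
    Q (Fz i' k' 1).
  move=> Ji' Jj' Jk' ij' ik' jk' Qij Qjk.
  by have := Q_lie Qij Qjk; rewrite Fz_bracket //; deltas; rewrite mulr1.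
apply: (@connect_all S (fun i j => Q (Fz i j 1))); try by apply: JS.
- move=> i' j' /SJ Ji' /SJ Jj'; rewrite Fz_opp // (_ : 1 \Po _ = 1); first exact: QN.
  by rewrite -polyC1 comp_polyC.
- by move=> i' j' k' /SJ ? /SJ ? /SJ ?; exact: trans.
- move=> s i' j'; apply: (@chain_up n 1 0 (fun i j => Q (Fz (sg s * i%:Z) (sg s * j%:Z) 1))).
  + move=> a b c /SJ Ja /SJ Jb /SJ Jc lt; apply: trans; rewrite ?absS //; lia.
  + move=> a /SJ Ja /SJ Jb; apply: Q_tw; last by apply: P_simple; lia.
    by apply: Fz_in_twisted; rewrite ?absS //; case: (s); rewrite /sg; lia.
  + by [].
- move=> i' j' _ _ _; exists (n - 1)%N, n; split=> [||| s]; try by rewrite /S; lia.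
  apply: Q_tw; last exact: P_end.
  by apply: Fz_in_twisted; rewrite ?abszN ?absS; try lia; case: (s); rewrite /sg; lia.
- exact: ij.
Qed.

Lemma gen_odd_diag i j : idx i -> idx j -> `|i|%N <> `|j|%N ->
  Q (Fz i i 'X - Fz j j 'X).
Proof.
have up (a b : nat) : (0 < a < b)%N -> (b <= n)%N -> Q (Fz a a 'X - Fz b b 'X).
  elim: b => [|b IH] ab bn; first by lia.
  have Qb : Q (Fz b b 'X - Fz b.+1 b.+1 'X).
    by apply: Q_tw; [exact: Fz_diag_in_twisted|apply: P_odd; lia].
  have [->//|ab'] := eqVneq a b.
  by have := QD (IH _ _) Qb; rewrite addrA subrK; apply; lia.
have abs_eq k : idx k -> Fz k k 'X = Fz `|k|%N `|k|%N 'X.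
  move=> Jk; case: k Jk => k Jk //=.
  by rewrite NegzE Fz_opp // comp_polyX FzN opprK.
move=> Ji Jj ij; rewrite (abs_eq i Ji) (abs_eq j Jj); have [lt|le] := ltnP `|i|%N `|j|%N.
  by apply: up; lia.
by rewrite -opprB; apply: QN; apply: up; lia.
Qed.

(** Bracketing with [F_{i,i}(u) - F_{j,j}(u)] multiplies [c] by [2 u], and the factor 2 is
    invertible, so every polynomial is reached by Horner's scheme. *)
Lemma gen_off i j c : idx i -> idx j -> `|i|%N <> `|j|%N -> Q (Fz i j c).
Proof.
move=> Ji Jj ij; elim/poly_ind: c => [|c a IH].
  by have := QZ 0 (gen_level0 Ji Jj ij); rewrite polyC0 scale0r Fz0.
have QX : Q (Fz i j (c * 'X)).
  apply: Q_half; have := Q_lie (gen_odd_diag Ji Jj ij) IH.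
  rewrite comm_brDl comm_brNl !Fz_bracket //; deltas.
  by rewrite opprK mulr2n mulrC.
have := Q_linear a (gen_level0 Ji Jj ij) QX.
by rewrite -Fz_linear addrC alg_polyC.
Qed.

Lemma gen_long i c : idx i -> Q (Fz i (- i) c).
Proof.
move=> Ji; pose k : int := if `|i|%N == 1%N then 2 else 1.
have Jk : idx k by rewrite /k; case: ifP; lia.
have ik : `|i|%N <> `|k|%N by rewrite /k; case: ifP; lia.
have ki : `|k|%N <> `|- i|%N by rewrite abszN; auto.
have JNi : idx (- i) by lia.
have := Q_lie (gen_level0 Ji Jk ik) (gen_off c Jk JNi ki).
by rewrite Fz_bracket //; deltas; rewrite mul1r.
Qed.

Lemma gen_diag i c : idx i -> Q (Fz i i c - Fz 1 1 c).
Proof.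
have off a b : idx a -> idx b -> `|a|%N <> `|b|%N -> Q (Fz a a c - Fz b b c).
  move=> Ja Jb ab; have ba : `|b|%N <> `|a|%N by auto.
  have := Q_lie (gen_off c Ja Jb ab) (gen_level0 Jb Ja ba).
  by rewrite Fz_bracket //; deltas; rewrite mulr1.
move=> Ji; have [i1|i1] := eqVneq `|i|%N 1%N; last by apply: off; lia.
have -> : Fz i i c - Fz 1 1 c = (Fz i i c - Fz 2 2 c) + (Fz 2 2 c - Fz 1 1 c).
  by rewrite addrA subrK.
by apply: QD; apply: off; lia.
Qed.

Theorem twisted_generated w : P w.
Proof.
suff [u uw Pu] : Q (val w) by rewrite -(val_inj uw).
have tw_w := valP w; have /andP[/eqP tr_w _] := tw_w.
have Fz_sum i j (f : 'I_(2 * n) -> {poly K}) :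
    Fz i j (\sum_p f p) = \sum_p Fz i j (f p).
  by apply: (big_morph (Fz i j)) => [c e|]; [exact: FzD|exact: Fz0].
apply: Q_half; rewrite (twisted_sum n_gt0) //.
(* Since the trace is 0, each diagonal term may be diminished by its analogue at index 1, which
   leaves the differences of [gen_diag]. *)
have tr0 : \sum_p Fz 1 1 (val w p p) = 0.
  by rewrite -Fz_sum; have -> : \sum_p val w p p = 0 by []; rewrite Fz0.
rewrite -[X in Q X]subr0 -[X in Q (_ - X)]tr0 -sumrB.
under eq_bigr => p _ do rewrite (bigD1 p) //= addrAC.
apply: (big_ind Q Q0 QD) => p _; apply: QD; first exact/gen_diag/(zi_idx n_gt0).
apply: (big_ind Q Q0 QD) => q qp.
have [zpq|/eqP zpq] := eqVneq `|zi p|%N `|zi q|%N; last by apply: gen_off; rewrite ?(zi_idx n_gt0).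
have zqp : zi q <> zi p by move=> /(congr1 (oi n_gt0)); rewrite !ziK; apply/eqP.
have -> : zi q = - zi p by lia.
exact/gen_long/(zi_idx n_gt0).
Qed.

End Generation.

(** * The linear map from matrices over K[u] to the Lie algebra *)

Section Rho.
Variables (K : fieldType) (L : lieAlgType K).
Hypothesis charK : [pchar K] =i pred0.
Variable n : nat.
Hypothesis n_gt4 : (4 < n)%N.
Variables (G : int -> int -> L) (t : nat -> L).
Local Notation idx i := (1 <= `|i| <= n)%N.
Hypothesis soG : so_family n 1 G.
Hypothesis tt : forall a b, (0 < a)%N -> (0 < b)%N -> [~ t a, t b] = 0.
Hypothesis t_sum : \sum_(1 <= b < n.+1) t b = 0.
Hypothesis tG : forall a i j, (0 < a <= n)%N -> idx i -> idx j ->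
  `|i|%N <> `|j|%N -> `|i|%N <> a -> `|j|%N <> a -> [~ t a, G i j] = 0.

Local Notation n_gt0 := (rank_gt0 n_gt4).
Local Notation mx := 'M[{poly K}]_(2 * n).
Local Notation Fz := (@Fz K n n_gt0).
Local Notation oi := (oi n_gt0).
Local Notation M := (level_image G t).
Local Notation E := (level G t).
Local Notation F := (unit_so G).
Local Notation conj c := (c \Po (- 'X)).

Definition rho_entry (k l : int) (c : {poly K}) : L := \sum_(r < size c) c`_r *: M r k l.

Lemma rho_entry_wide N k l (c : {poly K}) : (size c <= N)%N ->
  rho_entry k l c = \sum_(r < N) c`_r *: M r k l.
Proof.
move=> cN; rewrite /rho_entry (big_ord_widen N (fun r => c`_r *: M r k l)) //.
rewrite big_mkcond; apply: eq_bigr => r _; case: ltnP => // cr.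
by rewrite nth_default // scale0r.
Qed.

Lemma rho_entry_linear k l (a : K) c e : rho_entry k l (a *: c + e) =
  a *: rho_entry k l c + rho_entry k l e.
Proof.
pose N := maxn (size (a *: c + e)) (maxn (size c) (size e)).
rewrite !(@rho_entry_wide N) ?leq_max ?leqnn ?orbT //.
rewrite scaler_sumr -big_split; apply: eq_bigr => r _ /=.
by rewrite coefD coefZ scalerDl scalerA.
Qed.

HB.instance Definition _ k l :=
  GRing.isLinear.Build K {poly K} L _ (rho_entry k l) (rho_entry_linear k l).

Lemma rho_entry_Xn k l r : rho_entry k l 'X^r = M r k l.
Proof.
rewrite (@rho_entry_wide r.+1) ?size_polyXn // big_ord_recr /= coefXn eqxx scale1r.
rewrite big1 ?add0r // => s _; rewrite coefXn.
by rewrite (_ : (s == r :> nat) = false) ?scale0r //; apply/negbTE; rewrite neq_ltn ltn_ord.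
Qed.

Lemma rho_entry_mulX k l c : rho_entry k l ('X * c) = \sum_(r < size c) c`_r *: M r.+1 k l.
Proof.
rewrite (@rho_entry_wide (size c).+1); last first.
  by rewrite mulrC; have [->|c0] := eqVneq c 0; rewrite ?mul0r ?size_poly0 // size_mulX.
rewrite big_ord_recl mulrC coefMX /= scale0r add0r.
by apply: eq_bigr => r _; rewrite coefMX.
Qed.

Definition rho_entryact (i j k l : int) (c : {poly K}) : L :=
  rho_entry i l c *+ (j == k) - rho_entry k j c *+ (i == l)
  + rho_entry k (- i) c *+ (j == - l) - rho_entry (- j) l c *+ (k == - i).

Lemma F_rho_entry i j k l c : idx i -> idx j -> idx k -> idx l -> `|i|%N <> `|j|%N ->
  [~ F i j, rho_entry k l c] = rho_entryact i j k l c - rho_entryact i j 1 1 c *+ (k == l).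
Proof.
move=> Ji Jj Jk Jl ij.
have actE k' l' : rho_entryact i j k' l' c = \sum_(r < size c) c`_r *: level_act G t r i j k' l'.
  rewrite /rho_entryact /rho_entry -!sumrMnl -!sumrB -big_split /= -sumrB.
  by apply: eq_bigr => r _; rewrite /level_act !(scalerBr, scalerDr, scalerMnr).
rewrite !actE -sumrMnl -sumrB lie_sumr; apply: eq_bigr => r _.
by rewrite lieZr (F_M n_gt4 soG tt t_sum tG) // scalerBr scalerMnr.
Qed.

Lemma t_rho_entry a k l c : (0 < a <= n)%N -> idx k -> idx l ->
  [~ t a, rho_entry k l c] = rho_entry k l ('X * c) *~ ((a == `|k|%N)%:Z - (a == `|l|%N)%:Z).
Proof.
move=> Ja Jk Jl; rewrite rho_entry_mulX lie_sumr mulrz_suml; apply: eq_bigr => r _.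
by rewrite lieZr (t_M charK n_gt4 soG tt t_sum tG) // -!scaler_int !scalerA mulrC.
Qed.

(** The factor 1/2 is there because [F_{i,j}(u^r)] has two matrix entries, which contribute
    equally. *)
Definition rho (A : mx) : L := 2^-1 *: \sum_p \sum_q rho_entry (zi p) (zi q) (A p q).

Lemma rho_linear (c : K) A B : rho (c%:P *: A + B) = c *: rho A + rho B.
Proof.
rewrite /rho scalerA mulrC -scalerA -scalerDr; congr (_ *: _).
rewrite scaler_sumr -big_split; apply: eq_bigr => p _ /=.
rewrite scaler_sumr -big_split; apply: eq_bigr => q _ /=.
by rewrite !mxE mul_polyC linearP.
Qed.

Lemma rhoD A B : rho (A + B) = rho A + rho B.
Proof. by have := rho_linear 1 A B; rewrite polyC1 !scale1r. Qed.

Lemma rhoN A : rho (- A) = - rho A.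
Proof.
have := rho_linear (-1) A 0; rewrite addr0 polyCN polyC1 !scaleN1r => ->.
have := rho_linear 1 0 0; rewrite polyC1 !scale1r addr0 => /eqP.
by rewrite -subr_eq0 opprD addrA subrr sub0r oppr_eq0 => /eqP ->; rewrite addr0.
Qed.

Lemma rho_delta_mul i j A : idx i -> idx j ->
  rho (delta_mx (oi i) (oi j) *m A) = 2^-1 *: \sum_q rho_entry i (zi q) (A (oi j) q).
Proof.
move=> Ji Jj; congr (_ *: _).
rewrite (bigD1 (oi i)) //= [X in _ + X]big1 ?addr0 => [|p /negbTE pi].
  apply: eq_bigr => q _; rewrite oiK // mxE (bigD1 (oi j)) //= mxE !eqxx mul1r.
  by rewrite big1 ?addr0 // => s /negbTE sj; rewrite mxE sj andbF mul0r.
rewrite big1 // => q _; rewrite mxE big1 ?linear0 // => s _.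
by rewrite mxE pi mul0r.
Qed.

Lemma rho_mul_delta i j A : idx i -> idx j ->
  rho (A *m delta_mx (oi i) (oi j)) = 2^-1 *: \sum_p rho_entry (zi p) j (A p (oi i)).
Proof.
move=> Ji Jj; congr (_ *: _); apply: eq_bigr => p _.
rewrite (bigD1 (oi j)) //= [X in _ + X]big1 ?addr0 => [|q /negbTE qj].
  rewrite oiK // mxE (bigD1 (oi i)) //= mxE !eqxx mulr1.
  by rewrite big1 ?addr0 // => s /negbTE si; rewrite mxE si mulr0.
rewrite mxE big1 ?linear0 // => s _.
by rewrite mxE qj andbF mulr0.
Qed.

Lemma rho_F i j A : idx i -> idx j -> `|i|%N <> `|j|%N -> \tr A = 0 ->
  [~ F i j, rho A] = rho (comm_br (Fz i j 1) A).
Proof.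
move=> Ji Jj ij trA; have [JNi JNj] : idx (- i) /\ idx (- j) by lia.
have -> : Fz i j 1 = delta_mx (oi i) (oi j) - delta_mx (oi (- j)) (oi (- i)).
  by rewrite /Fz /Fo -polyC1 comp_polyC polyC1 !scale1r !rev_oi.
pose S1 := \sum_q rho_entry i (zi q) (A (oi j) q).
pose S2 := \sum_p rho_entry (zi p) j (A p (oi i)).
pose S3 := \sum_p rho_entry (zi p) (- i) (A p (oi (- j))).
pose S4 := \sum_q rho_entry (- j) (zi q) (A (oi (- i)) q).
transitivity (2^-1 *: (S1 - S2 + S3 - S4)); last first.
  rewrite comm_brDl comm_brNl /comm_br !(rhoN, rhoD).
  rewrite !rho_delta_mul ?rho_mul_delta // -/S1 -/S2 -/S3 -/S4.
  by rewrite !(scalerBr, scalerDr); zmodule.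
rewrite lieZr; congr (_ *: _).
transitivity (\sum_p \sum_q (rho_entryact i j (zi p) (zi q) (A p q)
    - rho_entryact i j 1 1 (A p q) *+ (zi p == zi q))).
  rewrite lie_sumr; apply: eq_bigr => p _.
  by rewrite lie_sumr; apply: eq_bigr => q _; rewrite F_rho_entry ?(zi_idx n_gt0).
(* The error terms are linear in the diagonal entries with the same coefficients for all [p], so
   their sum is the error at [\tr A = 0]. *)
have err0 : \sum_p \sum_q rho_entryact i j 1 1 (A p q) *+ (zi p == zi q) = 0.
  transitivity (\sum_p rho_entryact i j 1 1 (A p p)).
    apply: eq_bigr => p _; rewrite (bigD1 p) //= eqxx mulr1n big1 ?addr0 // => q qp.
    case: eqP => // /(congr1 oi); rewrite !ziK => pq.
    by move: qp; rewrite pq eqxx.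
  have trA' : \sum_p A p p = 0 by [].
  rewrite /rho_entryact !big_split /= !sumrN !sumrMnl -!linear_sum /= trA' !linear0.
  by rewrite !mul0rn; zmodule.
have negC (a b : int) : (a == - b) = (- a == b) by lia.
have negC' (a b : int) : (a == - b) = (- b == a) by lia.
transitivity (\sum_p \sum_q rho_entryact i j (zi p) (zi q) (A p q)).
  rewrite -[RHS]subr0 -[X in _ = _ - X]err0 -sumrB.
  by apply: eq_bigr => p _; rewrite sumrB.
have e1 : \sum_p \sum_q rho_entry i (zi q) (A p q) *+ (j == zi p) = S1.
  transitivity (\sum_p (\sum_q rho_entry i (zi q) (A p q)) *+ (j == zi p)).
    by apply: eq_bigr => p _; rewrite sumrMnl.
  by rewrite (sum_zi n_gt0).
have e2 : \sum_p \sum_q rho_entry (zi p) j (A p q) *+ (i == zi q) = S2.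
  by apply: eq_bigr => p _; rewrite (sum_zi n_gt0).
have e3 : \sum_p \sum_q rho_entry (zi p) (- i) (A p q) *+ (j == - zi q) = S3.
  apply: eq_bigr => p _.
  transitivity (\sum_q rho_entry (zi p) (- i) (A p q) *+ (- j == zi q));
    last by rewrite (sum_zi n_gt0).
  by apply: eq_bigr => q _; rewrite negC.
have e4 : \sum_p \sum_q rho_entry (- j) (zi q) (A p q) *+ (zi p == - i) = S4.
  transitivity (\sum_p (\sum_q rho_entry (- j) (zi q) (A p q)) *+ (- i == zi p)).
    by apply: eq_bigr => p _; rewrite -sumrMnl; apply: eq_bigr => q _; rewrite negC'.
  by rewrite (sum_zi n_gt0).
rewrite -e1 -e2 -e3 -e4 -!sumrB -big_split -sumrB; apply: eq_bigr => p _ /=.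
by rewrite -!sumrB -big_split -sumrB.
Qed.

(** This is [F_{a,a}(u)]; its two entries have equal signs because [u] is odd. Being of nonzero
    trace it lies outside the twisted algebra, unlike the differences in [Dz_sub], yet [rho_t] holds
    for each [a] separately. *)
Definition Dz (a : nat) : mx := diag_mx (\row_p ('X *+ (a == `|zi p|%N))).

Lemma rho_t a A : (0 < a <= n)%N -> [~ t a, rho A] = rho (comm_br (Dz a) A).
Proof.
move=> Ja; rewrite lieZr; congr (_ *: _); rewrite lie_sumr; apply: eq_bigr => p _.
rewrite lie_sumr; apply: eq_bigr => q _; rewrite t_rho_entry ?(zi_idx n_gt0) //.
rewrite /comm_br mul_diag_mx mul_mx_diag !mxE.
rewrite mulrnAl mulrnAr [A p q * 'X]mulrC linearB /= !linearMn /= mulrzBr.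
by rewrite -!pmulrn mulNrn.
Qed.

Lemma rho_Fz i j c : idx i -> idx j ->
  rho (Fz i j c) = 2^-1 *: (rho_entry i j c - rho_entry (- j) (- i) (conj c)).
Proof.
move=> Ji Jj; have [JNi JNj] : idx (- i) /\ idx (- j) by lia.
have one k l e : idx k -> idx l -> rho (e *: delta_mx (oi k) (oi l)) = 2^-1 *: rho_entry k l e.
  move=> Jk Jl; congr (_ *: _); rewrite (bigD1 (oi k)) //= [X in _ + X]big1 ?addr0.
    rewrite (bigD1 (oi l)) //= [X in _ + X]big1 ?addr0.
      by rewrite !oiK // !mxE !eqxx mulr1.
    by move=> q /negbTE ql; rewrite !mxE ql andbF mulr0 linear0.
  move=> p /negbTE pk; rewrite big1 // => q _.
  by rewrite !mxE pk mulr0 linear0.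
by rewrite /Fz /Fo rhoD rhoN !rev_oi // !one // scalerBr.
Qed.

Lemma rho_off i j r : idx i -> idx j -> `|i|%N <> `|j|%N ->
  rho (Fz i j 'X^r) = E r i j.
Proof.
move=> Ji Jj ij; rewrite rho_Fz // comp_Xn_poly exprNn -polyC1 -polyCN -polyC_exp.
rewrite mul_polyC linearZ /= !rho_entry_Xn !M_off ?abszN //; last by auto.
rewrite (E_opp n_gt4 soG tt t_sum tG) // scalerN opprK scalerA.
rewrite -exprMn mulrNN mulr1 expr1n scale1r -mulr2n -scaler_nat scalerA.
by rewrite mulVf ?scale1r // two_neq0.
Qed.

(** The entries at [i, j] and those at [- i, - j] contribute the same coroot: the signs of [H_opp]
    and of [H_sym] at level 1 compensate. *)
Lemma rho_odd_diag i j : idx i -> idx j -> `|i|%N <> `|j|%N ->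
  rho (Fz i i 'X - Fz j j 'X) = level_coroot G t 1 i j.
Proof.
move=> Ji Jj ij; rewrite rhoD rhoN !rho_Fz // -scalerBr.
have rho_entryX k l : rho_entry k l 'X = M 1 k l by rewrite -(rho_entry_Xn k l 1) expr1.
rewrite comp_polyX !linearN /= !opprK !rho_entryX !M_diag.
have -> (a b c d : L) : (a + b) - (c + d) = (a - c) + (b - d) by zmodule.
rewrite !(Mdiag_sub n_gt4 soG tt t_sum tG) ?abszN //.
rewrite (H_opp n_gt4 soG tt t_sum tG _ (i := - j)) ?abszN //; try (by auto).
rewrite (H_sym n_gt4 soG tt t_sum tG) // expr1 scaleN1r opprK.
rewrite -mulr2n -scaler_nat scalerA.
by rewrite mulVf ?scale1r // two_neq0.
Qed.

Lemma Dz_sub a b : (0 < a <= n)%N -> (0 < b <= n)%N ->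
  Fz a a 'X - Fz b b 'X = Dz a - Dz b.
Proof.
have D (k : nat) : (0 < k <= n)%N -> Fz k k 'X = Dz k.
  move=> Jk; rewrite /Fz /Fo comp_polyX scaleNr opprK rev_oi //.
  apply/matrixP=> p q; rewrite !mxE.
  have eq_oi (i : int) : idx i -> (p == oi i) = (zi p == i).
    by move=> Ji; rewrite -(oi_eq n_gt0 (zi_idx n_gt0 p) Ji) ziK.
  have [<-|pq] := eqVneq p q; last first.
    have neq (s : 'I_(2 * n)) : (p == s) && (q == s) = false.
      by apply/negbTE; apply: contraNN pq => /andP[/eqP -> /eqP ->].
    by rewrite !neq mulr0n !mulr0 addr0.
  have JNk : idx (- k%:Z) by lia.
  have Jk' : idx k%:Z by lia.
  rewrite !andbb !eq_oi // !mulr_natr -mulrnDr mulr1n; congr (_ *+ _).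
  by have := zi_idx n_gt0 p; lia.
by move=> Ja Jb; rewrite !D.
Qed.


End Rho.

(** * Matrices attached to the generators *)

Section Generators.
Variables (K : fieldType) (n : nat).
Hypothesis n_gt4 : (4 < n)%N.
Local Notation Fz := (@Fz K n (rank_gt0 n_gt4)).

(* The simple root of node [i] is that of the matrix unit at [(na i, nb i)]. *)
Definition na (i : nat) : int := if i == n then (n - 1)%N%:Z else i%:Z.
Definition nb (i : nat) : int := if i == n then - n%:Z else i.+1%:Z.

Definition Xm (s : bool) (i r : nat) : 'M[{poly K}]_(2 * n) :=
  if s then Fz (na i) (nb i) 'X^r else Fz (nb i) (na i) 'X^r.
Definition Hm (i r : nat) : 'M[{poly K}]_(2 * n) :=
  Fz (na i) (na i) 'X^r - Fz (nb i) (nb i) 'X^r.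

Lemma node_idx i : (0 < i <= n)%N ->
  [/\ (1 <= `|na i| <= n)%N, (1 <= `|nb i| <= n)%N & `|na i|%N <> `|nb i|%N].
Proof. by rewrite /na /nb => Ji; case: ifP; split; lia. Qed.

Lemma Xm_in_twisted s i r : (0 < i <= n)%N -> Xm s i r \in @in_twisted K n.
Proof.
by move=> /node_idx[Ja Jb ab]; case: s; apply: Fz_in_twisted => //; lia.
Qed.

Lemma Hm_in_twisted i r : Hm i r \in @in_twisted K n.
Proof. exact: Fz_diag_in_twisted. Qed.

Lemma Hm_bracket i r : (0 < i <= n)%N ->
  Hm i r = comm_br (Xm true i r) (Xm false i 0).
Proof.
move=> /node_idx[Ja Jb ab].
by rewrite /Xm Fz_bracket //; deltas; rewrite mulr1.
Qed.

Lemma tw_lie A B : A \in @in_twisted K n -> B \in @in_twisted K n ->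
  lie (tw A) (tw B) = tw (comm_br A B).
Proof.
move=> tA tB; apply: val_inj; rewrite val_tw /= ?val_tw //.
by rewrite -[A]val_tw // -[B]val_tw //; exact: (valP (lie (tw A) (tw B))).
Qed.

Lemma tw_Hm i r : (0 < i <= n)%N ->
  tw (Hm i r) = lie (tw (Xm true i r)) (tw (Xm false i 0)).
Proof.
by move=> Ji; rewrite (tw_lie (Xm_in_twisted _ _ Ji) (Xm_in_twisted _ _ Ji)) -Hm_bracket.
Qed.

End Generators.

(** * The Lie algebra morphism defined by [rho] *)

Section RhoMorphism.
Variables (K : fieldType) (L : lieAlgType K).
Hypothesis charK : [pchar K] =i pred0.
Variable n : nat.
Hypothesis n_gt4 : (4 < n)%N.
Variables (h0 h1 : nat -> L) (x : bool -> nat -> nat -> L).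
Hypothesis rels : drinfeld_relations n h0 h1 x.
Local Notation Fz := (@Fz K n (rank_gt0 n_gt4)).
Local Notation idx i := (1 <= `|i| <= n)%N.
Local Notation t := (odd_diag n h1).
Local Notation Xm := (@Xm K n n_gt4).
Local Notation Hm := (@Hm K n n_gt4).

Theorem twisted_to_drinfeld : exists f : twisted K n -> L,
  [/\ forall (c : K) u v, f (c *: u + v) = c *: f u + f v,
      forall u v, f [~ u, v] = [~ f u, f v],
      forall s i r, (0 < i <= n)%N -> (r <= 1)%N -> f (tw (Xm s i r)) = x s i r,
      forall i, (0 < i <= n)%N -> f (tw (Hm i 0)) = h0 i &
      forall i, (0 < i < n)%N -> f (tw (Hm i 1)) = h1 i].
Proof.
have [G [soG labG]] := so_exists charK n_gt4 rels.
have [Gd Gy Gn] := labG; have [GN _] := soG.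
have tt : forall a b, (0 < a)%N -> (0 < b)%N -> [~ t a, t b] = 0.
  by move=> a b; apply: (t_comm n_gt4 rels).
have t_sum := t_sum charK n_gt4 h1.
have tG : forall a i j, (0 < a <= n)%N -> idx i -> idx j ->
    `|i|%N <> `|j|%N -> `|i|%N <> a -> `|j|%N <> a -> [~ t a, G i j] = 0.
  by move=> a i j; apply: (t_commute charK n_gt4 rels soG labG).
pose f (w : twisted K n) : L := rho G t (val w).
have f_linear (c : K) u v : f (c *: u + v) = c *: f u + f v by exact: rho_linear.
have f_tw A : A \in @in_twisted K n -> f (tw A) = rho G t A by move=> tA; rewrite /f val_tw.
have trW (W : twisted K n) : \tr (val W) = 0 by case/andP: (valP W) => /eqP.
have absS s (k : nat) : absz (sg s * k%:Z) = k by case: s; rewrite /sg; lia.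
have f_off i j r : idx i -> idx j -> `|i|%N <> `|j|%N -> f (tw (Fz i j 'X^r)) = level G t r i j.
  move=> Ji Jj ij; rewrite f_tw; last by apply: Fz_in_twisted => //; lia.
  exact: rho_off.
have F_simple s i : (0 < i < n)%N -> unit_so G (sg s * i%:Z) (sg s * i.+1%:Z) = y0 x s i.
  by move=> Ji; rewrite /unit_so Gy //; lia.
have F_fork s : unit_so G (sg s * (n - 1)%N%:Z) (- (sg s * n%:Z)) = y0 x s n.
  by rewrite /unit_so opprK Gn //; lia.
have F_node i : (0 < i <= n)%N ->
    unit_so G (na n i) (nb n i) = x true i 0 /\ unit_so G (nb n i) (na n i) = x false i 0.
  move=> Ji; have [Ja Jb ab] := node_idx n_gt4 Ji.
  have -> : unit_so G (nb n i) (na n i) = - unit_so G (- na n i) (- nb n i).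
    by rewrite -(FN soG) ?abszN // !opprK.
  rewrite /na /nb; have [->|ni] := eqVneq i n.
    have := F_fork true; have := F_fork false; rewrite /sg !mulN1r !mul1r.
    by move=> -> ->; rewrite /y0 opprK.
  have Ji' : (0 < i < n)%N by lia.
  have := F_simple true _ Ji'; have := F_simple false _ Ji'; rewrite /sg !mulN1r !mul1r.
  by move=> -> ->; rewrite /y0 opprK.
have f_X s i r : (0 < i <= n)%N -> (r <= 1)%N -> f (tw (Xm s i r)) = x s i r.
  move=> Ji r1; have [Ja Jb ab] := node_idx n_gt4 Ji; have [FT FF] := F_node i Ji.
  have ta : wt1 n i `|na n i| = 1 by rewrite /wt1 /na; case: (i =P n); lia.
  have tb : wt1 n i `|nb n i| = -1 by rewrite /wt1 /nb; case: (i =P n); lia.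
  have Jan : (0 < `|na n i| <= n)%N by [].
  have tT := ty charK n_gt4 rels true Ja Ji; rewrite ta mulr1z in tT.
  have tF := ty charK n_gt4 rels false Jb Ji; rewrite tb mulrN1z in tF.
  case: s; rewrite /Xm f_off //; try (by auto); case: r r1 => [|[|//]] _.
  - exact: FT.
  - by rewrite /level /= FT; exact: tT.
  - exact: FF.
  - rewrite /level /= FF; apply: oppr_inj; rewrite -lieNr; exact: tF.
have f_lie u v : f [~ u, v] = [~ f u, f v].
  have fD w w' : f (w + w') = f w + f w'.
    by have := f_linear 1 w w'; rewrite !scale1r.
  have fN w : f (- w) = - f w by rewrite -scaleN1r -[_ *: _]addr0 f_linear
    scaleN1r [X in _ + X](_ : _ = 0) ?addr0 //; apply: (addrI (f 0)); rewrite -fD !addr0.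
  suff /(_ u v) : forall w w', f [~ w, w'] = [~ f w, f w'] by [].
  apply: (twisted_generated charK (n_gt4 := n_gt4)).
  - move=> c w w' fw fw' v'; rewrite lieDl lieZl !f_linear fw fw'.
    by rewrite [RHS]lieDl [in RHS]lieZl.
  - move=> w w' fw fw' v'.
    rewrite lie_liel (lieC _ w') fD fN fw' !fw fw'.
    by rewrite [RHS]lie_liel (lieC _ (f w')).
  - move=> s i Ji v'; have [Ja Jb] : idx (sg s * i%:Z)%R /\ idx (sg s * i.+1%:Z)%R.
      by rewrite !absS; lia.
    have ab : absz (sg s * i%:Z) <> absz (sg s * i.+1%:Z) by rewrite !absS; lia.
    have tF : Fz (sg s * i%:Z) (sg s * i.+1%:Z) 1 \in @in_twisted K n.
      by apply: Fz_in_twisted => //; lia.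
    rewrite /f /= val_tw // -rho_F //; last exact: (trW v').
    by rewrite -(expr0 'X) rho_off.
  - move=> s v'; have [Ja Jb] : idx (sg s * (n - 1)%N%:Z)%R /\ idx (- (sg s * n%:Z))%R.
      by rewrite abszN !absS; lia.
    have ab : absz (sg s * (n - 1)%N%:Z) <> absz (- (sg s * n%:Z)).
      by rewrite abszN !absS; lia.
    have tF : Fz (sg s * (n - 1)%N%:Z) (- (sg s * n%:Z)) 1 \in @in_twisted K n.
      by apply: Fz_in_twisted => //; lia.
    rewrite /f /= val_tw // -rho_F //; last exact: (trW v').
    by rewrite -(expr0 'X) rho_off.
  - move=> i Ji v'.
    have tF : Fz i i 'X - Fz i.+1 i.+1 'X \in @in_twisted K n.
      by apply: Fz_diag_in_twisted; lia.
    rewrite /f /= (val_tw tF) (rho_odd_diag charK n_gt4 soG tt t_sum tG); [|lia..].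
    rewrite Dz_sub; [|lia..]; rewrite comm_brDl comm_brNl rhoD rhoN.
    rewrite -!(rho_t charK n_gt4 soG tt t_sum tG); [|lia..].
    rewrite -lieBl t_diff; last by lia.
    (* It remains to identify the level 1 coroot with [h1 i]. By [f_X] its level 1 factor is
       [x false i 1], so this is [y1y] for the lower sign. *)
    congr [~ _, _]; rewrite /level_coroot; have Ji' : (0 < i <= n)%N by lia.
    have ai : na n i = i by rewrite /na; case: (i =P n); lia.
    have bi : nb n i = i.+1 by rewrite /nb; case: (i =P n); lia.
    have [Ja Jb ab] := node_idx n_gt4 Ji'.
    have := f_X false i 1%N Ji' isT; rewrite /Xm f_off //; last by auto.
    have [] := F_node i Ji'; rewrite ai bi => -> _ ->.
    have := y1y charK n_gt4 rels false Ji; rewrite /y1 /y0 /=.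
    by rewrite lieC => /eqP; rewrite eqr_opp => /eqP.

have f_H k r : (0 < k <= n)%N -> (r <= 1)%N ->
    f (tw (Hm k r)) = [~ x true k r, x false k 0].
  move=> Jk r1; rewrite (tw_Hm K n_gt4 r Jk).
  by rewrite f_lie; congr [~ _, _]; exact: f_X.
exists f; split=> // k Jk.
  by rewrite f_H // (dr_xx rels) // eqxx.
have Jk' : (0 < k <= n)%N by lia.
by rewrite f_H // (dr_x1x rels).
Qed.

End RhoMorphism.

(** * The defining relations verified on matrices *)

Section DrinfeldMatrices.
Variables (K : fieldType) (n : nat).
Hypothesis n_gt4 : (4 < n)%N.
Local Notation Fz := (@Fz K n (rank_gt0 n_gt4)).
Local Notation Xm := (@Xm K n n_gt4).
Local Notation Hm := (@Hm K n n_gt4).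
Local Notation idx i := (1 <= `|i| <= n)%N.

(** The eigenvalue of [F_{a,a}(u^r)] on [F_{k,l}(1)], up to the shift of level. The part with
    [(-1)^r] stems from the entry [- (- u)^r] at [(- a, - a)]. *)
Definition weight (r : nat) (a k l : int) : int :=
  (a == k)%:Z - (a == l)%:Z + (-1) ^+ r * ((a == - l)%:Z - (a == - k)%:Z).

Lemma conj1 : 1 \Po (- 'X) = 1 :> {poly K}.
Proof. by rewrite -polyC1 comp_polyC. Qed.

Lemma Fz_mulz i j c (z : int) : Fz i j (c *~ z) = Fz i j c *~ z.
Proof.
have FzMn m : Fz i j (c *+ m) = Fz i j c *+ m.
  by elim: m => [|m IH]; rewrite ?mulr0n ?Fz0 // !mulrSr FzD IH.
case: z => m; first by rewrite -!pmulrn FzMn.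
by rewrite NegzE !mulrNz -!pmulrn FzN FzMn.
Qed.

Lemma conj_Xn r : 'X^r \Po (- 'X) = 'X^r *~ ((-1) ^+ r)%R :> {poly K}.
Proof.
elim: r => [|r IH]; first by rewrite !expr0 conj1 mulr1z.
by rewrite !exprS comp_polyM IH comp_polyX mulN1r mulrNz mulNr mulrzAr.
Qed.

Lemma diag_bracket r a k l : idx a -> idx k -> idx l -> `|k|%N <> `|l|%N ->
  comm_br (Fz a a 'X^r) (Fz k l 1) = Fz k l 'X^r *~ weight r a k l.
Proof.
move=> Ja Jk Jl kl; rewrite Fz_bracket // conj1 mulr1 /weight.
have FzO : Fz (- l) (- k) 'X^r = - (Fz k l 'X^r *~ ((-1) ^+ r)%R).
  by rewrite Fz_opp // conj_Xn Fz_mulz.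
have [ak|/eqP ak] := eqVneq a k.
  rewrite ak in Ja *; deltas.
  by rewrite [X in _ *~ X](_ : _ = 1) ?mulr1z // mulr0 addr0.
have [al|/eqP al] := eqVneq a l.
  rewrite al in Ja *; deltas.
  by rewrite [X in _ *~ X](_ : _ = -1) ?mulrN1z // mulr0 addr0.
have [al'|/eqP al'] := eqVneq a (- l).
  rewrite al' in Ja *; deltas; rewrite FzO opprK.
  by rewrite [X in _ = _ *~ X](_ : _ = (-1) ^+ r) // mulr1.
have [ak'|/eqP ak'] := eqVneq a (- k).
  rewrite ak' in Ja *; deltas; rewrite FzO.
  by rewrite [X in _ = _ *~ X](_ : _ = - (-1) ^+ r) ?mulrNz // mulrN1.
by deltas; rewrite [X in _ = _ *~ X](_ : _ = 0) ?mulr0z // mulr0.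
Qed.

Lemma weight_opp r a k l : weight r a l k = - weight r a k l.
Proof. by rewrite /weight; ring. Qed.

Lemma na_last i : i = n -> na n i = (n - 1)%N%:Z /\ nb n i = - n%:Z.
Proof. by move=> ->; rewrite /na /nb eqxx. Qed.

Lemma na_lt i : i <> n -> na n i = i%:Z /\ nb n i = i.+1%:Z.
Proof. by rewrite /na /nb => /eqP/negbTE ->. Qed.

Lemma weight_pos r (a k l : nat) : (0 < a)%N -> (0 < k)%N -> (0 < l)%N ->
  weight r a k l = (a == k)%:Z - (a == l)%:Z.
Proof.
move=> a_gt0 k_gt0 l_gt0; rewrite /weight.
have -> : (a%:Z == - l%:Z) = false by lia.
have -> : (a%:Z == - k%:Z) = false by lia.
by rewrite subrr mulr0 addr0.
Qed.

Lemma weight_end r (a k l : nat) : (0 < a)%N -> (0 < k)%N -> (0 < l)%N ->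
  weight r a k (- l%:Z) = (a == k)%:Z + (-1) ^+ r * (a == l)%:Z.
Proof.
move=> a_gt0 k_gt0 l_gt0; rewrite /weight opprK.
have -> : (a%:Z == - l%:Z) = false by lia.
have -> : (a%:Z == - k%:Z) = false by lia.
by rewrite !subr0.
Qed.

Lemma weight_neg r (a k l : nat) : (0 < a)%N -> (0 < k)%N -> (0 < l)%N ->
  weight r (- a%:Z) k l = (-1) ^+ r * ((a == l)%:Z - (a == k)%:Z).
Proof.
move=> a_gt0 k_gt0 l_gt0; rewrite /weight !eqr_opp.
have -> : (- a%:Z == l%:Z) = false by lia.
have -> : (- a%:Z == k%:Z) = false by lia.
by rewrite subrr add0r.
Qed.

Lemma weight_neg_end r (a k l : nat) : (0 < a)%N -> (0 < k)%N -> (0 < l)%N ->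
  weight r (- a%:Z) k (- l%:Z) = - (a == l)%:Z - (-1) ^+ r * (a == k)%:Z.
Proof.
move=> a_gt0 k_gt0 l_gt0; rewrite /weight !eqr_opp.
have -> : (a%:Z == - l%:Z) = false by lia.
have -> : (- a%:Z == k%:Z) = false by lia.
by rewrite !sub0r mulrN.
Qed.

(** The bound [n - r] encodes the absence of [H_{n,1}]. For [i = n - 1] and [j = n] the sign
    [(-1)^r] turns [1 - 1] into [1 + 1], which is the extra 2 in [cartanr]. *)
Lemma weight_node r i j : (r <= 1)%N -> (0 < i <= n - r)%N -> (0 < j <= n)%N ->
  weight r (na n i) (na n j) (nb n j) - weight r (nb n i) (na n j) (nb n j)
  = cartanr n r i j.
Proof.
move=> r1 Ji Jj; have n1 : (0 < n - 1)%N by lia.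
have n_gt0 : (0 < n)%N by lia.
rewrite /cartanr /cartan.
have [i_n|/eqP i_n] := eqVneq i n; have [j_n|/eqP j_n] := eqVneq j n.
- have r0 : r = 0%N by lia.
  have [-> ->] := na_last i_n; have [-> ->] := na_last j_n.
  rewrite weight_end // weight_neg_end // r0 i_n j_n expr0 !mul1r /=.
  by rewrite (_ : (n <= n - 1)%N = false) //=; lia.
- have r0 : r = 0%N by lia.
  have [-> ->] := na_last i_n; have [-> ->] := na_lt j_n.
  rewrite weight_pos //; try lia; rewrite weight_neg //; try lia.
  rewrite r0 i_n expr0 !mul1r /= (_ : (n <= n - 1)%N = false) //=; last by lia.
  by clear -Jj j_n n_gt4; lia.
- have [-> ->] := na_lt i_n; have [-> ->] := na_last j_n.
  rewrite !weight_end //; try lia.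
  rewrite j_n (_ : (n <= n - 1)%N = false) ?andbF //=; last by lia.
  case: r r1 Ji => [|[|//]] _ Ji; rewrite ?expr0 ?expr1 ?mul1r ?mulN1r /=;
    clear -Ji i_n n_gt4; lia.
- have [-> ->] := na_lt i_n; have [-> ->] := na_lt j_n.
  rewrite !weight_pos //; try lia.
  have -> : (i <= n - 1)%N && (j <= n - 1)%N by lia.
  case: r r1 Ji => [|[|//]] _ Ji /=; clear -Ji i_n Jj j_n n_gt4; lia.
Qed.

Lemma Hm_Xm p i j r : (r <= 1)%N -> (0 < i <= n - r)%N -> (0 < j <= n)%N ->
  comm_br (Hm i r) (Xm p j 0) =
  Xm p j r *~ (if p then cartanr n r i j else - cartanr n r i j).
Proof.
move=> r1 Ji Jj; have Ji' : (0 < i <= n)%N by lia.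
have [Ja Jb ab] := node_idx n_gt4 Ji'; have [Ja' Jb' ab'] := node_idx n_gt4 Jj.
have wE := weight_node r1 Ji Jj.
case: p; rewrite /Hm /Xm comm_brDl comm_brNl !diag_bracket //; try (by auto).
  by rewrite -mulrzBr wE.
by rewrite -mulrzBr !(weight_opp r _ (na n j)) -wE opprB opprK addrC.
Qed.

(** Constants are fixed by [u -> - u], so the two entries cancel. This is why the root vectors of
    the two fork nodes [n - 1] and [n] commute: their brackets sit at such positions. *)
Lemma Fz_long_even i : idx i -> Fz i (- i) 1 = 0.
Proof.
by move=> Ji; rewrite /Fz /Fo conj1 !rev_oi ?abszN // opprK subrr.
Qed.

Lemma diag_commute a b c e : idx a -> idx b -> comm_br (Fz a a c) (Fz b b e) = 0.
Proof.
move=> Ja Jb; rewrite Fz_bracket //.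
have [->|/eqP ab] := eqVneq a b; first by deltas; rewrite subrr.
have [ab'|/eqP ab'] := eqVneq a (- b); last by deltas.
by rewrite ab' in Ja *; deltas; rewrite ?opprK addNr.
Qed.

Lemma comm_brBB (A B C D : 'M[{poly K}]_(2 * n)) :
  comm_br (A - B) (C - D) = comm_br A C - comm_br A D - (comm_br B C - comm_br B D).
Proof. by rewrite comm_brDl comm_brNl !comm_brDr !comm_brNr. Qed.

Lemma Hm_Hm i j r s : (0 < i <= n)%N -> (0 < j <= n)%N ->
  comm_br (Hm i r) (Hm j s) = 0.
Proof.
move=> Ji Jj; have [Ja Jb _] := node_idx n_gt4 Ji; have [Ja' Jb' _] := node_idx n_gt4 Jj.
by rewrite /Hm comm_brBB !diag_commute // !subrr.
Qed.

Lemma Xm_Xm i j : (0 < i <= n)%N -> (0 < j <= n)%N ->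
  comm_br (Xm true i 0) (Xm false j 0) = Hm i 0 *+ (i == j).
Proof.
move=> Ji Jj; have [<-|/eqP ij] := eqVneq i j.
  by rewrite -Hm_bracket.
have [Ja Jb ab] := node_idx n_gt4 Ji; have [Ja' Jb' ab'] := node_idx n_gt4 Jj.
rewrite /Xm Fz_bracket // !expr0 conj1 mulr1.
have -> : (nb n i == nb n j) = false.
  by rewrite /nb; case: (i =P n) => ?; case: (j =P n) => ?; lia.
have -> : (nb n i == - na n j) = false.
  by rewrite /na /nb; case: (i =P n) => ?; case: (j =P n) => ?; lia.
have -> : (- na n i == nb n j) = false.
  by rewrite /na /nb; case: (i =P n) => ?; case: (j =P n) => ?; lia.
have [aa|aa] := eqVneq (na n j) (na n i); last by rewrite !mulr0n !subr0 addr0.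
have bb : nb n i = - nb n j.
  by move: aa; rewrite /na /nb; case: (i =P n) => ?; case: (j =P n) => ?; lia.
rewrite bb !mulr0n Fz_long_even //.
by rewrite mul0rn !subr0 addr0.
Qed.

Lemma Xm_self p i r : (0 < i <= n)%N -> comm_br (Xm p i r) (Xm p i 0) = 0.
Proof.
move=> Ji; have [Ja Jb ab] := node_idx n_gt4 Ji.
by case: p; rewrite /Xm Fz_bracket //; deltas; zmodule.
Qed.

Lemma Xm_self' p i r : (0 < i <= n)%N -> comm_br (Xm p i 0) (Xm p i r) = 0.
Proof.
move=> Ji; have [Ja Jb ab] := node_idx n_gt4 Ji.
by case: p; rewrite /Xm Fz_bracket //; deltas; zmodule.
Qed.

Lemma cartan0 i j : (0 < i <= n)%N -> (0 < j <= n)%N -> cartan n i j = 0 ->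
  [/\ nb n i <> na n j, nb n j <> na n i & i <> j].
Proof.
rewrite /cartan /na /nb => Ji Jj; case: ifP => ?;
  by case: (i =P n) => ?; case: (j =P n) => ?; split; lia.
Qed.

Lemma cartanN1 i j : (0 < i <= n)%N -> (0 < j <= n)%N -> cartan n i j = -1 ->
  nb n i = na n j /\ `|na n i|%N <> `|nb n j|%N \/
  nb n j = na n i /\ `|na n j|%N <> `|nb n i|%N.
Proof.
rewrite /cartan /na /nb => Ji Jj; case: ifP => ?;
  by case: (i =P n) => ?; case: (j =P n) => ?; lia.
Qed.

Lemma Xm_serre0 p i j : (0 < i <= n)%N -> (0 < j <= n)%N -> cartan n i j = 0 ->
  comm_br (Xm p i 0) (Xm p j 0) = 0.
Proof.
move=> Ji Jj /(cartan0 Ji Jj)[ba ab' ij].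
have [Ja Jb ab] := node_idx n_gt4 Ji; have [Ja' Jb' ab''] := node_idx n_gt4 Jj.
have [aa|ne] : (na n i = na n j /\ nb n i = - nb n j) \/
    (nb n i <> - nb n j /\ na n i <> - na n j /\ nb n i <> - nb n j).
  by rewrite /na /nb; case: (i =P n) => ?; case: (j =P n) => ?; lia.
  have [aE bE] := aa; have Fz_long := Fz_long_even Ja'.
  have Fz_long' : Fz (- na n j) (na n j) 1 = 0.
    by rewrite -{2}[na n j]opprK Fz_long_even ?abszN.
  rewrite aE in ab *; rewrite bE in ab *.
  case: p; rewrite /Xm !expr0 aE bE Fz_bracket ?abszN // conj1 mulr1; deltas.
    by rewrite Fz_long oppr0.
  by rewrite Fz_long'.
have [n1 [n2 n3]] := ne.
by case: p; rewrite /Xm Fz_bracket // !expr0 conj1 mulr1; deltas.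
Qed.

Lemma bracket3 i j k : idx i -> idx j -> idx k -> `|i|%N <> `|j|%N ->
  `|i|%N <> `|k|%N -> `|j|%N <> `|k|%N ->
  comm_br (Fz i j 1) (comm_br (Fz i j 1) (Fz j k 1)) = 0 /\
  comm_br (Fz j k 1) (comm_br (Fz j k 1) (Fz i j 1)) = 0.
Proof.
move=> Ji Jj Jk ij ik jk; rewrite !Fz_bracket // conj1 !mulr1; deltas.
by rewrite comm_brNr !Fz_bracket //; split; deltas; rewrite ?oppr0.
Qed.

Lemma Xm_serre1 p i j : (0 < i <= n)%N -> (0 < j <= n)%N -> cartan n i j = -1 ->
  comm_br (Xm p i 0) (comm_br (Xm p i 0) (Xm p j 0)) = 0.
Proof.
move=> Ji Jj /(cartanN1 Ji Jj).
have [Ja Jb ab] := node_idx n_gt4 Ji; have [Ja' Jb' ab'] := node_idx n_gt4 Jj.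
rewrite /Xm !expr0; case=> [[ba aNb]|[ba aNb]].
  rewrite {}ba in Jb ab *.
  by case: p; [have [] := bracket3 Ja Ja' Jb'|have [] := bracket3 Jb' Ja' Ja]; auto.
rewrite {}ba in Jb' ab' *.
by case: p; [have [] := bracket3 Ja' Ja Jb|have [] := bracket3 Jb Ja Ja']; auto.
Qed.

End DrinfeldMatrices.

(** * The relations at the fork of the diagram *)

Section TailRelations.
Variables (K : fieldType) (n : nat).
Hypothesis charK : [pchar K] =i pred0.
Hypothesis n_gt4 : (4 < n)%N.
Local Notation Fz := (@Fz K n (rank_gt0 n_gt4)).
Local Notation Xm := (@Xm K n n_gt4).
Local Notation Hm := (@Hm K n n_gt4).
Local Notation idx i := (1 <= `|i| <= n)%N.

Lemma conjX : 'X \Po (- 'X) = - 'X :> {poly K}.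
Proof. exact: comp_polyX. Qed.

Lemma bracket_head_tail i j l c e : idx i -> idx j -> idx l ->
  `|i|%N <> `|j|%N -> `|l|%N <> `|j|%N -> `|i|%N <> `|l|%N ->
  comm_br (Fz i j c) (Fz j l e) = Fz i l (c * e).
Proof. by move=> Ji Jj Jl ij lj il; rewrite Fz_bracket //; deltas. Qed.

Lemma bracket_tail_head i j k c e : idx i -> idx j -> idx k ->
  `|i|%N <> `|j|%N -> `|k|%N <> `|j|%N -> `|i|%N <> `|k|%N ->
  comm_br (Fz i j c) (Fz k i e) = - Fz k j (c * e).
Proof. by move=> Ji Jj Jk ij kj ik; rewrite Fz_bracket //; deltas. Qed.

Lemma bracket_heads i j k c e : idx i -> idx j -> idx k ->
  `|i|%N <> `|j|%N -> `|k|%N <> `|j|%N -> i <> - k ->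
  comm_br (Fz i j c) (Fz k (- j) e) = - Fz i (- k) (c * (e \Po (- 'X))).
Proof. by move=> Ji Jj Jk ij kj ik; rewrite Fz_bracket ?abszN //; deltas. Qed.

Lemma bracket_tails i j l c e : idx i -> idx j -> idx l ->
  `|i|%N <> `|j|%N -> `|l|%N <> `|i|%N -> j <> - l ->
  comm_br (Fz i j c) (Fz (- i) l e) = Fz (- l) j (c * (e \Po (- 'X))).
Proof. by move=> Ji Jj Jl ij li jl; rewrite Fz_bracket ?abszN //; deltas. Qed.

Lemma bracket_apart i j k l c e : idx i -> idx j -> idx k -> idx l ->
  j <> k -> l <> i -> j <> - l -> i <> - k ->
  comm_br (Fz i j c) (Fz k l e) = 0.
Proof. by move=> Ji Jj Jk Jl jk li jl ik; rewrite Fz_bracket //; deltas. Qed.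

Section Fork.
Variables a b c : int.
Hypotheses (Ja : idx a) (Jb : idx b) (Jc : idx c).
Hypotheses (ab : `|a|%N <> `|b|%N) (ac : `|a|%N <> `|c|%N) (bc : `|b|%N <> `|c|%N).

(** Both double brackets are multiples of [F_{b,-a}(u)]; on the right [u] gets conjugated, which
    accounts for the sign of the relation. *)
Lemma fork_end1 :
  comm_br (Fz b (- c) 'X) (comm_br (Fz a b 1) (Fz b c 1)) =
    - comm_br (Fz b c 1) (comm_br (Fz a b 1) (Fz b (- c) 'X)).
Proof.
rewrite !bracket_head_tail ?abszN //; try (by auto).
rewrite -{2}[c]opprK !bracket_heads ?abszN //; try lia.
by rewrite mulr1 conj1 !mul1r conjX FzN mulr1 opprK.
Qed.

Lemma fork_end1_opp :
  comm_br (Fz (- c) b 'X) (comm_br (Fz b a 1) (Fz c b 1)) =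
    - comm_br (Fz c b 1) (comm_br (Fz b a 1) (Fz (- c) b 'X)).
Proof.
rewrite !bracket_tail_head ?abszN //; try lia.
rewrite !comm_brNr -{2}[c]opprK !bracket_tails ?abszN //; try lia.
by rewrite mulr1 conj1 !mul1r conjX FzN mulr1 opprK.
Qed.

(** The index [c] stands for [n] as well as for [- n], which exchanges the two fork nodes and so
    covers both relations of this shape. *)
Lemma fork_end2 :
  comm_br (comm_br (Fz b (- c) 1) (Fz a b 1)) (comm_br (Fz b (- c) 1) (Fz b c 'X)) = 0.
Proof.
rewrite bracket_tail_head ?abszN //; try lia.
rewrite -{3}[c]opprK bracket_heads ?abszN //; try lia.
rewrite comm_brNl comm_brNr bracket_apart ?abszN ?oppr0 //; lia.
Qed.

Lemma fork_end2_opp :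
  comm_br (comm_br (Fz (- c) b 1) (Fz b a 1)) (comm_br (Fz (- c) b 1) (Fz c b 'X)) = 0.
Proof.
rewrite bracket_head_tail ?abszN //; try lia.
rewrite -{3}[c]opprK bracket_tails ?abszN //; try lia.
rewrite bracket_apart ?abszN ?oppr0 //; lia.
Qed.

End Fork.

Lemma node_before k m : m.+1 = k -> (k <= n)%N -> na n m = m /\ nb n m = k.
Proof. by move=> <- m_n; apply: na_lt; lia. Qed.

Let pen : (n - 1).+1 = n. Proof. lia. Qed.
Let pen2 : (n - 2).+1 = (n - 1)%N. Proof. lia. Qed.

Lemma Xm_fork p r : [/\
  Xm p (n - 2) r = (if p then Fz (n - 2)%N (n - 1)%N 'X^r else Fz (n - 1)%N (n - 2)%N 'X^r),
  Xm p (n - 1) r = (if p then Fz (n - 1)%N n 'X^r else Fz n (n - 1)%N 'X^r) &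
  Xm p n r = (if p then Fz (n - 1)%N (- n%:Z) 'X^r else Fz (- n%:Z) (n - 1)%N 'X^r)].
Proof.
have [a2 b2] := node_before pen2 (leq_subr _ _).
have [a1 b1] := node_before pen (leqnn n).
have [a0 b0] := na_last (erefl n).
by rewrite /Xm a2 b2 a1 b1 a0 b0.
Qed.

Let Ja : idx (n - 2)%N. Proof. lia. Qed.
Let Jb : idx (n - 1)%N. Proof. lia. Qed.
Let Jc : idx n. Proof. lia. Qed.
Let JN : idx (- n%:Z). Proof. lia. Qed.

Lemma Xm_end1 p :
  comm_br (Xm p n 1) (comm_br (Xm p (n - 2) 0) (Xm p (n - 1) 0)) =
  - comm_br (Xm p (n - 1) 0) (comm_br (Xm p (n - 2) 0) (Xm p n 1)).
Proof.
have [-> -> _] := Xm_fork p 0; have [_ _ ->] := Xm_fork p 1; rewrite expr0 expr1.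
case: p; [apply: fork_end1 | apply: fork_end1_opp]; lia.
Qed.

Lemma Xm_end2 p :
  comm_br (comm_br (Xm p n 0) (Xm p (n - 2) 0))
          (comm_br (Xm p n 0) (Xm p (n - 1) 1)) = 0.
Proof.
have [-> _ ->] := Xm_fork p 0; have [_ -> _] := Xm_fork p 1; rewrite expr0 expr1.
case: p; [apply: fork_end2 | apply: fork_end2_opp]; lia.
Qed.

Lemma Xm_end3 p :
  comm_br (comm_br (Xm p (n - 1) 0) (Xm p (n - 2) 0))
          (comm_br (Xm p (n - 1) 0) (Xm p n 1)) = 0.
Proof.
have [-> -> _] := Xm_fork p 0; have [_ _ ->] := Xm_fork p 1; rewrite expr0 expr1.
have pN : `|(n - 1)%N|%N <> `|- n%:Z|%N /\ `|(n - 2)%N|%N <> `|- n%:Z|%N by lia.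
have pp : `|(n - 2)%N|%N <> `|(n - 1)%N|%N by lia.
have [bN aN] := pN.
have := fork_end2 Ja Jb JN pp aN bN; have := fork_end2_opp Ja Jb JN pp aN bN.
by rewrite !opprK; case: p.
Qed.

Lemma Hm_pen r : Hm (n - 1) r = Fz (n - 1)%N (n - 1)%N 'X^r - Fz n n 'X^r.
Proof.
have [a1 b1] := node_before pen (leqnn n).
by rewrite /Hm a1 b1.
Qed.

(** As [u] is odd, [F_{-n,-n}(u) = F_{n,n}(u)]: at level 1 the coroot of node [n] coincides with
    that of node [n - 1]. *)
Lemma Xm_fork_bracket : comm_br (Xm true n 1) (Xm false n 0) = Hm (n - 1) 1.
Proof.
rewrite -Hm_bracket; last lia.
have [a0 b0] := na_last (erefl n); rewrite Hm_pen /Hm a0 b0.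
by rewrite Fz_opp // expr1 conjX FzN opprK.
Qed.

(** The scaled bracket is [F_{n-1,n}(u^2)], hence the next one is [F_{n-1,n-1}(u^2) - F_{n,n}(u^2)].
    At even level these two terms have the same weight on the root of node [n]. *)
Lemma Xm_X2 p :
  comm_br (comm_br ((2^-1)%:P *: comm_br (Hm (n - 1) 1) (Xm true (n - 1) 1))
                   (Xm false (n - 1) 0)) (Xm p n 0) = 0.
Proof.
have [_ XT1 _] := Xm_fork true 1; have [_ XF0 _] := Xm_fork false 0.
have [_ _ X0] := Xm_fork p 0.
have bc : `|(n - 1)%N|%N <> `|n%:Z|%N by lia.
have -> : comm_br (Hm (n - 1) 1) (Xm true (n - 1) 1) = Fz (n - 1)%N n 'X^2 *+ 2.
  rewrite XT1 Hm_pen comm_brDl comm_brNl expr1 !Fz_bracket //; deltas.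
  by rewrite opprK -mulr2n.
have -> : (2^-1)%:P *: (Fz (n - 1)%N n 'X^2 *+ 2) = Fz (n - 1)%N n 'X^2.
  rewrite -scaler_nat scalerA -polyC_natr -polyCM mulVf ?scale1r //.
  exact: (two_neq0 charK).
rewrite XF0 expr0 Fz_bracket //; deltas.
rewrite mulr1 X0 expr0 comm_brDl comm_brNl.
have w : weight 2 (n - 1)%N (n - 1)%N (- n%:Z) = weight 2 n (n - 1)%N (- n%:Z).
  have n1_gt0 : (0 < n - 1)%N by lia.
  have n_gt0 := rank_gt0 n_gt4; have nn : (n == n - 1)%N = false by lia.
  rewrite (weight_end n_gt4 2 n1_gt0 n1_gt0 n_gt0) (weight_end n_gt4 2 n_gt0 n1_gt0 n_gt0).
  by rewrite !eqxx nn eq_sym nn sqrrN expr1n.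
have bN : `|(n - 1)%N|%N <> `|- n%:Z|%N by rewrite abszN.
case: p {X0}; rewrite !diag_bracket //; try (by auto); first by rewrite w subrr.
by rewrite !(weight_opp _ _ (n - 1)%N) w subrr.
Qed.
End TailRelations.

(** * Presented algebras as Lie algebras, and their morphisms *)

Section CommutatorLie.
Variables (K : fieldType) (X : Type) (rel : expr K X -> expr K X -> Prop).
Implicit Types a b c : presented rel.

Definition pr_lie a b : presented rel := a * b - b * a.

Fact pr_lie_linearl (k : K) a b c :
  pr_lie (k *: a + b) c = k *: pr_lie a c + pr_lie b c.
Proof.
by rewrite /pr_lie mulrDl mulrDr scalerBr -pr_scaleAl -pr_scaleAr; zmodule.
Qed.

Fact pr_lie_linearr (k : K) a b c :
  pr_lie c (k *: a + b) = k *: pr_lie c a + pr_lie c b.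
Proof.
by rewrite /pr_lie mulrDl mulrDr scalerBr -pr_scaleAl -pr_scaleAr; zmodule.
Qed.

Fact pr_liexx a : pr_lie a a = 0.
Proof. exact: subrr. Qed.

Fact pr_jacobi a b c :
  pr_lie a (pr_lie b c) + pr_lie b (pr_lie c a) + pr_lie c (pr_lie a b) = 0.
Proof.
rewrite /pr_lie !mulrBl !mulrBr !mulrA.
by zmodule.
Qed.

HB.instance Definition _ := Lmodule_isLieAlgebra.Build K (presented rel)
  pr_lie_linearl pr_lie_linearr pr_liexx pr_jacobi.

Lemma pr_lieE a b : [~ a, b] = a * b - b * a.
Proof. by []. Qed.

End CommutatorLie.

Section PresentedMorphisms.
Variables (K : fieldType) (X Y : Type).
Variables (rel : expr K X -> expr K X -> Prop) (rel' : expr K Y -> expr K Y -> Prop).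
Local Notation A := (presented rel).
Local Notation B := (presented rel').
Implicit Types (f g : A -> B) (phi : X -> B).

(* [Defs.eval] needs an [algType], which [presented rel'] is not. *)
Fixpoint pr_eval phi (e : expr K X) : B :=
  match e with
  | Gen x => phi x
  | EZero => 0
  | EOne => 1
  | EOpp a => - pr_eval phi a
  | EAdd a b => pr_eval phi a + pr_eval phi b
  | EMul a b => pr_eval phi a * pr_eval phi b
  | EScale c a => c *: pr_eval phi a
  end.

Lemma presented_lift phi :
  (forall a b, rel a b -> pr_eval phi a = pr_eval phi b) ->
  exists f, [/\ linear f, monoid_morphism f & forall x, f (cls rel (Gen x)) = phi x].
Proof.
move=> phi_rel; have phi_cong a b : cong rel a b -> pr_eval phi a = pr_eval phi b.
  elim=> {a b} //=; first by move=> a b c _ -> _ ->.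
  - by move=> a a' _ ->.
  - by move=> a a' b b' _ -> _ ->.
  - by move=> a a' b b' _ -> _ ->.
  - by move=> c a a' _ ->.
  - by move=> a b c; rewrite addrA.
  - by move=> a b; rewrite addrC.
  - by move=> a; rewrite add0r.
  - by move=> a; rewrite addNr.
  - by move=> a b c; rewrite mulrA.
  - by move=> a; rewrite mul1r.
  - by move=> a; rewrite mulr1.
  - by move=> a b c; rewrite mulrDl.
  - by move=> a b c; rewrite mulrDr.
  - by move=> k l a; rewrite scalerA.
  - by move=> a; rewrite scale1r.
  - by move=> k a b; rewrite scalerDr.
  - by move=> k l a; rewrite scalerDl.
  - by move=> k a b; rewrite pr_scaleAl.
  - by move=> k a b; rewrite pr_scaleAr.
pose f (x : A) : B := pr_eval phi (repr x).
have f_cls a : f (cls rel a) = pr_eval phi a by exact/phi_cong/cong_repr.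
exists f; split=> [k||x]; last exact: f_cls.
  by elim/cls_ind=> a; elim/cls_ind=> b; rewrite -clsZ -clsD !f_cls.
split; first by rewrite -cls1 f_cls.
by elim/cls_ind=> a; elim/cls_ind=> b; rewrite -clsM !f_cls.
Qed.

Lemma pr_linear f : linear f -> [/\ f 0 = 0, {morph f : a / - a},
  {morph f : a b / a + b} & forall c a, f (c *: a) = c *: f a].
Proof.
move=> f_lin.
pose F : {linear A -> B} := HB.pack f (GRing.isLinear.Build K A B _ f f_lin).
split; [exact: (raddf0 F) | exact: (raddfN F) | exact: (raddfD F) |].
exact: (linearZZ F).
Qed.

Lemma pr_morphism_lie f : linear f -> monoid_morphism f ->
  forall a b, f [~ a, b] = [~ f a, f b].
Proof.
by move=> /pr_linear[_ fN fD _] [_ fM] a b; rewrite !pr_lieE fD fN !fM.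
Qed.

Lemma presented_ext f g : linear f -> linear g ->
  monoid_morphism f -> monoid_morphism g ->
  (forall x, f (cls rel (Gen x)) = g (cls rel (Gen x))) -> f =1 g.
Proof.
move=> /pr_linear[f0 fN fD fZ] /pr_linear[g0 gN gD gZ] [f1 fM] [g1 gM] fg.
elim/cls_ind; elim=> [x|||a IHa|a IHa b IHb|a IHa b IHb|c a IHa].
- exact: fg.
- by rewrite cls0 f0 g0.
- by rewrite cls1 f1 g1.
- by rewrite clsN fN gN IHa.
- by rewrite clsD fD gD IHa IHb.
- by rewrite clsM fM gM IHa IHb.
- by rewrite clsZ fZ gZ IHa.
Qed.

End PresentedMorphisms.

(** * Passing between generators and symbols with unrestricted indices *)

Section Letters.
Variables (K : fieldType) (n : nat).

(** A decidable form of lying in the image of [expr_map val], the condition under which a relation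
    is imposed. *)
Fixpoint letters_ok (e : expr K symbol) : bool :=
  match e with
  | Gen g => is_gen n g
  | EZero | EOne => true
  | EOpp a | EScale _ a => letters_ok a
  | EAdd a b | EMul a b => letters_ok a && letters_ok b
  end.

Lemma letters_okP e : letters_ok e -> exists a : expr K (gen n), expr_map val a = e.
Proof.
elim: e => [g g_ok|||e IHe|e IHe e' IHe'|e IHe e' IHe'|c e IHe] /=.
- by exists (Gen (exist _ g g_ok : gen n)).
- by exists EZero.
- by exists EOne.
- by case/IHe=> a <-; exists (EOpp a).
- by case/andP=> /IHe[a <-] /IHe'[b <-]; exists (EAdd a b).
- by case/andP=> /IHe[a <-] /IHe'[b <-]; exists (EMul a b).
- by case/IHe=> a <-; exists (EScale c a).
Qed.

Lemma map_letters_ok (a : expr K (gen n)) : letters_ok (expr_map val a).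
Proof. by elim: a => //= [[]//|a -> b ->|a -> b ->]. Qed.

Local Notation rel := (@gen_rel K n).
Local Notation D := (presented rel).

(** The extension by 0 gives a value to every symbol, such as [GH n 1], so that total functions of
    the indices can be fed to [drinfeld_relations]. *)
Definition letter (g : symbol) : D :=
  if insub g is Some g' then cls rel (Gen (g' : gen n)) else 0.

Lemma letter_val (g : gen n) : letter (val g) = cls rel (Gen g).
Proof. by rewrite /letter valK. Qed.

Lemma letter_rel e e' : sym_rel n e e' -> letters_ok e -> letters_ok e' ->
  pr_eval letter e = pr_eval letter e'.
Proof.
have pr_eval_val a : pr_eval letter (expr_map val a) = cls rel a.
  elim: a => //= [g|a ->|a -> b ->|a -> b ->|c a ->].
  - exact: letter_val.
  - by rewrite clsN.
  - by rewrite clsD.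
  - by rewrite clsM.
  - by rewrite clsZ.
by move=> ee' /letters_okP[a ae] /letters_okP[b be']; move: ee';
  rewrite -ae -be' !pr_eval_val => ab; apply/clsP/cong_rel.
Qed.

Hypothesis n_gt4 : (4 < n)%N.

Lemma letter_relations : drinfeld_relations n (fun i => letter (GH i 0))
  (fun i => letter (GH i 1)) (fun s i r => letter (GX s i r)).
Proof.
split.
- move=> i j Ji Jj; apply: (letter_rel (rel_HH K n i j 0 0)) => //=; lia.
- move=> i j Ji Jj; apply: (letter_rel (rel_HH K n i j 0 1)) => //=; lia.
- move=> i j Ji Jj; apply: (letter_rel (rel_HH K n i j 1 1)) => //=; lia.
- move=> s i j Ji Jj; apply: (letter_rel (rel_HX K n s i j 0)) => //=; lia.
- move=> s i j Ji Jj; apply: (letter_rel (rel_HX K n s i j 1)) => //=; lia.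
- move=> i j Ji Jj; rewrite -scaler_nat.
  apply: (letter_rel (rel_XX K n i j)) => //=; lia.
- move=> i Ji; apply: (letter_rel (rel_X1X K (_ : i != n))) => //=; lia.
- move=> s i Ji; apply: (letter_rel (rel_X1X0 K n s i)) => //=; lia.
- move=> s i j Ji Jj c0; apply: (letter_rel (rel_serre0 K s c0)) => //=; lia.
- move=> s i j Ji Jj c1; apply: (letter_rel (rel_serre1 K s c1)) => //=; lia.
- move=> s; apply: (letter_rel (rel_end1 K n s)) => //=; lia.
Qed.

End Letters.

Local Arguments Xm : simpl never.
Local Arguments Hm : simpl never.

(** * The two mutually inverse morphisms *)

Section Isomorphism.
Variables (K : fieldType) (n : nat).
Hypothesis charK : [pchar K] =i pred0.
Hypothesis n_gt4 : (4 < n)%N.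
Local Notation Fz := (@Fz K n (rank_gt0 n_gt4)).
Local Notation Xm := (@Xm K n n_gt4).
Local Notation Hm := (@Hm K n n_gt4).
Local Notation W := (twisted K n).
Local Notation U := (presented (@uea_rel K W)).
Local Notation D := (presented (@gen_rel K n)).
Local Notation tws := (@in_twisted K n).

Definition uea_incl (w : W) : U := cls (@uea_rel K W) (Gen w).

Lemma uea_incl_linear (c : K) u v : uea_incl (c *: u + v) = c *: uea_incl u + uea_incl v.
Proof.
rewrite /uea_incl -clsZ -clsD; apply/clsP.
apply: cong_trans; first by apply: cong_rel; exact: uea_add.
by apply: cong_add; [apply: cong_rel; exact: uea_scale | exact: cong_refl].
Qed.

Lemma uea_incl_lie u v : uea_incl [~ u, v] = [~ uea_incl u, uea_incl v].
Proof.
rewrite pr_lieE /uea_incl -!clsM -clsN -clsD; apply/clsP/cong_rel; exact: uea_lie.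
Qed.

Lemma uea_incl0 : uea_incl 0 = 0.
Proof.
have := uea_incl_linear 1 0 0; rewrite !scale1r addr0 => i0.
by apply: (addrI (uea_incl 0)); rewrite -i0 addr0.
Qed.

Definition uea_tw A : U := uea_incl (tw A).

Lemma in_twisted_comm_br A B : A \in tws -> B \in tws -> comm_br A B \in tws.
Proof.
move=> tA tB; have := valP (lie (tw A) (tw B)).
by rewrite /= /twisted_lie /= !val_tw.
Qed.

Lemma in_twisted_scale (c : K) A : A \in tws -> c%:P *: A \in tws.
Proof. by move=> tA; rewrite -[_ *: _]addr0 in_twistedP ?in_twisted0. Qed.

Lemma uea_tw_lie A B : A \in tws -> B \in tws ->
  uea_tw A * uea_tw B - uea_tw B * uea_tw A = uea_tw (comm_br A B).
Proof. by move=> tA tB; rewrite -pr_lieE /uea_tw -uea_incl_lie tw_lie. Qed.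

Lemma tw0 : tw 0 = 0 :> W.
Proof. by apply: val_inj; rewrite val_tw ?in_twisted0. Qed.

Lemma uea_tw0 : uea_tw 0 = 0.
Proof. by rewrite /uea_tw tw0 uea_incl0. Qed.

Lemma uea_twZ (c : K) A : A \in tws -> uea_tw (c%:P *: A) = c *: uea_tw A.
Proof.
move=> tA; rewrite -[RHS]addr0 /uea_tw -[X in _ + X]uea_incl0 -uea_incl_linear addr0.
congr uea_incl.
by apply: val_inj; rewrite /= !val_tw ?in_twisted_scale.
Qed.

Lemma uea_twN A : A \in tws -> uea_tw (- A) = - uea_tw A.
Proof. by move=> tA; have := uea_twZ (-1) tA; rewrite rmorphN1 !scaleN1r. Qed.

Definition uea_letter (g : symbol) : U :=
  match g with
  | GH i r => uea_tw (Hm i r)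
  | GX s i r => uea_tw (Xm s i r)
  end.

(** Products alone do not come from matrices, but commutators do. Both sides of each relation are
    built from generators by commutators, opposites and scaling, so each relation becomes an
    identity of matrices. *)
Definition denotes (e : expr K symbol) A : Prop :=
  A \in tws /\ pr_eval uea_letter e = uea_tw A.

Lemma denotes_H i r : denotes (EH K i r) (Hm i r).
Proof. by split=> //; exact: Hm_in_twisted. Qed.

Lemma denotes_X s i r : (0 < i <= n)%N -> denotes (EX K s i r) (Xm s i r).
Proof. by move=> Ji; split=> //; exact: Xm_in_twisted. Qed.

Lemma denotes0 : denotes EZero 0.
Proof. by split; [exact: in_twisted0 | exact/esym/uea_tw0]. Qed.

Lemma denotesN e A : denotes e A -> denotes (EOpp e) (- A).
Proof. by move=> [tA eA]; split; [rewrite rpredN | rewrite uea_twN // -eA]. Qed.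

Lemma denotesZ c e A : denotes e A -> denotes (EScale c e) (c%:P *: A).
Proof. by move=> [tA eA]; split; [exact: in_twisted_scale | rewrite uea_twZ // -eA]. Qed.

Lemma denotes_lie e e' A A' : denotes e A -> denotes e' A' ->
  denotes [~ e, e']%E (comm_br A A').
Proof.
move=> [tA eA] [tA' eA']; split; first exact: in_twisted_comm_br.
by rewrite -uea_tw_lie // -eA -eA'.
Qed.

Lemma denotes_eq e e' A A' : denotes e A -> denotes e' A' -> A = A' ->
  pr_eval uea_letter e = pr_eval uea_letter e'.
Proof. by move=> [_ ->] [_ ->] ->. Qed.

Lemma uea_letter_rel e e' : sym_rel n e e' -> letters_ok n e -> letters_ok n e' ->
  pr_eval uea_letter e = pr_eval uea_letter e'.
Proof.
(* The bound [n - r] rules out the letter [GH n 1]. *)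
have genH i r : is_gen n (GH i r) -> (0 < i <= n - r)%N && (r <= 1)%N.
  by case: r => [|[|r]] //=; rewrite ?subn0 ?andbT.
have genX s i r : is_gen n (GX s i r) -> (0 < i <= n)%N by case/andP.
have J2 : (0 < n - 2 <= n)%N by lia.
have J1 : (0 < n - 1 <= n)%N by lia.
have Jn : (0 < n <= n)%N by lia.
case=> {e e'}.
- move=> i j r s /andP[/andP[/genH Ji /genH Jj] _] _.
  apply: denotes_eq (denotes_lie (denotes_H _ _) (denotes_H _ _)) denotes0 _.
  by apply: Hm_Hm; lia.
- move=> p i j r /andP[/andP[/genH Ji /genX Jj] _] _.
  apply: denotes_eq (denotes_lie (denotes_H _ _) (denotes_X _ _ Jj))
    (denotesZ _ (denotes_X _ _ Jj)) _.
  rewrite Hm_Xm; [|lia..].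
  by rewrite /with_sign rmorph_int scaler_int.
- move=> i j /andP[/andP[/genX Ji /genX Jj] _] _.
  apply: denotes_eq (denotes_lie (denotes_X _ _ Ji) (denotes_X _ _ Jj))
    (denotesZ _ (denotes_H _ _)) _.
  by rewrite Xm_Xm // polyC_natr scaler_nat.
- move=> i _ /andP[/andP[/genX Ji _] _] _.
  apply: denotes_eq (denotes_lie (denotes_X _ _ Ji) (denotes_X _ _ Ji)) (denotes_H _ _) _.
  by rewrite Hm_bracket.
- move=> p X2 _ _.
  apply: denotes_eq (denotes_lie (denotes_lie (denotesZ _ (denotes_lie (denotes_H _ _)
    (denotes_X _ _ J1))) (denotes_X _ _ J1)) (denotes_X _ _ Jn)) denotes0 _.
  exact: Xm_X2.
- move=> _ _.
  apply: denotes_eq (denotes_lie (denotes_X _ _ Jn) (denotes_X _ _ Jn)) (denotes_H _ _) _.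
  exact: Xm_fork_bracket.
- move=> p i /andP[/andP[/genX Ji _] _] _.
  apply: denotes_eq (denotes_lie (denotes_X _ _ Ji) (denotes_X _ _ Ji))
    (denotes_lie (denotes_X _ _ Ji) (denotes_X _ _ Ji)) _.
  by rewrite Xm_self // Xm_self'.
- move=> p i j c0 /andP[/andP[/genX Ji /genX Jj] _] _.
  apply: denotes_eq (denotes_lie (denotes_X _ _ Ji) (denotes_X _ _ Jj)) denotes0 _.
  exact: Xm_serre0.
- move=> p i j c1 /andP[/andP[/genX Ji /andP[/andP[_ /genX Jj] _]] _] _.
  apply: denotes_eq (denotes_lie (denotes_X _ _ Ji)
    (denotes_lie (denotes_X _ _ Ji) (denotes_X _ _ Jj)))
    denotes0 _.
  exact: Xm_serre1.
- move=> p _ _.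
  apply: denotes_eq
    (denotes_lie (denotes_X _ _ Jn) (denotes_lie (denotes_X _ _ J2) (denotes_X _ _ J1)))
    (denotesN (denotes_lie (denotes_X _ _ J1)
      (denotes_lie (denotes_X _ _ J2) (denotes_X _ _ Jn)))) _.
  exact: Xm_end1.
- move=> p _ _.
  apply: denotes_eq (denotes_lie (denotes_lie (denotes_X _ _ Jn) (denotes_X _ _ J2))
    (denotes_lie (denotes_X _ _ Jn) (denotes_X _ _ J1))) denotes0 _.
  exact: Xm_end2.
- move=> p _ _.
  apply: denotes_eq (denotes_lie (denotes_lie (denotes_X _ _ J1) (denotes_X _ _ J2))
    (denotes_lie (denotes_X _ _ J1) (denotes_X _ _ Jn))) denotes0 _.
  exact: Xm_end3.
Qed.

Theorem uea_drinfeld_iso :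
  exists2 F : U -> D, linear F /\ monoid_morphism F & bijective F.
Proof.
have [f [f_lin f_lie f_X f_H0 f_H1]] := twisted_to_drinfeld charK n_gt4 (letter_relations K n_gt4).
have fD u v : f (u + v) = f u + f v by have := f_lin 1 u v; rewrite !scale1r.
have f0 : f 0 = 0 by apply: (addrI (f 0)); rewrite -fD !addr0.
have fZ c u : f (c *: u) = c *: f u by have := f_lin c u 0; rewrite f0 !addr0.
have [F [F_lin F_mor F_gen]] : exists F : U -> D,
    [/\ linear F, monoid_morphism F & forall w, F (cls (@uea_rel K W) (Gen w)) = f w].
  by apply: presented_lift => e e' [u v|c u|u v] /=; [exact: fD | exact: fZ | exact: f_lie].
have [G [G_lin G_mor G_gen]] : exists G : D -> U, [/\ linear G, monoid_morphism G &
    forall g : gen n, G (cls (@gen_rel K n) (Gen g)) = uea_letter (val g)].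
  apply: presented_lift => e e' ee'.
  have pr_eval_val a : pr_eval (fun g : gen n => uea_letter (val g)) a =
      pr_eval uea_letter (expr_map val a).
    by elim: a => //= [a ->|a -> b ->|a -> b ->|c a ->].
  by rewrite !pr_eval_val; apply: uea_letter_rel; rewrite ?map_letters_ok.
have G_letter g : is_gen n g -> G (letter K n g) = uea_letter g.
  by move=> g_ok; have := G_gen (exist _ g g_ok); rewrite -letter_val.
have [F1 FM] := F_mor; have [G1 GM] := G_mor.
exists F; first by [].
have [_ GN _ _] := pr_linear G_lin.
have GfX s i r : (0 < i <= n)%N -> (r <= 1)%N -> G (f (tw (Xm s i r))) = uea_tw (Xm s i r).
  by move=> Ji r1; rewrite f_X // G_letter //= r1 andbT.
(* For the sign [-], the elements in [twisted_generated] are opposites of the matrices [Xm], since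
   [F_{-i,-j}(1) = - F_{j,i}(1)]. *)
have GfXN s i : (0 < i <= n)%N -> G (f (tw (- Xm s i 0))) = uea_tw (- Xm s i 0).
  move=> Ji; rewrite uea_twN ?Xm_in_twisted // -GfX // -GN; congr G.
  rewrite -[RHS]scaleN1r -fZ; congr f; apply: val_inj.
  by rewrite /= !val_tw ?rpredN ?Xm_in_twisted // rmorphN1 scaleN1r.
have Fz_neg i j : (1 <= `|i| <= n)%N -> (1 <= `|j| <= n)%N ->
    Fz (- i) (- j) 1 = - Fz j i 1 by move=> Ji Jj; rewrite Fz_opp // conj1.
(* Both sides are linear and compatible with brackets, so they are compared on the generating set of
   the twisted algebra only. *)
have Gf w : G (f w) = uea_incl w.
  move: w; apply: (twisted_generated charK (n_gt4 := n_gt4)).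
  - by move=> c w w' Gfw Gfw'; rewrite f_lin G_lin uea_incl_linear Gfw Gfw'.
  - by move=> w w' Gfw Gfw'; rewrite f_lie pr_morphism_lie // uea_incl_lie Gfw Gfw'.
  - move=> s i Ji; have ni : i <> n by lia.
    have [ai bi] := na_lt ni.
    have Ji' : (0 < i <= n)%N by lia.
    case: s; rewrite /sg ?mul1r ?mulN1r.
      by have := GfX true i 0%N Ji' isT; rewrite /Xm ai bi.
    rewrite Fz_neg; [|lia..].
    by have := GfXN false i Ji'; rewrite /Xm ai bi.
  - move=> s; have [an bn] := na_last (erefl n).
    have Jn : (0 < n <= n)%N by lia.
    case: s; rewrite /sg ?mul1r ?mulN1r.
      by have := GfX true n 0%N Jn isT; rewrite /Xm an bn.
    rewrite Fz_neg; [|lia..].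
    by have := GfXN false n Jn; rewrite /Xm an bn.
  - move=> i Ji; have ni : i <> n by lia.
    have [ai bi] := na_lt ni.
    have HmE : Hm i 1 = Fz i i 'X - Fz i.+1 i.+1 'X by rewrite /Hm ai bi.
    have i_ok : is_gen n (GH i 1) by clear -Ji; rewrite /=; lia.
    by rewrite -HmE f_H1 // G_letter.
exists G => [u|d].
  apply: (@presented_ext K W W (@uea_rel K W) (@uea_rel K W) (G \o F) id) => //.
  - by move=> c a b /=; rewrite F_lin G_lin.
  - by split=> [|a b] /=; rewrite ?F1 ?G1 ?FM ?GM.
  by move=> w /=; rewrite F_gen Gf.
apply: (@presented_ext K (gen n) (gen n) (@gen_rel K n) (@gen_rel K n) (F \o G) id) => //.
- by move=> c a b /=; rewrite G_lin F_lin.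
- by split=> [|a b] /=; rewrite ?G1 ?F1 ?GM ?FM.
move=> [g g_ok] /=; rewrite G_gen -letter_val /=.
case: g g_ok => [i r|s i r] g_ok /=; rewrite F_gen.
- by case: r g_ok => [|[|//]] Ji; [apply: f_H0 | apply: f_H1]; move: Ji; rewrite /=; lia.
- apply: f_X; move: g_ok => /=; lia.
Qed.

End Isomorphism.

Theorem theorem4p1 (R : realType) (n : nat) (n_gt4 : (4 < n)%N) :
  exists f : {linear uea (twisted R[i] n) -> drinfeld_alg R[i] n},
    GRing.monoid_morphism f /\ bijective f.
Proof.
have [F [F_lin F_mor] F_bij] := uea_drinfeld_iso (Num.Theory.pchar_num R[i]) n_gt4.
pose f : {linear uea (twisted R[i] n) -> drinfeld_alg R[i] n} := HB.pack F
  (GRing.isLinear.Build R[i] (uea (twisted R[i] n)) (drinfeld_alg R[i] n) _ F F_lin).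
by exists f.
Qed.
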